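(* For every $\omega<0$ there exists a global minimizer $\Psi(\cdot,\omega)\in H^1_{\rm C}(\mathcal{T})$ of the constrained minimization problem $$\mathcal{B}(\omega)=\inf_{U\in H^1_{\rm C}(\mathcal{T})}\left\{B_\omega(U):\ \|U\|_{L^6(\mathcal{T})}=1\right\},$$ and it yields, via $\Phi(\cdot,\omega):=\left(\tfrac13\mathcal{B}(\omega)\right)^{1/4}\Psi(\cdot,\omega)$, a strong solution $\Phi(\cdot,\omega)\in H^2_{\rm NK}(\mathcal{T})$ of the stationary NLS equation $-\Delta\Phi-3|\Phi|^4\Phi=\omega\Phi$. The function $\Phi=(u,v)$ is real up to a phase rotation (multiplication by a constant of modulus one), positive up to the choice of sign, symmetric on $[-\pi,\pi]$ (that is, $u(-x)=u(x)$), and monotonically decreasing on $[0,\pi]$ and on $[0,\infty)$ (that is, after the choice of phase and sign, $u$ is decreasing on $[0,\pi]$ and $v$ is decreasing on $[0,\infty)$).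
   Context: The tadpole graph $\mathcal{T}$ consists of a circle, identified with $[-\pi,\pi]$ with both end points attached to a single vertex, and a half-line $[0,\infty)$ attached at $0$ to the same vertex. Functions on $\mathcal{T}$ are (complex-valued) pairs $U=(u,v)$ with $u$ on $[-\pi,\pi]$ and $v$ on $[0,\infty)$; $L^q(\mathcal{T})$ norms are defined by $\|U\|_{L^q(\mathcal{T})}^q=\|u\|_{L^q(-\pi,\pi)}^q+\|v\|_{L^q(0,\infty)}^q$, and $\nabla U=(u',v')$, $\Delta U=(u'',v'')$ componentwise. $H^1_{\rm C}(\mathcal{T})$ is the space of $(u,v)\in H^1(-\pi,\pi)\times H^1(0,\infty)$ with $u(\pi)=u(-\pi)=v(0)$. $H^2_{\rm NK}(\mathcal{T})$ is the space of $(u,v)\in H^2(-\pi,\pi)\times H^2(0,\infty)$ satisfying the Neumann--Kirchhoff conditions $u(\pi)=u(-\pi)=v(0)$ and $u'(\pi)-u'(-\pi)=v'(0)$. $B_\omega(U):=\|\nabla U\|_{L^2(\mathcal{T})}^2-\omega\|U\|_{L^2(\mathcal{T})}^2$. *)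

(* Defs.v *)
From HB Require Import structures.
From mathcomp Require Import all_boot all_order all_algebra.
From mathcomp Require Import all_classical all_reals all_analysis.
From mathcomp.real_closed Require Import complex.

Set Implicit Arguments.
Unset Strict Implicit.
Unset Printing Implicit Defensive.

Import Order.TTheory GRing.Theory Num.Theory.
Import numFieldNormedType.Exports.

Local Open Scope classical_set_scope.
Local Open Scope ring_scope.
Local Open Scope complex_scope.

Section Edge.
Context {R : realType}.
Implicit Types (D : set R) (f g : R -> R[i]) (phi : R -> R).

Notation mu := (@lebesgue_measure R).

Definition cabs (z : R[i]) : R := ComplexField.Normc.normc z.

Definition Cintegral D f : R[i] :=
  (\int[mu]_(x in D) complex.Re (f x))%R +i*
  (\int[mu]_(x in D) complex.Im (f x))%R.

Definition in_L2 D f : Prop :=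
  [/\ measurable_fun D (fun x => complex.Re (f x)),
      measurable_fun D (fun x => complex.Im (f x)) &
      (\int[mu]_(x in D) (cabs (f x) ^+ 2)%:E < +oo)%E].

(* Test functions of class C^1 with compact support in the open set D. *)
Definition C1c D phi : Prop :=
  [/\ forall x, derivable phi x 1,
      continuous (derive1 phi),
      compact (closure [set x | phi x != 0]) &
      closure [set x | phi x != 0] `<=` D].

(* Testing against C^1_c instead of C^oo_c is the convention of Brezis
   (Functional Analysis, Sobolev Spaces and PDEs, section 8.2); by
   mollification both give the same notion.  Real test functions suffice by
   linearity. *)
Definition is_weak_derivative D f g : Prop :=
  in_L2 D g /\
  forall phi, C1c D phi ->
    Cintegral D (fun x => f x * (derive1 phi x)%:C) =
    - Cintegral D (fun x => g x * (phi x)%:C).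

(* A weak derivative is only determined almost everywhere; this is an
   arbitrary representative, and 0 if there is none. *)
Definition weak_derivative D f : R -> R[i] :=
  xget (fun=> 0) [set g | is_weak_derivative D f g].

Definition continuous_on (A : set R) f : Prop :=
  {within A, continuous (fun x => complex.Re (f x))} /\
  {within A, continuous (fun x => complex.Im (f x))}.

(* Elements of H^1 are represented by their representative that is continuous
   up to the boundary, so that the boundary values are the values of f; what f
   does outside closure D is irrelevant. *)
Definition in_H1 D f : Prop :=
  [/\ in_L2 D f,
      exists g, is_weak_derivative D f g &
      continuous_on (closure D) f].

(* f is in H^2(D), and g is the H^1 representative of its derivative. *)
Definition in_H2 D f g : Prop :=
  [/\ in_H1 D f, is_weak_derivative D f g & in_H1 D g].

End Edge.

Section Tadpole.
Context {R : realType}.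

Notation mu := (@lebesgue_measure R).

(* The interiors of the circle and of the half-line. *)
Definition circ : set R := `](- pi), pi[.
Definition halfline : set R := `]0, +oo[.

Definition tfun : Type := (R -> R[i]) * (R -> R[i]).

Implicit Types U : tfun.

Definition tscale (c : R[i]) U : tfun :=
  (fun x => c * U.1 x, fun x => c * U.2 x).

Definition Lqnorm (q : nat) U : \bar R :=
  ((\int[mu]_(x in circ) (cabs (U.1 x) ^+ q)%:E +
    \int[mu]_(x in halfline) (cabs (U.2 x) ^+ q)%:E) `^ (q%:R^-1)%R)%E.

Definition grad U : tfun :=
  (weak_derivative circ U.1, weak_derivative halfline U.2).

Definition laplacian U : tfun := grad (grad U).

Definition H1C U : Prop :=
  [/\ in_H1 circ U.1, in_H1 halfline U.2,
      U.1 pi = U.1 (- pi) & U.1 (- pi) = U.2 0].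

Definition H2NK U : Prop :=
  exists dU : tfun,
    [/\ in_H2 circ U.1 dU.1, in_H2 halfline U.2 dU.2,
        U.1 pi = U.1 (- pi), U.1 (- pi) = U.2 0 &
        dU.1 pi - dU.1 (- pi) = dU.2 0].

Definition B_form (omega : R) U : R :=
  fine (Lqnorm 2 (grad U)) ^+ 2 - omega * fine (Lqnorm 2 U) ^+ 2.

Definition constraint_set : set tfun :=
  [set U | H1C U /\ Lqnorm 6 U = 1%E].

Definition B_inf (omega : R) : R :=
  inf [set B_form omega U | U in constraint_set].

Definition is_global_minimizer (omega : R) (Psi : tfun) : Prop :=
  constraint_set Psi /\
  forall U, constraint_set U -> B_form omega Psi <= B_form omega U.

Definition stationary_NLS (omega : R) U : Prop :=
  {ae mu, forall x, circ x ->
     - (laplacian U).1 x - 3%:R * (cabs (U.1 x) ^+ 4)%:C * U.1 x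
     = omega%:C * U.1 x} /\
  {ae mu, forall x, halfline x ->
     - (laplacian U).2 x - 3%:R * (cabs (U.2 x) ^+ 4)%:C * U.2 x
     = omega%:C * U.2 x}.

Definition strong_solution (omega : R) U : Prop :=
  H2NK U /\ stationary_NLS omega U.

Definition strictly_decreasing_on (A : set R) (f : R -> R) : Prop :=
  forall x y, A x -> A y -> x < y -> f y < f x.

End Tadpole.

Arguments tfun : clear implicits.

(* Main.v *)
Require Import Defs.
From HB Require Import structures.
From mathcomp Require Import all_boot all_order all_algebra.
From mathcomp Require Import all_classical all_reals all_analysis.
From mathcomp Require Import measurable_realfun.
From mathcomp.real_closed Require Import complex.
From mathcomp Require Import ring lra.

Import Order.TTheory GRing.Theory Num.Theory.
Import numFieldNormedType.Exports.

Local Open Scope classical_set_scope.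
Local Open Scope ring_scope.
Local Open Scope complex_scope.

(** Why the theorem holds.  Put a = -omega.  The functional B_omega is quadratic
    and the L^6 norm is homogeneous, so minimizing B_omega on the unit sphere of
    L^6 amounts to maximizing the integral of |U|^6 under B_omega(U) <= 1; if [best]
    denotes that maximum, the minimum is best^(-1/3).

    Passing from U to |U| does not increase the energy, so the maximization
    concerns real functions F >= 0.  The tadpole is unrolled into [-h, +oo[ with
    the points -h and h identified (here h = pi), and F is one function of one
    real variable.  Its Dirichlet energy is at most c when some function A with
    total increase at most c satisfies (F y - F x)^2 <= (y - x) (A y - A x) for
    x <= y: the choice A x = integral of |F'|^2 up to x gives this by Cauchy and
    Schwarz.  The condition mentions no derivative, is stable under
    pointwise limits, and is checked by hand for rearranged or piecewise affine
    functions; [budget] is the resulting form of B_omega(F) <= j.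

    Existence of a maximizer ([exists_maximizer]).  Each F is replaced by its
    decreasing rearrangement f on [0, +oo[, laid out symmetrically around the
    middle of the circle: f(2|x|) on the circle, f(x + h) on the half-line.  This
    keeps the L^2 and L^6 norms.  The energy does not increase, because F crosses
    every band s < F < t at least once, and at least twice when {F > s} is too
    small to contain the circle ([rearr_energy], [rearr_energy2]); the factor
    4 = 2^2 won there pays for compressing f by 2 on the circle.  Profiles are
    decreasing and of bounded mass, hence f(x)^2 <= 1 / (a x), so no L^6 mass
    escapes to infinity, and a pointwise cluster point of a maximizing sequence of
    profiles is a maximizer.

    Euler-Lagrange equation ([euler_lagrange], [maximizer_smooth]).  Only piecewise
    affine variations are used, since their effect on the energy is explicit.
    Hat functions show that W minus a second primitive of a W - W^5 / best is affine
    on each edge, and one variation that is 1 at the vertex gives the Kirchhoff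
    condition.  So W solves W'' = a W - W^5 / best on both edges.

    Strict monotonicity ([smooth_decreasing]).  If W were constant on an interval,
    uniqueness for the differential equation, together with the symmetry of W and
    Kirchhoff's condition at the vertex, would make W constant on the whole tadpole,
    which is impossible for a nonzero function of finite mass.  Positivity follows.

    Sobolev functions.  A weak derivative controls increments, tested
    by C^1 plateau functions ([weak_increment]), so every admissible U has
    an unrolled modulus with budget B_omega(U) ([constraint_budget]).  Conversely the
    classical derivatives of W are its weak ones, and weak derivatives are
    unique almost everywhere ([weak_derivative_unique]), so W gives an admissible
    function that attains the bound.  Multiplying by m with 3 m^4 = 1 / best turns
    the Euler-Lagrange equation into the stationary NLS equation; this is the
    factor (B/3)^(1/4) applied to the normalized minimizer. *)

Set Implicit Arguments.
Unset Strict Implicit.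
Unset Printing Implicit Defensive.

(** * Primitives and integrals of continuous functions *)

Section Calculus.
Context {R : realType}.
Notation mu := (@lebesgue_measure R).
Implicit Types (f g F G B : R -> R) (a b c p q x y : R).

Lemma is_derive_continuous f x d : is_derive x 1 f d -> f t @[t --> x] --> f x.
Proof.
move=> [df _]; apply: differentiable_continuous; exact/derivable1_diffP.
Qed.

Lemma Rintegral_FTC_within f F a b : a <= b -> {within `[a, b], continuous f} ->
  (forall x, a < x -> x < b -> is_derive x 1 F (f x)) ->
  {within `[a, b], continuous F} ->
  \int[mu]_(x in `[a, b]) f x = F b - F a.
Proof.
rewrite le_eqVlt => /predU1P[-> _ _ _|ab cf dF cF].
  by rewrite set_itv1 Rintegral_set1 subrr.
rewrite /Rintegral (@continuous_FTC2 _ f F)//.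
- have [? ? ?] := (continuous_within_itvP F ab).1 cF.
  split => // x; rewrite in_itv/= => /andP[ax xb].
  by have [] := dF x ax xb.
move=> x; rewrite in_itv/= => /andP[ax xb].
by rewrite derive1E; have := dF x ax xb => -[].
Qed.

Lemma Rintegral_FTC f F a b : a <= b -> continuous f ->
  (forall x, a < x -> x < b -> is_derive x 1 F (f x)) ->
  {within `[a, b], continuous F} ->
  \int[mu]_(x in `[a, b]) f x = F b - F a.
Proof. by move=> ab cf; apply: Rintegral_FTC_within => //; exact: continuous_subspaceT. Qed.

(** The increments of B are squeezed between those of linear functions whose slopes tend
    to g x. *)
Lemma is_derive_near g B x e : 0 < e -> g t @[t --> x] --> g x ->
  (forall y, `|y - x| < e -> forall k1 k2,
     (forall z, Num.min x y <= z -> z <= Num.max x y -> k1 <= g z <= k2) ->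
     k1 * (Num.max x y - Num.min x y) <= B (Num.max x y) - B (Num.min x y)
       <= k2 * (Num.max x y - Num.min x y)) ->
  is_derive x 1 B (g x).
Proof.
move=> e0 cg h.
suff lim : (fun d => d^-1 *: ((B \o shift x) (d *: 1) - B x)) @ 0^' --> g x.
  by apply: DeriveDef; [apply/cvg_ex; exists (g x)|exact: cvg_lim].
apply/cvgrPdist_le => /= d d0.
have /cvgrPdist_le/(_ _ d0) /nbhs_ballP[e' /= e'0 he'] := cg.
near=> t.
have t0 : t != 0 by near: t; exact: nbhs_dnbhs_neq.
have te : `|t| < Num.min e e'.
  near: t; apply: dnbhs0_lt; by rewrite lt_min e0 e'0.
rewrite lt_min in te; move/andP: te => [te te'].
rewrite [t *: 1]mulr1.
have := h (t + x) _ (g x - d) (g x + d).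
rewrite addrK => /(_ te).
have hz z : Num.min x (t + x) <= z -> z <= Num.max x (t + x) -> g x - d <= g z <= g x + d.
  move=> z1 z2.
  have : `|x - z| < e'.
    apply: le_lt_trans te'.
    move: z1 z2; case: (leP x (t + x)) => xt z1 z2.
      rewrite ler0_norm ?subr_le0// ger0_norm; lra.
    rewrite ger0_norm ?subr_ge0// ltr0_norm; lra.
  by move=> /he' /=; rewrite ler_norml; lra.
move=> /(_ hz).
rewrite /= -[X in `|X| <= _](_ : t^-1 * (t * g x - (B (t + x) - B x)) = _); last first.
  by rewrite mulrBr mulrA mulVf// mul1r.
rewrite normrM normfV ler_pdivrMl ?normr_gt0// ler_norml.
case: (leP x (t + x)) => xt.
  rewrite ger0_norm; [|lra].
  by move=> /andP[h1 h2]; apply/andP; split; lra.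
rewrite ltr0_norm; [|lra].
by move=> /andP[h1 h2]; apply/andP; split; lra.
Unshelve. all: by end_near. Qed.

(** B is a primitive of g in the sense of lower and upper rectangle sums. Unlike a
    derivative, this condition makes sense up to the end points, so it can be glued
    across a point where g has a kink. *)
Definition primitive_on p q g B := forall x y, p <= x -> x <= y -> y <= q ->
  forall k1 k2, (forall z, x <= z -> z <= y -> k1 <= g z <= k2) ->
  k1 * (y - x) <= B y - B x <= k2 * (y - x).

Lemma primitive_on_glue p c q g B : primitive_on p c g B -> primitive_on c q g B ->
  primitive_on p q g B.
Proof.
move=> h1 h2 x y px xy yq k1 k2 h.
have [yc|cy] := leP y c; first exact: h1.
have [cx|xc] := leP c x; first exact: h2.
have /andP[a1 a2] := h1 x c px (ltW xc) (lexx c) k1 k2 (fun z xz zc => h z xz (le_trans zc (ltW cy))).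
have /andP[b1 b2] := h2 c y (lexx c) (ltW cy) yq k1 k2 (fun z cz zy => h z (le_trans (ltW xc) cz) zy).
by apply/andP; split; lra.
Qed.

(** For monotone g the two end values are the extreme values, whichever the direction of
    monotonicity. *)
Lemma primitive_on_monotone p q g B :
  (forall x y, p <= x -> x <= y -> y <= q ->
     (g x * (y - x) <= B y - B x <= g y * (y - x)) \/
     (g y * (y - x) <= B y - B x <= g x * (y - x))) ->
  primitive_on p q g B.
Proof.
move=> h x y px xy yq k1 k2 hz; have yx : 0 <= y - x by rewrite subr_ge0.
have /andP[x1 x2] := hz x (lexx x) xy; have /andP[y1 y2] := hz y xy (lexx y).
have u1 := ler_wpM2r yx x1; have u2 := ler_wpM2r yx x2.
have u3 := ler_wpM2r yx y1; have u4 := ler_wpM2r yx y2.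
by have [|] := h x y px xy yq => /andP[h1 h2]; apply/andP; split; lra.
Qed.

Lemma Rintegral_primitive p q g B : p <= q -> continuous g -> primitive_on p q g B ->
  \int[mu]_(x in `[p, q]) g x = B q - B p.
Proof.
move=> pq cg hB.
have [M hM] : exists M, forall z, p <= z -> z <= q -> `|g z| <= M.
  have [M [_ hM]] := compact_bounded (continuous_compact
    (continuous_subspaceT cg) (@segment_compact _ p q)).
  exists (M + 1) => z pz zq; apply: (hM (M + 1)); first by rewrite ltrDl.
  by exists z => //=; rewrite in_itv/= pz zq.
have lip x y : p <= x -> x <= y -> y <= q -> `|B y - B x| <= M * (y - x).
  move=> px xy yq.
  have := hB x y px xy yq (- M) M; rewrite mulNr ler_norml; apply => z xz zy.
  by rewrite -ler_norml hM ?(le_trans px)// (le_trans zy).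
apply: Rintegral_FTC => //.
  move=> x px xq; pose e := Num.min (x - p) (q - x).
  apply: (@is_derive_near _ _ _ e).
  - by rewrite /e lt_min !subr_gt0 px xq.
  - exact: cg.
  move=> y; rewrite /e lt_min => /andP[h1 h2] k1 k2 hk; apply: hB => //.
  + by rewrite le_min (ltW px)/=; move: h1; rewrite ltr_norml; lra.
  + by rewrite le_max ge_min lexx.
  + by rewrite ge_max (ltW xq)/=; move: h2; rewrite ltr_norml; lra.
apply/subspace_continuousP => x /=; rewrite in_itv/= => /andP[px xq].
have M0 : 0 <= M by apply: le_trans (hM x px xq).
apply/cvgrPdist_le => e e0; rewrite near_withinE.
near=> y => yI; move: yI; rewrite /= in_itv/= => /andP[py yq].
have yx : `|x - y| <= e / (M + 1).
  near: y; apply: (@cvgr_dist_le _ _ _ _ _ idfun x) => //.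
  by rewrite divr_gt0// ltr_wpDl.
have key : `|B x - B y| <= M * `|x - y|.
  have [xy|yx'] := leP x y.
    by rewrite distrC [`|x - y|]distrC (ger0_norm (_ : 0 <= y - x)) ?subr_ge0//; exact: lip.
  by rewrite (ger0_norm (_ : 0 <= x - y)) ?subr_ge0 ?(ltW yx')//; apply: lip => //; exact: ltW.
apply: (le_trans key); apply: (@le_trans _ _ ((M + 1) * `|x - y|)).
  by rewrite ler_wpM2r// lerDl.
by rewrite mulrC -ler_pdivlMr// ltr_wpDl.
Unshelve. all: by end_near. Qed.

(** A primitive that is continuous on the whole line, and differentiable to the right of
    c, spares all later arguments the discussion of end points. *)
Lemma antiderivative c f : continuous f ->
  exists2 G, continuous G & forall x, c < x -> is_derive x 1 G (f x).
Proof.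
move=> cf; pose G0 x := \int[mu]_(t in `[c - 1, x]) f t.
have dG0 x : c - 1 < x -> is_derive x 1 G0 (f x).
  move=> cx; have [] := @continuous_FTC1_closed R f (c - 1) x (x + 1) _ _ cx (cf x).
  - by rewrite ltrDl.
  - apply: continuous_compact_integrable; first exact: segment_compact.
    exact: continuous_subspaceT.
  by move=> d1 d2; apply: DeriveDef; [exact: d1|rewrite -derive1E; exact: d2].
exists (fun x => G0 (Num.max x c)).
  move=> x; apply: (@continuous_comp _ _ _ (fun x => Num.max x c) G0).
    by apply: continuous_max; [exact: cvg_id|exact: cvg_cst].
  have h : c - 1 < Num.max x c by rewrite lt_max (_ : c - 1 < c) ?orbT//; lra.
  exact: is_derive_continuous (dG0 _ h).
move=> x cx; have h : c - 1 < x by lra.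
apply: near_eq_is_derive (dG0 x h) => //.
near=> y; rewrite max_l//; near: y; exact: lt_le_nbhsr.
Unshelve. all: by end_near. Qed.

(** Monotone convergence along ]l, l + n]. *)
Lemma halfline_integrable g l K : continuous g -> (forall x, 0 <= g x) ->
  (forall X, l <= X -> \int[mu]_(x in `[l, X]) g x <= K) ->
  mu.-integrable `]l, +oo[ (EFin \o g) /\ \int[mu]_(x in `]l, +oo[) g x <= K.
Proof.
move=> cg g0 hK.
pose I n : set (measurableTypeR R) := `]l, l + n%:R]%classic.
have mg (A : set (measurableTypeR R)) : measurable_fun A (EFin \o g).
  by apply/measurable_EFinP; apply: measurable_funS (continuous_measurable_fun cg).
have nd : nondecreasing_seq I.
  by move=> m n mn; apply/subsetPset/subset_itvl; rewrite bnd_simp lerD2l ler_nat.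
have E : `]l, +oo[%classic = \bigcup_n I n :> set (measurableTypeR R).
  apply/seteqP; split => x /=; rewrite in_itv/= ?andbT.
    move=> lx; exists (Num.bound (x - l)) => //; rewrite /I /= in_itv/= lx/= -lerBlDl.
    by rewrite ltW// unstable.ltr_bound.
  by move=> [n _]; rewrite /I /= in_itv/= => /andP[].
have ge0 x : (0 <= (EFin \o g) x)%E by rewrite lee_fin.
have leK : (\int[mu]_(x in `]l, +oo[) (g x)%:E <= K%:E)%E.
  have := @ge0_nondecreasing_set_cvg_integral _ (measurableTypeR R) R I (EFin \o g) mu nd
    (fun=> measurable_itv _) (fun=> mg _) (fun _ x _ => ge0 x).
  rewrite -E => /cvg_lim <- //; apply: lime_le.
    apply: ereal_nondecreasing_is_cvgn => m n mn; apply: ge0_subset_integral => //;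
      [exact: measurable_itv|exact: measurable_itv|exact/subsetPset/nd].
  near=> n.
  have iI : mu.-integrable `[l, l + n%:R] (EFin \o g).
    apply: continuous_compact_integrable; first exact: segment_compact.
    exact: continuous_subspaceT.
  have := hK (l + n%:R); rewrite lerDl ler0n => /(_ isT).
  rewrite -lee_fin fineK; last exact: integrable_fin_num.
  apply: le_trans; apply: ge0_subset_integral => //; first exact: measurable_itv.
  by apply: subset_itvr; rewrite bnd_simp.
have i : mu.-integrable `]l, +oo[ (EFin \o g).
  apply/integrableP; split => //; apply: le_lt_trans (ltry K).
  by under eq_integral do rewrite gee0_abs//.
by split => //; rewrite -lee_fin fineK//; exact: integrable_fin_num.
Unshelve. all: by end_near. Qed.

End Calculus.

(** * Energy without derivatives *)

Section RealIntegrable.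
Context d (T : measurableType d) (R : realType).
Context (mu : {measure set T -> \bar R}) (D : set T) (mD : measurable D).
Implicit Types (f g : T -> R).

Lemma integrable_scale k f : mu.-integrable D (EFin \o f) ->
  mu.-integrable D (EFin \o (fun x => k * f x)).
Proof. by move=> /(integrableZl mD k); apply: eq_integrable. Qed.

Lemma integrable_add f g : mu.-integrable D (EFin \o f) ->
  mu.-integrable D (EFin \o g) -> mu.-integrable D (EFin \o (fun x => f x + g x)).
Proof. by move=> h1 h2; have := integrableD mD h1 h2; apply: eq_integrable. Qed.

Lemma integrable_sub f g : mu.-integrable D (EFin \o f) ->
  mu.-integrable D (EFin \o g) -> mu.-integrable D (EFin \o (fun x => f x - g x)).
Proof. by move=> h1 h2; have := integrableB mD h1 h2; apply: eq_integrable. Qed.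

Lemma integrable_dom f g : measurable_fun D g -> mu.-integrable D (EFin \o f) ->
  (forall x, D x -> `|g x| <= f x) -> mu.-integrable D (EFin \o g).
Proof.
move=> mg h fg; apply: (le_integrable mD _ _ h); first exact/measurable_EFinP.
by move=> x Dx /=; rewrite lee_fin (le_trans (fg x Dx))// ler_norm.
Qed.

Lemma le_Rintegral_subset (X : set T) f : measurable X -> X `<=` D ->
  mu.-integrable D (EFin \o f) -> (forall x, D x -> 0 <= f x) ->
  \int[mu]_(x in X) f x <= \int[mu]_(x in D) f x.
Proof.
move=> mX XD h f0; have hX := integrableS mD mX XD h.
apply: fine_le; first exact: integrable_fin_num.
  exact: integrable_fin_num.
by apply: ge0_subset_integral => //; try (by case/integrableP: h); move=> x /f0; rewrite lee_fin.
Qed.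

Lemma integrable_indic_fin (X : set T) : measurable X -> (mu X < +oo)%E ->
  mu.-integrable D (EFin \o (\1_X : T -> R)).
Proof.
move=> mX Xoo; apply/integrableP; split; first exact/measurable_EFinP.
rewrite (eq_integral (fun x => (\1_X x)%:E)); last first.
  by move=> t _; rewrite /= ger0_norm.
rewrite integral_indic//; apply: le_lt_trans Xoo.
by apply: le_measure; rewrite ?inE//; exact: measurableI.
Qed.

Lemma integrable_indic_scale (X : set T) (k : R) : measurable X -> (mu X < +oo)%E ->
  mu.-integrable D (EFin \o (fun x => k * \1_X x)).
Proof.
by move=> mX Xoo; apply: integrable_scale; exact: integrable_indic_fin.
Qed.

Lemma Rintegral_indic_scale (X : set T) (k : R) : measurable X -> X `<=` D ->
  (mu X < +oo)%E -> \int[mu]_(x in D) (k * \1_X x) = k * fine (mu X).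
Proof.
move=> mX XD Xoo; rewrite RintegralZl//; last first.
  exact: integrable_indic_fin.
by rewrite /Rintegral integral_indic// setIidl.
Qed.

End RealIntegrable.

Section Energy.
Context {R : realType}.
Implicit Types (F A : R -> R) (x y l r : R).

(** Closed conditions that hold just to the right of a point hold at the point: the
    device by which strict inequalities between arguments are removed. *)
Lemma ge0_at_right (f : R -> R) x z : x < z -> f t @[t --> x] --> f x ->
  (forall t, x < t -> t < z -> 0 <= f t) -> 0 <= f x.
Proof.
move=> xz cf f0.
apply: (cvgr_to_ge (cvg_at_right_filter cf)).
near=> t; apply: f0; near: t; [exact: nbhs_right_gt|exact: nbhs_right_lt].
Unshelve. all: by end_near.
Qed.

Lemma ge0_at_left (f : R -> R) x z : z < x -> f t @[t --> x] --> f x ->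
  (forall t, z < t -> t < x -> 0 <= f t) -> 0 <= f x.
Proof.
move=> xz cf f0.
apply: (cvgr_to_ge (cvg_at_left_filter cf)).
near=> t; apply: f0; near: t; [exact: nbhs_left_gt|exact: nbhs_left_lt].
Unshelve. all: by end_near.
Qed.

Lemma continuous_integrable_itv (f : R -> R) (a b : R) (i : interval R) :
  continuous f -> [set` i] `<=` `[a, b] ->
  (@lebesgue_measure R).-integrable [set` i] (EFin \o f).
Proof.
move=> cf sub.
have h : (@lebesgue_measure R).-integrable `[a, b] (EFin \o f).
  apply: continuous_compact_integrable; first exact: segment_compact.
  exact: continuous_subspaceT.
by apply: (integrableS _ _ _ h).
Qed.

(** When A' = |F'|^2 this is the inequality of Cauchy and Schwarz on [x, y]. *)
Definition energy_le F A x y := (F y - F x) ^+ 2 <= (y - x) * (A y - A x).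

(** This is (p + q)^2 <= (u + v) (s + t) whenever p^2 <= u s and q^2 <= v t: the energy
    inequality may be checked piece by piece. *)
Lemma energy_le_trans F A x y z : x <= y -> y <= z ->
  energy_le F A x y -> energy_le F A y z -> energy_le F A x z.
Proof.
rewrite le_eqVlt => /predU1P[-> //|xy]; rewrite le_eqVlt => /predU1P[<- //|yz].
rewrite /energy_le => h1 h2.
set p := F y - F x in h1; set q := F z - F y in h2.
set u := y - x in h1; set v := z - y in h2.
set s := A y - A x in h1; set t := A z - A y in h2.
have -> : F z - F x = p + q by rewrite /p /q; lra.
have -> : z - x = u + v by rewrite /u /v; lra.
have -> : A z - A x = s + t by rewrite /s /t; lra.
have u0 : 0 < u by rewrite subr_gt0.
have v0 : 0 < v by rewrite subr_gt0.
have h : 2 * p * q <= u * t + v * s.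
  rewrite -(ler_pM2l (mulr_gt0 u0 v0)).
  have g1 := ler_wpM2l (sqr_ge0 v) h1.
  have g2 := ler_wpM2l (sqr_ge0 u) h2.
  have := sqr_ge0 (v * p - u * q).
  nra.
nra.
Qed.

Lemma energy_le_nd F A x y : x < y -> energy_le F A x y -> A x <= A y.
Proof.
rewrite /energy_le => xy h.
have := le_trans (sqr_ge0 _) h.
rewrite pmulr_rge0 ?subr_gt0// subr_ge0 => AA. exact: AA.
Qed.

(** A stands for the function x |-> integral of |F'|^2 over [l, x]. *)
Definition potential l F A :=
  forall x y, l <= x -> x <= y -> energy_le F A x y.

Definition energy_bound l F c :=
  exists2 A, potential l F A & forall y, l <= y -> A y - A l <= c.

Lemma potential_nd l F A x y : potential l F A -> l <= x -> x <= y -> A x <= A y.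
Proof.
move=> pA lx; rewrite le_eqVlt => /orP[/eqP-> //|xy].
by apply: (@energy_le_nd F) => //; apply: pA => //; exact: ltW.
Qed.

(** The right-continuous regularization of a potential is again a potential, by
    continuity of F. Regularity from the right is what a Stieltjes measure needs, and
    with that measure energy can be attributed to level sets. *)
Lemma cumulative_potential l F c : continuous F -> energy_bound l F c ->
  exists A : cumulative R R, potential l F A /\
    forall y, l <= y -> 0 <= A y <= c.
Proof.
move=> cF [A pA Ac].
have nd := potential_nd pA.
pose B x := inf [set A y - A l | y in [set y | Order.max x l < y]].
have lbB x : lbound [set A y - A l | y in [set y | Order.max x l < y]] (A (Order.max x l) - A l).
  move=> _ [y /= xy <-]; rewrite lerB// nd ?(ltW xy)//.
  by rewrite le_max lexx orbT.
have neB x : [set A y - A l | y in [set y | Order.max x l < y]] !=set0.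
  by exists (A (Order.max x l + 1) - A l), (Order.max x l + 1) => //=; rewrite ltrDl.
have hasB x : has_inf [set A y - A l | y in [set y | Order.max x l < y]].
  by split=> //; exists (A (Order.max x l) - A l).
have Ble x y : Order.max x l < y -> B x <= A y - A l.
  by move=> xy; apply: ge_inf; [case: (hasB x)|exists y].
have leB x : A (Order.max x l) - A l <= B x by apply: lb_le_inf.
have ndB : nondecreasing B.
  move=> x y xy; apply: lb_le_inf => // _ [z /= yz <-]; apply: Ble.
  by rewrite (le_lt_trans _ yz)// ge_max !le_max lexx xy orbT.
have rcB : right_continuous B.
  move=> x; apply/cvgrPdist_le => /= e e0.
  have [_ [z /= xz <-] ze] := inf_adherent e0 (hasB x).
  move: (xz); rewrite gt_max => /andP[xz1 xz2].
  near=> y; rewrite distrC ger0_norm ?subr_ge0; last first.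
    by apply: ndB; near: y; exact: nbhs_right_ge.
  rewrite lerBlDl (le_trans _ (ltW ze))//; apply: Ble.
  by rewrite gt_max xz2 andbT; near: y; exact: nbhs_right_lt.
pose cB := isCumulative.Build R _ R B ndB rcB.
pose BB : cumulative R R := HB.pack B cB.
exists BB; split; last first.
  move=> y ly; rewrite /BB /=; apply/andP; split.
    apply: le_trans (leB y); rewrite max_l// subr_ge0; exact: nd.
  apply: le_trans (Ble y (y + 1) _) _.
    by rewrite max_l// ltrDl.
  by apply: Ac; rewrite (le_trans ly)// lerDl.
move=> x y lx; rewrite le_eqVlt => /orP[/eqP->|xy].
  by rewrite /energy_le !subrr expr0n mul0r.
rewrite /energy_le /BB /=.
(* F is continuous, so the inequality on [t, z] passes to the limit as t decreases to x. *)
have key z : y < z -> (F z - F x) ^+ 2 <= (z - x) * (A z - A l - B x).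
  move=> yz; rewrite -subr_ge0.
  apply: (@ge0_at_right (fun t => (z - x) * (A z - A l - B x) - (F z - F t) ^+ 2) x y xy).
    apply: cvgB; first exact: cvg_cst.
    apply: cvgM; (apply: cvgB; [exact: cvg_cst|exact: cF]).
  move=> t xt ty; rewrite subr_ge0.
  have tz : t < z by exact: lt_trans yz.
  apply: (le_trans (pA t z _ _)); rewrite ?(ltW tz)//.
    exact: le_trans (ltW xt).
  have h1 : B x <= A t - A l by apply: Ble; rewrite gt_max xt (le_lt_trans lx).
  have h2 : A t <= A z by apply: nd; rewrite ?(ltW tz)// (le_trans lx)// ltW.
  have : 0 <= A z - A t by rewrite subr_ge0.
  by nra.
have le_cF : (F y - F x) ^+ 2 / (y - x) <= B y - B x.
  rewrite lerBrDr; apply: lb_le_inf => // _ [z' /= + <-].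
  rewrite max_l; last exact: le_trans (ltW xy).
  move=> yz'; rewrite -lerBrDr -subr_ge0.
  apply: (@ge0_at_right (fun t => A z' - A l - B x - (F t - F x) ^+ 2 / (t - x)) y z' yz').
    apply: cvgB; first exact: cvg_cst.
    apply: cvgM.
      by apply: cvgM; (apply: cvgB; [exact: cF|exact: cvg_cst]).
    apply: cvgV; first by rewrite subr_eq0 gt_eqF.
    by apply: cvgB; [exact: cvg_id|exact: cvg_cst].
  move=> t yt tz'; rewrite subr_ge0 ler_pdivrMr ?subr_gt0 ?(lt_trans xy)// mulrC.
  apply: le_trans (key _ yt) _; apply: ler_wpM2l.
    by rewrite subr_ge0 ltW// (lt_trans xy).
  by rewrite !lerB// nd ?(ltW tz')// (le_trans lx)// ltW// (lt_trans xy).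
by rewrite mulrC -ler_pdivrMr ?subr_gt0.
Unshelve. all: by end_near.
Qed.

End Energy.

(** * Bands between two levels *)

Section Crossing.
Context {R : realType}.
Implicit Types (F : R -> R) (x y l r s t : R).
Notation mu := (@lebesgue_measure R).

(** Take a the last point where F >= t, and b the first point after a where F <= s. *)
Lemma crossing_down F al be s t : continuous F -> al < be -> s < t ->
  t <= F al -> F be <= s ->
  exists a b, [/\ al <= a, a < b, b <= be,
    (forall x, a < x -> x < b -> s < F x < t) & t <= F a /\ F b <= s].
Proof.
move=> cF albe st Fal Fbe.
have cid (A : set R) : {within A, continuous (@idfun R)}.
  by apply: continuous_subspaceT => x; exact: cvg_id.
have [a] : exists2 c, c \in `[al, be] `&` [set x | t <= F x] &
    forall x, x \in `[al, be] `&` [set x | t <= F x] -> x <= c.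
  apply: (@compact_EVT_max _ R idfun) => //.
  - by exists al; split => //=; rewrite in_itv/= lexx ltW.
  - apply: (subclosed_compact _ (@segment_compact _ al be)); last first.
      exact: subIsetl.
    apply: closedI; first exact: interval_closed.
    by apply: (@preimage_closed _ _ F [set x | t <= x]) => // x; exact: cF.
rewrite inE => -[/=]; rewrite in_itv/= => /andP[ala abe] tFa amax.
have {}abe : a < be.
  by rewrite lt_neqAle abe andbT; apply: contraTneq tFa => ->; rewrite -ltNge (le_lt_trans Fbe).
have [b] : exists2 c, c \in `[a, be] `&` [set x | F x <= s] &
    forall x, x \in `[a, be] `&` [set x | F x <= s] -> c <= x.
  apply: (@compact_EVT_min _ R idfun) => //.
  - by exists be; split => //=; rewrite in_itv/= lexx ltW.
  - apply: (subclosed_compact _ (@segment_compact _ a be)); last first.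
      exact: subIsetl.
    apply: closedI; first exact: interval_closed.
    by apply: (@preimage_closed _ _ F [set x | x <= s]) => // x; exact: cF.
rewrite inE => -[/=]; rewrite in_itv/= => /andP[ab bbe] Fbs bmin.
have {}ab : a < b.
  rewrite lt_neqAle ab andbT; apply: contraTneq tFa => ->.
  by rewrite -ltNge (le_lt_trans Fbs).
exists a, b; split => // x ax xb; apply/andP; split; rewrite ltNge; apply/negP => h.
  have := bmin x; rewrite inE => /(_ _)/wrap[]; last by rewrite leNgt xb.
  by split => //=; rewrite in_itv/= (ltW ax)/= (le_trans (ltW xb)).
have := amax x; rewrite inE => /(_ _)/wrap[]; last by rewrite leNgt ax.
by split => //=; rewrite in_itv/= (le_trans ala (ltW ax))/= (le_trans (ltW xb)).
Qed.

Lemma crossing F al be s t : continuous F -> al < be -> s < t ->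
  (t <= F al /\ F be <= s) \/ (F al <= s /\ t <= F be) ->
  exists a b, [/\ al <= a, a < b, b <= be,
    (forall x, a < x -> x < b -> s < F x < t) &
    (t - s) ^+ 2 <= (F b - F a) ^+ 2].
Proof.
move=> cF albe st [[Fal Fbe]|[Fal Fbe]].
  have [a [b [ala ab bbe H [h1 h2]]]] := crossing_down cF albe st Fal Fbe.
  by exists a, b; split => //; nra.
have cFN : continuous (fun x => F (- x)).
  by move=> x; apply: (@continuous_comp _ _ _ -%R F); [exact: opp_continuous|exact: cF].
have := @crossing_down (fun x => F (- x)) (- be) (- al) s t cFN.
rewrite ltrN2 !opprK => /(_ albe st Fbe Fal)[a [b [ala ab bbe H [h1 h2]]]].
exists (- b), (- a); split; rewrite ?ltrN2 1?lerNr// 1?lerNl//.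
  by move=> x bx xa; have := H (- x); rewrite opprK; apply; [rewrite ltrNr|rewrite ltrNl].
by nra.
Qed.

Context (nu : cumulative R R).
Notation nu_ := (lebesgue_stieltjes_measure nu).

Lemma stieltjes_itvoc x y : x <= y -> nu_ `]x, y]%classic = (nu y - nu x)%:E.
Proof.
move=> xy; have -> : nu_ `]x, y]%classic = wlength nu `]x, y]%classic.
  rewrite /lebesgue_stieltjes_measure/= /measure_extension/=.
  by rewrite measurable_mu_extE//; exact: is_ocitv.
rewrite wlength_itv/= lte_fin; case: ltP => // yx.
by have /eqP -> : x == y by [rewrite eq_le xy yx]; rewrite subrr.
Qed.

Lemma stieltjes_open_fin x y : x <= y -> nu_ `]x, y[%classic \is a fin_num.
Proof.
move=> xy; rewrite ge0_fin_numE//; apply: (@le_lt_trans _ _ (nu_ `]x, y]%classic)).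
  apply: le_measure; rewrite ?inE; try exact: measurable_itv.
  by apply: subset_itvl; rewrite bnd_simp.
by rewrite stieltjes_itvoc// ltry.
Qed.

(** The intervals ]al, t] with t < be exhaust ]al, be[, so a jump of the potential at be
    is not counted. *)
Lemma energy_open l F al be : continuous F -> potential l F nu ->
  l <= al -> al < be ->
  (F be - F al) ^+ 2 <= (be - al) * fine (nu_ `]al, be[%classic).
Proof.
move=> cF pF lal albe; rewrite -subr_ge0.
apply: (@ge0_at_left _ (fun t => (be - al) * fine (nu_ `]al, be[%classic) - (F t - F al) ^+ 2) _ al) => //.
  apply: cvgB; first exact: cvg_cst.
  by apply: cvgM; (apply: cvgB; [exact: cF|exact: cvg_cst]).
move=> t at_ tb; rewrite subr_ge0; apply: le_trans (pF al t lal (ltW at_)) _.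
have h : nu t - nu al <= fine (nu_ `]al, be[%classic).
  rewrite -lee_fin fineK ?stieltjes_open_fin ?(ltW albe)//.
  rewrite -stieltjes_itvoc ?(ltW at_)//.
  apply: le_measure; rewrite ?inE; try exact: measurable_itv.
  by apply: subset_itvl; rewrite bnd_simp.
have h0 : 0 <= nu t - nu al by rewrite subr_ge0 cumulative_is_nondecreasing// ltW.
nra.
Qed.

Lemma stieltjes_halfline_le l c : (forall y, l <= y -> 0 <= nu y <= c) ->
  (nu_ `]l, +oo[%classic <= c%:E)%E.
Proof.
move=> nuc.
have nd : nondecreasing_seq (fun n : nat => `]l, l + n%:R]%classic : set R).
  by move=> m n mn; apply/subsetPset/subset_itvl; rewrite bnd_simp lerD2l ler_nat.
have E : `]l, +oo[%classic = \bigcup_n `]l, l + n%:R]%classic :> set R.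
  apply/seteqP; split => x /=; rewrite in_itv/= ?andbT.
    move=> lx; exists (Num.bound (x - l)) => //=; rewrite in_itv/= lx/= -lerBlDl.
    by rewrite ltW// unstable.ltr_bound.
  by move=> [n _ /=]; rewrite in_itv/= => /andP[].
have mE : measurable (\bigcup_n `]l, l + n%:R]%classic : set R).
  by rewrite -E; exact: measurable_itv.
have := @nondecreasing_cvg_mu _ _ _ nu_ (fun n : nat => `]l, l + n%:R]%classic)
   (fun=> measurable_itv _) mE nd.
rewrite -E => /cvg_lim <- //; apply: lime_le.
  apply: ereal_nondecreasing_is_cvgn => m n mn; apply: le_measure; rewrite ?inE; try exact: measurable_itv.
  exact/subsetPset/nd.
near=> n => /=; rewrite stieltjes_itvoc ?lerDl// lee_fin.
have ln : l <= l + n%:R by rewrite lerDl.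
have /andP[_ h1] := nuc _ ln; have /andP[h2 _] := nuc l (lexx _).
lra.
Unshelve. all: by end_near. Qed.

End Crossing.

Section Bands.
Context {R : realType}.
Implicit Types (x y s t : R) (X Y : set R).
Notation mu := (@lebesgue_measure R).
Context (nu : cumulative R R) (F : R -> R) (l r c : R).
Notation nu_ := (lebesgue_stieltjes_measure nu).
Hypotheses (cF : continuous F) (pF : potential l F nu)
  (nuc : forall y, l <= y -> 0 <= nu y <= c).

(** The Cauchy-Schwarz inequality for a total variation of a over the set X, which need
    not be an interval: the length and the energy of X stand on the right. *)
Definition crossed (a : R) X := a ^+ 2 <= fine (mu X) * fine (nu_ X).

Definition band s t := `]l, +oo[%classic `&` F @^-1` `]s, t[%classic.

Lemma measurable_band s t : measurable (band s t).
Proof.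
apply: measurableI => //; rewrite -[X in measurable X]setTI.
by apply: (continuous_measurable_fun cF) => //; exact: measurable_itv.
Qed.

(** The triangle inequality in the form that adds up pieces. *)
Lemma sqr_add_le (a b p1 q1 p2 q2 : R) : 0 <= p1 -> 0 <= q1 -> 0 <= p2 -> 0 <= q2 ->
  a ^+ 2 <= p1 * q1 -> b ^+ 2 <= p2 * q2 ->
  (a + b) ^+ 2 <= (p1 + p2) * (q1 + q2).
Proof.
move=> p10 q10 p20 q20 h1 h2.
have h : 2 * a * b <= p1 * q2 + p2 * q1.
  apply: le_trans (ler_norm _) _.
  rewrite -ler_sqr ?nnegrE ?addr_ge0 ?mulr_ge0// -normrX ger0_norm ?sqr_ge0//.
  have := ler_pM (sqr_ge0 _) (sqr_ge0 _) h1 h2.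
  have := sqr_ge0 (p1 * q2 - p2 * q1); nra.
nra.
Qed.

Lemma stieltjes_sub_fin X : measurable X -> X `<=` `]l, +oo[%classic -> nu_ X \is a fin_num.
Proof.
move=> mX Xl; rewrite ge0_fin_numE//.
apply: (@le_lt_trans _ _ (nu_ `]l, +oo[%classic)).
  by apply: le_measure; rewrite ?inE//; exact: measurable_itv.
by apply: le_lt_trans (stieltjes_halfline_le nuc) _; exact: ltry.
Qed.

(** Disjoint pieces of X contribute additively to the variation. *)
Lemma crossed_add a b X X1 X2 : measurable X -> measurable X1 -> measurable X2 ->
  X `<=` `]l, +oo[%classic -> (mu X < +oo)%E ->
  X1 `<=` X -> X2 `<=` X -> [disjoint X1 & X2] ->
  crossed a X1 -> crossed b X2 -> crossed (a + b) X.
Proof.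
move=> mX mX1 mX2 Xl muX X1X X2X X12 h1 h2.
have fX : mu X \is a fin_num by rewrite ge0_fin_numE.
have fX1 : mu X1 \is a fin_num.
  by rewrite ge0_fin_numE// (le_lt_trans _ muX)// le_measure ?inE.
have fX2 : mu X2 \is a fin_num.
  by rewrite ge0_fin_numE// (le_lt_trans _ muX)// le_measure ?inE.
have nX := stieltjes_sub_fin mX Xl.
have nX1 := stieltjes_sub_fin mX1 (subset_trans X1X Xl).
have nX2 := stieltjes_sub_fin mX2 (subset_trans X2X Xl).
have X120 : X1 `&` X2 = set0 by apply/disj_set2P.
have le1 : fine (mu X1) + fine (mu X2) <= fine (mu X).
  rewrite -fineD// fine_le ?fin_numD ?fX1// -measureU//.
  by apply: le_measure; rewrite ?inE//; [exact: measurableU|rewrite subUset].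
have le2 : fine (nu_ X1) + fine (nu_ X2) <= fine (nu_ X).
  rewrite -fineD// fine_le ?fin_numD ?nX1// -measureU//.
  by apply: le_measure; rewrite ?inE//; [exact: measurableU|rewrite subUset].
apply: le_trans (sqr_add_le _ _ _ _ h1 h2) _; rewrite ?fine_ge0//.
by apply: ler_pM => //; rewrite addr_ge0// fine_ge0.
Qed.

(** By the intermediate value theorem F runs through the whole band between the two
    points, and there it stays strictly between the levels. *)
Lemma crossed_itv al be s t : l <= al -> al < be -> s < t ->
  (t <= F al /\ F be <= s) \/ (F al <= s /\ t <= F be) ->
  crossed (t - s) (band s t `&` `]al, be[%classic).
Proof.
move=> lal albe st h.
have [a [b [ala ab bbe H h2]]] := crossing cF albe st h.
have la : l <= a by exact: le_trans ala.
apply: le_trans h2 _; apply: le_trans (energy_open cF pF la ab) _.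
set X := _ `&` _.
have mX : measurable X by apply: measurableI; [exact: measurable_band|exact: measurable_itv].
have abX : `]a, b[%classic `<=` X.
  move=> x /=; rewrite in_itv/= => /andP[ax xb]; split; last first.
    by rewrite /= in_itv/= (le_lt_trans ala)//= (lt_le_trans xb).
  by split; rewrite /= in_itv/= ?andbT ?(le_lt_trans la)//; apply: H.
apply: ler_pM; rewrite ?fine_ge0// ?subr_ge0 ?(ltW ab)//.
  rewrite -lee_fin fineK; last first.
    rewrite ge0_fin_numE//; apply: (@le_lt_trans _ _ (mu `]al, be[%classic)).
      by apply: le_measure; rewrite ?inE//; exact: subIsetr.
    by rewrite lebesgue_measure_itv/= lte_fin albe -EFinB ltry.
  have <- : mu `]a, b[%classic = (b - a)%:E.
    by rewrite lebesgue_measure_itv/= lte_fin ab -EFinB.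
  by apply: le_measure; rewrite ?inE.
have fX : nu_ X \is a fin_num.
  by apply: stieltjes_sub_fin => // x [[]].
rewrite fine_le//; last by apply: le_measure; rewrite ?inE.
by apply: stieltjes_sub_fin => // x /abX[[]].
Qed.

Lemma crossed_sub a X Y : measurable X -> measurable Y -> X `<=` Y ->
  Y `<=` `]l, +oo[%classic -> (mu Y < +oo)%E -> crossed a X -> crossed a Y.
Proof.
move=> mX mY XY Yl muY h.
rewrite -[a]addr0; apply: (@crossed_add a 0 Y X set0) => //.
- by apply/disj_set2P; rewrite setI0.
- by rewrite /crossed !measure0 /= expr0n mulr0.
Qed.

Lemma band_crossed z z' s t : s < t -> (mu (band s t) < +oo)%E ->
  l <= z -> z < z' -> t <= F z -> F z' <= s -> crossed (t - s) (band s t).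
Proof.
move=> st fin lz zz' tz zs.
apply: (@crossed_sub _ (band s t `&` `]z, z'[%classic)) => //.
- by apply: measurableI; [exact: measurable_band|exact: measurable_itv].
- exact: measurable_band.
- by move=> x [].
- by apply: crossed_itv => //; left.
Qed.

Let band_crossed2_itv al1 be1 al2 be2 s t : s < t -> (mu (band s t) < +oo)%E ->
  l <= al1 -> al1 < be1 -> be1 <= al2 -> al2 < be2 ->
  (t <= F al1 /\ F be1 <= s) \/ (F al1 <= s /\ t <= F be1) ->
  (t <= F al2 /\ F be2 <= s) \/ (F al2 <= s /\ t <= F be2) ->
  crossed (2 * (t - s)) (band s t).
Proof.
move=> st fin lal ab1 ba ab2 h1 h2.
have -> : 2 * (t - s) = (t - s) + (t - s) by lra.
have c1 := crossed_itv lal ab1 st h1.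
have la2 : l <= al2 by apply: le_trans lal _; apply: le_trans (ltW ab1) _.
have c2 := crossed_itv la2 ab2 st h2.
have mb := measurable_band s t.
apply: crossed_add c1 c2 => //; try (apply: measurableI => //; exact: measurable_itv).
- exact: subIsetl.
apply/disj_set2P; rewrite -subset0 => x [[_ /=]] + [_ /=].
rewrite !in_itv/= => /andP[_ xb] /andP[ax _].
by have := lt_trans xb (le_lt_trans ba ax); rewrite ltxx.
Qed.

Hypotheses (lr : l < r) (Flr : F l = F r).

(** Here the value at the vertex lies outside the band. If it is low, the excursion to z
    provides a way up and a way down; if it is high, the low point y of the circle does,
    since the circle leaves the vertex and comes back to it. *)
Let band_crossed2_vertex y z z' s t : s < t -> (mu (band s t) < +oo)%E ->
  l <= y -> y <= r -> F y <= s ->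
  l <= z -> z < z' -> t <= F z -> F z' <= s ->
  F r <= s \/ t <= F r -> crossed (2 * (t - s)) (band s t).
Proof.
move=> st fin ly yr ys lz zz' tz z's [rs|tr].
- have lz' : l < z.
    by rewrite lt_neqAle lz andbT; apply: contraTneq tz => <-; rewrite Flr -ltNge (le_lt_trans rs).
  have [zr|] := ltP z r.
    apply: (@band_crossed2_itv l z z r) => //; [right|left]; rewrite ?Flr//.
  rewrite le_eqVlt => /predU1P[rz|rz].
    by move: tz; rewrite -rz leNgt (le_lt_trans rs).
  apply: (@band_crossed2_itv r z z z') => //; [exact: ltW|by right|by left].
- have ly' : l < y.
    by rewrite lt_neqAle ly andbT; apply: contraTneq ys => <-; rewrite Flr -ltNge (lt_le_trans st).
  have yr' : y < r.
    by rewrite lt_neqAle yr andbT; apply: contraTneq ys => ->; rewrite -ltNge (lt_le_trans st).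
  by apply: (@band_crossed2_itv l y y r) => //; [left|right]; rewrite ?Flr.
Qed.

(** A low point on the circle and a high point somewhere force two crossings of the
    band. When the value at the vertex lies inside the band, the band is cut at that
    value and each half has the vertex at its boundary. *)
Lemma band_crossed2 y z z' s t : s < t -> (mu (band s t) < +oo)%E ->
  l <= y -> y <= r -> F y <= s ->
  l <= z -> z < z' -> t <= F z -> F z' <= s ->
  crossed (2 * (t - s)) (band s t).
Proof.
move=> st fin ly yr ys lz zz' tz z's.
have [rs|sr] := leP (F r) s; first by apply: (band_crossed2_vertex st fin ly yr ys lz zz') => //; left.
have [tr|rt] := leP t (F r); first by apply: (band_crossed2_vertex st fin ly yr ys lz zz') => //; right.
set p := F r in sr rt.
have sub1 : band s p `<=` band s t.
  by move=> x [? /=]; rewrite in_itv/= => /andP[h1 h2]; split => //=; rewrite in_itv/= h1 (lt_trans h2).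
have sub2 : band p t `<=` band s t.
  by move=> x [? /=]; rewrite in_itv/= => /andP[h1 h2]; split => //=; rewrite in_itv/= h2 andbT (lt_trans sr).
have mb := measurable_band.
have -> : 2 * (t - s) = 2 * (p - s) + 2 * (t - p) by lra.
apply: (@crossed_add _ _ _ (band s p) (band p t)) => //.
- exact: subIsetl.
- apply/disj_set2P; rewrite -subset0 => x [[_ /=]] + [_ /=].
  rewrite !in_itv/= => /andP[_ xp] /andP[px _].
  by have := lt_trans xp px; rewrite ltxx.
- have f1 : (mu (band s p) < +oo)%E by apply: le_lt_trans fin; apply: le_measure => //; rewrite inE; exact: mb.
  apply: (band_crossed2_vertex sr f1 ly yr ys lz zz') => //.
    by rewrite (le_trans (ltW rt)).
  by right.
- have f1 : (mu (band p t) < +oo)%E by apply: le_lt_trans fin; apply: le_measure => //; rewrite inE; exact: mb.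
  apply: (band_crossed2_vertex rt f1 ly yr _ lz zz') => //.
  + by rewrite (le_trans ys)// ltW.
  + by rewrite (le_trans z's)// ltW.
  + by left.
Qed.

End Bands.

(** * Decreasing rearrangement *)

(** The arithmetic behind the primitive of the rearrangement: a <= b are powers of two
    levels, u and v arguments, e1 and e2 the excesses above the levels. *)
Lemma layer_bounds (R : realType) (a b m n u v e1 e2 : R) : a <= b ->
  (b - a) * m <= e2 - e1 -> e2 - e1 <= (b - a) * n -> n <= v -> u <= m ->
  a * (v - u) <= e2 + a * v - (e1 + b * u) <= b * (v - u).
Proof.
move=> ab h1 h2 nv um; have ba : 0 <= b - a by rewrite subr_ge0.
have h5 := ler_wpM2l ba nv; have h6 := ler_wpM2l ba um.
by apply/andP; split; lra.
Qed.

Section Rearrangement.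
Context {R : realType}.
Implicit Types (x y s t : R) (q : nat).
Notation mu := (@lebesgue_measure R).
Context (nu : cumulative R R) (F : R -> R) (l r c : R).
Notation nu_ := (lebesgue_stieltjes_measure nu).
Hypotheses (cF : continuous F) (pF : potential l F nu)
  (nuc : forall y, l <= y -> 0 <= nu y <= c).
Hypotheses (lr : l < r) (Flr : F l = F r) (F0 : forall x, 0 <= F x).
Local Notation E := `]l, +oo[%classic.
Hypothesis (iF2 : mu.-integrable E (EFin \o (fun x => F x ^+ 2))).
Local Notation S := (\int[mu]_(x in E) F x ^+ 2).

(** Average F x ^ 2 <= 2 F y ^ 2 + 2 (F x - F y) ^ 2 over y in [x, x + 1]; the energy
    bounds the last term. *)
Lemma energy_sup x : l <= x -> F x ^+ 2 <= 2 * S + 2 * c.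
Proof.
move=> lx.
have sub : `]x, x + 1[%classic `<=` E.
  by move=> y /=; rewrite !in_itv/= andbT => /andP[xy _]; exact: le_lt_trans xy.
have mI : mu `]x, x + 1[%classic = 1%E.
  by rewrite lebesgue_measure_itv/= lte_fin ltrDl ltr01 -EFinB addrC addKr.
have iI : mu.-integrable `]x, x + 1[ (EFin \o (fun x => F x ^+ 2)).
  by apply: integrableS iF2.
have ic k : mu.-integrable `]x, x + 1[ (EFin \o cst k).
  apply: (@continuous_integrable_itv R _ x (x + 1)); first exact: cst_continuous.
  by move=> y /=; rewrite !in_itv/= => /andP[/ltW -> /ltW ->].
have h1 : \int[mu]_(y in `]x, x + 1[) (F x ^+ 2 - 2 * c) <= \int[mu]_(y in `]x, x + 1[) (2 * F y ^+ 2).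
  apply: le_Rintegral => //.
    by rewrite -/(cst _); exact: ic.
    exact: integrable_scale.
  move=> y /=; rewrite in_itv/= => /andP[xy yx].
  have := pF lx (ltW xy); rewrite /energy_le.
  have /andP[_ h1] := nuc (le_trans lx (ltW xy)); have /andP[h2 _] := nuc lx.
  have h3 : 0 <= nu y - nu x by rewrite subr_ge0 cumulative_is_nondecreasing// ltW.
  have := sqr_ge0 (2 * F y - F x).
  nra.
have h2 : \int[mu]_(y in `]x, x + 1[) F y ^+ 2 <= S.
  by apply: le_Rintegral_subset => // y _; exact: sqr_ge0.
move: h1; rewrite Rintegral_cst// RintegralZl//.
have -> : fine (mu `]x, x + 1[%classic) = 1 by rewrite mI.
by move: h2; rewrite -/mu; lra.
Qed.

Definition over t := E `&` F @^-1` `]t, +oo[%classic.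
(** Both forms of the superlevel set are used: their measures bound an argument of the
    rearrangement from above and from below. *)
Definition over_eq t := E `&` F @^-1` `[t, +oo[%classic.

Let mF : measurable_fun setT F := continuous_measurable_fun cF.

Lemma measurable_over t : measurable (over t).
Proof.
by apply: measurableI => //; rewrite -[X in measurable X]setTI; exact: mF.
Qed.

Lemma measurable_over_eq t : measurable (over_eq t).
Proof.
by apply: measurableI => //; rewrite -[X in measurable X]setTI; exact: mF.
Qed.

Lemma over_subset s t : s <= t -> over t `<=` over s.
Proof.
by move=> st x [Ex /=]; rewrite in_itv/= andbT => tF; split => //=; rewrite in_itv/= andbT (le_lt_trans st).
Qed.

Lemma mu_over_le s t : s <= t -> (mu (over t) <= mu (over s))%E.
Proof.
by move=> st; apply: le_measure; rewrite ?inE; [exact: measurable_over|exact: measurable_over|exact: over_subset].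
Qed.

Lemma mu_over_eq_fin t : 0 < t -> (mu (over_eq t) < +oo)%E.
Proof.
move=> t0.
have : ((t ^+ 2)%:E * mu (over_eq t) <= S%:E)%E.
  rewrite -integral_cst; last exact: measurable_over_eq.
  rewrite fineK; last exact: integrable_fin_num.
  apply: (@le_trans _ _ (\int[mu]_(x in over_eq t) (F x ^+ 2)%:E)%E).
    apply: ge0_le_integral => //.
    - exact: measurable_over_eq.
    - by move=> x _; rewrite lee_fin sqr_ge0.
    - by apply/measurable_EFinP/measurable_funX; apply: measurable_funS mF.
    - move=> x [_ /=]; rewrite in_itv/= andbT => tF.
      by rewrite lee_fin ler_sqr ?nnegrE// ltW.
  apply: ge0_subset_integral => //.
  - exact: measurable_over_eq.
  - by case/integrableP: iF2.
  - by move=> y _; rewrite lee_fin sqr_ge0.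
  - by move=> x [].
have [//|] := ltP (mu (over_eq t)) +oo%E.
rewrite leye_eq => /eqP ->.
by rewrite mulry gtr0_sg ?exprn_gt0// mul1e leye_eq.
Qed.

Lemma mu_over_fin t : 0 < t -> (mu (over t) < +oo)%E.
Proof.
move=> /mu_over_eq_fin; apply: le_lt_trans; apply: le_measure; rewrite ?inE.
- exact: measurable_over.
- exact: measurable_over_eq.
- by move=> x [Ex /=]; rewrite in_itv/= andbT => tF; split => //=; rewrite in_itv/= andbT ltW.
Qed.

(** The usual decreasing rearrangement, the generalized inverse of the distribution
    function. *)
Definition rearr (u : R) := inf [set t | 0 <= t /\ (mu (over t) <= u%:E)%E].

Context (M : R).
Hypotheses (M0 : 0 <= M) (FM : forall x, l <= x -> F x <= M).

Let over_M : over M = set0.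
Proof.
rewrite -subset0 => x [/=]; rewrite !in_itv/= !andbT => lx; rewrite ltNge FM//; exact: ltW.
Qed.

Let has_inf_rearr u : 0 <= u -> has_inf [set t | 0 <= t /\ (mu (over t) <= u%:E)%E].
Proof.
move=> u0; split; last by exists 0 => t [].
by exists M; split => //; rewrite over_M measure0 lee_fin.
Qed.

Lemma rearr_ge0 u : 0 <= u -> 0 <= rearr u.
Proof. by move=> u0; apply: lb_le_inf; [case: (has_inf_rearr u0)|move=> t []]. Qed.

Lemma rearr_le u t : 0 <= u -> 0 <= t -> (mu (over t) <= u%:E)%E -> rearr u <= t.
Proof. by move=> u0 t0 h; apply: ge_inf; [case: (has_inf_rearr u0)|]. Qed.

Lemma rearr_leM u : 0 <= u -> rearr u <= M.
Proof. by move=> u0; apply: rearr_le => //; rewrite over_M measure0 lee_fin. Qed.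

Lemma rearr_gt u t : 0 <= u -> 0 <= t -> t < rearr u -> (u%:E < mu (over t))%E.
Proof. by move=> u0 t0; rewrite !ltNge; apply: contra => /(rearr_le u0 t0); rewrite leNgt. Qed.

Lemma mu_over_gt u t : 0 <= u -> rearr u < t -> (mu (over t) <= u%:E)%E.
Proof.
move=> u0 ut; have e0 : 0 < t - rearr u by rewrite subr_gt0.
have [s [s0 hs]] := inf_adherent e0 (has_inf_rearr u0).
move=> st; have {}st : s < rearr u + (t - rearr u) := st.
by apply: le_trans hs; apply: mu_over_le; rewrite ltW// (lt_le_trans st)// addrC subrK.
Qed.

Lemma rearr_nincr u v : 0 <= u -> u <= v -> rearr v <= rearr u.
Proof.
move=> u0 uv; apply/ler_addgt0Pr => e e0; apply: rearr_le.
- exact: le_trans uv.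
- by rewrite addr_ge0 ?rearr_ge0// ltW.
- apply: (@le_trans _ _ u%:E); last by rewrite lee_fin.
  by apply: mu_over_gt => //; rewrite ltrDl.
Qed.

Lemma mu_over_rearr u : 0 <= u -> (mu (over (rearr u)) <= u%:E)%E.
Proof.
move=> u0; set t := rearr u.
pose G n := over (t + n.+1%:R^-1).
have E1 : over t = \bigcup_n G n.
  apply/seteqP; split => x.
    move=> [Ex /=]; rewrite in_itv/= andbT -subr_gt0 => tF.
    have [n _ hn] := near_infty_natSinv_lt (PosNum tF).
    exists n => //; split => //=; rewrite in_itv/= andbT.
    by rewrite -ltrBrDl; exact: hn (leqnn _).
  by move=> [n _]; apply: over_subset; rewrite lerDl.
have mG : measurable (\bigcup_n G n) by rewrite -E1; exact: measurable_over.
have nd : nondecreasing_seq G.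
  move=> m n mn; apply/subsetPset/over_subset; rewrite lerD2l.
  by rewrite lef_pV2 ?posrE// ler_nat.
have := @nondecreasing_cvg_mu _ _ _ mu G (fun=> measurable_over _) mG nd.
rewrite -E1 => /cvg_lim <- //; apply: lime_le.
  by apply: ereal_nondecreasing_is_cvgn => m n mn; apply: le_measure; rewrite ?inE;
    [exact: measurable_over|exact: measurable_over|exact/subsetPset/nd].
by near=> n => /=; apply: mu_over_gt => //; rewrite ltrDl.
Unshelve. all: by end_near. Qed.

(** Continuity of the measure from above along levels increasing to rearr u. *)
Lemma mu_over_eq_rearr u : 0 <= u -> 0 < rearr u -> (u%:E <= mu (over_eq (rearr u)))%E.
Proof.
move=> u0; set t := rearr u => t0.
pose G n := over (t - t / n.+2%:R).
have lt1 n : t / n.+2%:R < t by rewrite ltr_pdivrMr// ltr_pMr// ltr1n.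
have E1 : over_eq t = \bigcap_n G n.
  apply/seteqP; split => x.
    move=> [Ex /=]; rewrite in_itv/= andbT => tF n _; split => //=.
    rewrite in_itv/= andbT; apply: lt_le_trans tF.
    by rewrite ltrBlDr ltrDl divr_gt0.
  move=> h; split; first by have [] := h 0%N I.
  rewrite /= in_itv/= andbT leNgt; apply/negP; rewrite -subr_gt0 => Ft.
  have h1 : 0 < (t - F x) / t by rewrite divr_gt0.
  have [n _ hn] := near_infty_natSinv_lt (PosNum h1).
  have [_ /=] := h n I; rewrite in_itv/= andbT.
  have : n.+2%:R^-1 < (t - F x) / t := hn n.+1 (leqnSn _).
  rewrite ltr_pdivlMr// mulrC => h3 h4.
  have h5 : t - F x < t / n.+2%:R by rewrite ltrBlDr addrC -ltrBlDr.
  by have := lt_trans h3 h5; rewrite ltxx.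
have mG : measurable (\bigcap_n G n) by rewrite -E1; exact: measurable_over_eq.
have nd : nonincreasing_seq G.
  move=> m n mn; apply/subsetPset/over_subset; rewrite lerD2l lerN2.
  by rewrite ler_pM2l// lef_pV2 ?posrE// ler_nat.
have fin : (mu (G 0%N) < +oo)%E by apply: mu_over_fin; rewrite subr_gt0.
have := @nonincreasing_cvg_mu _ _ _ mu G fin (fun=> measurable_over _) mG nd.
rewrite -E1 => /cvg_lim <- //; apply: lime_ge.
  by apply: ereal_nonincreasing_is_cvgn => m n mn; apply: le_measure; rewrite ?inE;
    [exact: measurable_over|exact: measurable_over|exact/subsetPset/nd].
near=> n => /=; apply/ltW/rearr_gt => //; last by rewrite ltrBlDr ltrDl divr_gt0.
by rewrite subr_ge0 ltW.
Unshelve. all: by end_near. Qed.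

(** The layer cake formula without a second integration: t |-> excess q t decreases at
    rate q t^(q-1) times the measure of {F > t}. *)
Definition excess q t := \int[mu]_(x in E) (Num.max (F x) t ^+ q - t ^+ q).

Section Excess.
Context (q : nat).
Hypotheses (q0 : (0 < q)%N) (iFq : mu.-integrable E (EFin \o (fun x => F x ^+ q))).

Let pow_le (s t : R) : 0 <= s -> s <= t -> s ^+ q <= t ^+ q.
Proof. by move=> s0 st; rewrite lerXn2r ?nnegrE// (le_trans s0). Qed.

Lemma integrable_excess t : 0 <= t ->
  mu.-integrable E (EFin \o (fun x => Num.max (F x) t ^+ q - t ^+ q)).
Proof.
move=> t0; apply: integrable_dom iFq _ => //.
  apply: measurable_funB; last exact: measurable_cst.
  by apply: measurable_funX; apply: measurable_maxr => //; apply: measurable_funS mF.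
move=> x _; have [Ft|tF] := leP (F x) t.
  by rewrite subrr normr0 exprn_ge0.
by rewrite ger0_norm ?subr_ge0 ?pow_le ?(ltW tF)// gerBl exprn_ge0.
Qed.

Lemma excess_ge0 t : 0 <= t -> 0 <= excess q t.
Proof.
by move=> t0; apply: Rintegral_ge0 => x _; rewrite subr_ge0 pow_le// le_max lexx orbT.
Qed.

Lemma excess0 : excess q 0 = \int[mu]_(x in E) F x ^+ q.
Proof.
by apply: eq_Rintegral => x _; rewrite max_l// expr0n gtn_eqF// subr0.
Qed.

Lemma excess_sub_ge s t : 0 <= s -> s <= t ->
  (t ^+ q - s ^+ q) * fine (mu (over_eq t)) <= excess q s - excess q t.
Proof.
move=> s0; rewrite le_eqVlt => /predU1P[->|st]; first by rewrite !subrr mul0r.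
have t0 : 0 < t by apply: le_lt_trans st.
have -> : (t ^+ q - s ^+ q) * fine (mu (over_eq t)) =
    \int[mu]_(x in E) ((t ^+ q - s ^+ q) * \1_(over_eq t) x).
  rewrite Rintegral_indic_scale//; [exact: measurable_over_eq|exact: subIsetl|exact: mu_over_eq_fin].
rewrite /excess -RintegralB//; [|exact: integrable_excess|exact/integrable_excess/ltW].
apply: le_Rintegral => //.
- apply: integrable_indic_scale => //; [exact: measurable_over_eq|exact: mu_over_eq_fin].
- by apply: integrable_sub => //; apply: integrable_excess => //; exact: ltW.
move=> x Ex; rewrite /= indicE; have [tF|Ft] := leP t (F x).
  rewrite mem_set; last by split => //=; rewrite in_itv/= andbT.
  by rewrite mulr1 max_l ?(le_trans (ltW st))//; lra.
rewrite memNset; last by move=> [_ /=]; rewrite in_itv/= andbT leNgt Ft.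
by rewrite mulr0 subrr subr0 subr_ge0 pow_le// le_max lexx orbT.
Qed.

Lemma excess_sub_le s t : 0 <= s -> s <= t -> (mu (over s) < +oo)%E ->
  excess q s - excess q t <= (t ^+ q - s ^+ q) * fine (mu (over s)).
Proof.
move=> s0 st fin.
have t0 : 0 <= t by apply: le_trans st.
have -> : (t ^+ q - s ^+ q) * fine (mu (over s)) =
    \int[mu]_(x in E) ((t ^+ q - s ^+ q) * \1_(over s) x).
  rewrite Rintegral_indic_scale//; [exact: measurable_over|exact: subIsetl].
rewrite /excess -RintegralB//; [|exact: integrable_excess|exact/integrable_excess].
apply: le_Rintegral => //.
- by apply: integrable_sub => //; exact: integrable_excess.
- by apply: integrable_indic_scale => //; exact: measurable_over.
move=> x Ex; rewrite /= indicE; have [Fs|sF] := leP (F x) s.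
  rewrite memNset; last by move=> [_ /=]; rewrite in_itv/= andbT ltNge Fs.
  rewrite mulr0 subrr sub0r oppr_le0 subr_ge0 pow_le// le_max lexx orbT//.
rewrite mem_set; last by split => //=; rewrite in_itv/= andbT.
rewrite mulr1.
have : F x ^+ q <= Num.max (F x) t ^+ q by rewrite pow_le// le_max lexx.
lra.
Qed.

(** The area under the q-th power of the rearrangement on [0, u]: the part above the
    level rearr u plus a rectangle. This closed formula makes its increments elementary. *)
Definition rearr_primitive u := excess q (rearr u) + rearr u ^+ q * u.

(** These bounds say that the formula is a primitive of the q-th power of the decreasing
    function rearr. *)
Lemma rearr_primitive_incr u v : 0 <= u -> u <= v ->
  rearr v ^+ q * (v - u) <= rearr_primitive v - rearr_primitive u
    <= rearr u ^+ q * (v - u).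
Proof.
move=> u0 uv; rewrite /rearr_primitive.
have v0 := le_trans u0 uv.
have fv := rearr_ge0 v0; have vu := rearr_nincr u0 uv.
have [fu|fu] := ltP 0 (rearr u); last first.
  have -> : rearr u = 0 by apply/eqP; rewrite eq_le fu rearr_ge0.
  have -> : rearr v = 0 by apply/eqP; rewrite eq_le fv (le_trans vu).
  by rewrite expr0n gtn_eqF//= !mul0r; lra.
have pw := pow_le fv vu.
have fin : (mu (over (rearr v)) < +oo)%E.
  by apply: le_lt_trans (mu_over_rearr v0) _; exact: ltry.
have h1 := excess_sub_ge fv vu; have h2 := excess_sub_le fv vu fin.
have h3 : fine (mu (over (rearr v))) <= v.
  by rewrite -lee_fin fineK ?ge0_fin_numE//; exact: mu_over_rearr.
have h4 : u <= fine (mu (over_eq (rearr u))).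
  by rewrite -lee_fin fineK ?ge0_fin_numE//; [exact: mu_over_eq_rearr|exact: mu_over_eq_fin].
exact: layer_bounds pw h1 h2 h3 h4.
Qed.

Lemma rearr_primitive_le u : 0 <= u -> rearr_primitive u <= \int[mu]_(x in E) F x ^+ q.
Proof.
move=> u0; rewrite /rearr_primitive -excess0.
have fu0 := rearr_ge0 u0.
move: (fu0); rewrite le_eqVlt => /predU1P[<-|fu].
  by rewrite expr0n gtn_eqF//= mul0r addr0.
have h1 := excess_sub_ge (lexx 0) fu0.
have h4 : u <= fine (mu (over_eq (rearr u))).
  by rewrite -lee_fin fineK ?ge0_fin_numE//; [exact: mu_over_eq_rearr|exact: mu_over_eq_fin].
move: h1; rewrite expr0n gtn_eqF//= subr0.
have := ler_wpM2l (exprn_ge0 q fu0) h4; lra.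
Qed.

Lemma rearr_primitive0 : rearr_primitive 0 = 0.
Proof.
rewrite /rearr_primitive mulr0 addr0; apply/eqP; rewrite eq_le.
have f0 := rearr_ge0 (lexx 0); rewrite excess_ge0// andbT.
have h := mu_over_rearr (lexx 0).
have e0 : mu (over (rearr 0)) = 0%E by apply/eqP; rewrite eq_le h measure_ge0.
have := @excess_sub_le _ _ f0 (rearr_leM (lexx 0)).
rewrite e0 /= mulr0 => /(_ (ltry _)).
suff -> : excess q M = 0 by rewrite subr0.
rewrite /excess (@eq_Rintegral _ _ _ _ _ (cst 0)); first by rewrite Rintegral_cst// mul0r.
move=> x; rewrite inE /= in_itv/= andbT => lx; rewrite max_r ?subrr// FM//; exact: ltW.
Qed.

End Excess.

(** What lies below the level rearr u contributes at most rearr u ^ 4 times the mass. *)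
Lemma rearr_primitive6_ge u : 0 <= u ->
  mu.-integrable E (EFin \o (fun x => F x ^+ 6)) ->
  \int[mu]_(x in E) F x ^+ 6 - rearr u ^+ 4 * S <= rearr_primitive 6 u.
Proof.
move=> u0 iF6; have t0 := rearr_ge0 u0; set t := rearr u in t0 *.
have : \int[mu]_(x in E) F x ^+ 6 - excess 6 t <= t ^+ 4 * S.
  have iex := integrable_excess iF6 t0.
  rewrite /excess -RintegralB// -RintegralZl//; apply: le_Rintegral => //.
  - exact: integrable_sub.
  - exact: integrable_scale.
  move=> x Ex; have Fx := F0 x; have [Ft|tF] := leP (F x) t.
    rewrite subrr subr0 (_ : 6 = 4 + 2)%N// exprD ler_wpM2r ?exprn_ge0//.
    by rewrite lerXn2r ?nnegrE.
  rewrite opprB addrC subrK (_ : 6 = 4 + 2)%N// exprD ler_wpM2l ?exprn_ge0//.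
  by rewrite lerXn2r ?nnegrE// ltW.
rewrite /rearr_primitive -/t.
have : 0 <= t ^+ 6 * u by rewrite mulr_ge0// exprn_ge0.
lra.
Qed.

(** The energy that F spends above the level rearr u, which is the candidate for the
    energy of the rearrangement on [0, u]. *)
Definition rearr_potential u := fine (nu_ (over (rearr u))).

Let over_fin X : measurable X -> X `<=` E -> nu_ X \is a fin_num.
Proof. by move=> mX XE; exact: (stieltjes_sub_fin nuc mX XE). Qed.

Lemma rearr_potential_bnd u : 0 <= rearr_potential u <= c.
Proof.
apply/andP; split; first exact: fine_ge0.
rewrite -lee_fin fineK; last first.
  by apply: over_fin; [exact: measurable_over|exact: subIsetl].
apply: le_trans (stieltjes_halfline_le nuc).
apply: le_measure; rewrite ?inE//; [exact: measurable_over|exact: subIsetl].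
Qed.

Lemma exists_below t z : l <= z -> (mu (over t) < +oo)%E ->
  exists2 z', z < z' & F z' <= t.
Proof.
move=> lz; apply: contraPP => /forall2NP h; apply/negP; rewrite -leNgt.
apply: (@le_trans _ _ (mu `]z, +oo[%classic)); first by rewrite lebesgue_measure_itv/= ltry.
apply: le_measure; rewrite ?inE; [exact: measurable_itv|exact: measurable_over|].
move=> x /=; rewrite in_itv/= andbT => zx; split; rewrite /= in_itv/= andbT.
  exact: le_lt_trans zx.
by rewrite ltNge; apply/negP; have [] := h x.
Qed.

(** Otherwise, by continuity at r, {F > t} would contain ]l, r + e[ and be longer than
    the circle. *)
Lemma exists_below_circle t : (mu (over t) <= (r - l)%:E)%E ->
  exists y, [/\ l <= y, y <= r & F y <= t].
Proof.
apply: contraPP => /forallNP h.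
have tF y : l <= y -> y <= r -> t < F y.
  by move=> ly yr; rewrite ltNge; apply/negP => yt; apply: (h y).
have /nbhs_ballP[e /= e0 he] : \forall x \near r, t < F x.
  have Fr : t < F r by apply: tF => //; exact: ltW.
  exact: (cvgr_gt (F r) (@cF r) t Fr).
apply/negP; rewrite -ltNge; apply: (@lt_le_trans _ _ (mu `]l, r + e[%classic)).
  rewrite lebesgue_measure_itv/= lte_fin ifT; first by rewrite -EFinB lte_fin ltrD2r ltrDl.
  by rewrite (lt_trans lr)// ltrDl.
apply: le_measure; rewrite ?inE; [exact: measurable_itv|exact: measurable_over|].
move=> x /=; rewrite in_itv/= => /andP[lx xre]; split; rewrite /= in_itv/= andbT//.
have [xr|rx] := leP x r; first by apply: tF => //; exact: ltW.
by apply: he; rewrite /ball/= distrC gtr0_norm ?subr_gt0// ltrBlDl.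
Qed.

(** Between u and v the rearrangement descends from the level rearr u to rearr v. The
    band between these levels has length at most v - u and energy at most the increment
    of the potential, so k crossings of the band give the factor k. Bands with an open
    upper end t' < rearr u are enough, by continuity in t'. *)
Let rearr_energy_gen (k : R) u v : 0 <= u -> u <= v ->
  (forall t', rearr v < t' -> t' < rearr u ->
    crossed nu (k * (t' - rearr v)) (band F l (rearr v) t')) ->
  (k * (rearr v - rearr u)) ^+ 2 <= (v - u) * (rearr_potential v - rearr_potential u).
Proof.
move=> u0 uv h; have v0 := le_trans u0 uv.
have := rearr_nincr u0 uv; rewrite le_eqVlt => /predU1P[e|vu].
  by rewrite /rearr_potential e !subrr !mulr0 expr0n.
have a0 := rearr_ge0 v0; have b0 : 0 < rearr u := le_lt_trans a0 vu.
have h1 := mu_over_rearr v0; have h2 := mu_over_eq_rearr u0 b0.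
have h3 := mu_over_eq_fin b0.
rewrite /rearr_potential; move: h vu a0 b0 h1 h2 h3.
move: (rearr v) (rearr u) => a b h ab a0 b0 h1 h2 h3.
have mB := measurable_band l cF a b.
have mo := measurable_over; have moe := measurable_over_eq.
have oaoo : (mu (over a) < +oo)%E by rewrite (le_lt_trans h1)// ltry.
have Bsub : band F l a b `<=` over a.
  by move=> x [Ex /=]; rewrite in_itv/= => /andP[ax _]; split => //=; rewrite in_itv/= andbT.
have oesub : over_eq b `<=` over a.
  by move=> x [Ex /=]; rewrite in_itv/= andbT => bx; split => //=; rewrite in_itv/= andbT (lt_le_trans ab).
have muB : (mu (band F l a b) < +oo)%E.
  by apply: le_lt_trans oaoo; apply: le_measure; rewrite ?inE//; exact: mo.
have k1 : fine (mu (band F l a b)) <= v - u.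
  have d : band F l a b `&` over_eq b = set0.
    rewrite -subset0 => x [[_ /=]]; rewrite in_itv/= => /andP[_ xb] [_ /=].
    by rewrite in_itv/= andbT leNgt xb.
  have : (mu (band F l a b) + mu (over_eq b) <= v%:E)%E.
    rewrite -measureU//; last exact: moe.
    apply: le_trans h1; apply: le_measure; rewrite ?inE//; [|exact: mo|by rewrite subUset].
    by apply: measurableU => //; exact: moe.
  rewrite -(fineK (_ : mu (band F l a b) \is a fin_num)) ?ge0_fin_numE//.
  have : (u%:E <= (fine (mu (over_eq b)))%:E)%E by rewrite fineK ?ge0_fin_numE.
  rewrite -[X in (_ + X)%E](fineK (_ : mu (over_eq b) \is a fin_num)) ?ge0_fin_numE//.
  by rewrite -EFinD !lee_fin => g1 g2; rewrite lerBrDr (le_trans _ g2)// lerD2l.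
have osub : over b `<=` over a by apply: over_subset; exact: ltW.
have nB : nu_ (band F l a b) \is a fin_num by apply: over_fin => //; exact: subIsetl.
have nob : nu_ (over b) \is a fin_num by apply: over_fin; [exact: mo|exact: subIsetl].
have noa : nu_ (over a) \is a fin_num by apply: over_fin; [exact: mo|exact: subIsetl].
have k2 : fine (nu_ (band F l a b)) <= fine (nu_ (over a)) - fine (nu_ (over b)).
  have d : band F l a b `&` over b = set0.
    rewrite -subset0 => x [[_ /=]]; rewrite in_itv/= => /andP[_ xb] [_ /=].
    by rewrite in_itv/= andbT ltNge (ltW xb).
  rewrite lerBrDr -fineD// fine_le ?fin_numD ?nB//.
  rewrite -measureU//; last exact: mo.
  apply: le_measure; rewrite ?inE//; [|exact: mo|by rewrite subUset].
  by apply: measurableU => //; exact: mo.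
have -> : (k * (a - b)) ^+ 2 = (k * (b - a)) ^+ 2 by ring.
rewrite -subr_ge0.
apply: (@ge0_at_left _ (fun t => (v - u) *
  (fine (nu_ (over a)) - fine (nu_ (over b))) - (k * (t - a)) ^+ 2) b a ab).
  apply: cvgB; first exact: cvg_cst.
  by apply: cvgM; (apply: cvgM; [exact: cvg_cst|apply: cvgB; [exact: cvg_id|exact: cvg_cst]]).
move=> t at_ tb; rewrite subr_ge0.
have cr : crossed nu (k * (t - a)) (band F l a b).
  apply: (crossed_sub nuc _ _ _ _ _ (h t at_ tb)) => //.
  - exact: (measurable_band l cF).
  - by move=> x [Ex /=]; rewrite in_itv/= => /andP[h4 h5]; split => //=; rewrite in_itv/= h4 (lt_trans h5).
  - exact: subIsetl.
by apply: le_trans cr _; apply: ler_pM; rewrite ?fine_ge0.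
Qed.

Let over_neq0 u t : 0 <= u -> 0 <= t -> t < rearr u -> exists2 z, l <= z & t < F z.
Proof.
move=> u0 t0 /(rearr_gt u0 t0) h.
have : over t !=set0.
  apply/set0P/eqP => e; move: h; rewrite e measure0 lte_fin ltNge u0//.
by move=> [z [/= + +]]; rewrite !in_itv/= !andbT => lz tz; exists z => //; exact: ltW.
Qed.

(** F has finite mass, hence comes back below any positive level: one crossing. *)
Lemma rearr_energy u v : 0 <= u -> u <= v -> energy_le rearr rearr_potential u v.
Proof.
move=> u0 uv; rewrite /energy_le; have v0 := le_trans u0 uv.
rewrite -[rearr v - _]mul1r; apply: rearr_energy_gen => // t vt tu; rewrite mul1r.
have [z lz tz] := over_neq0 u0 (ltW (le_lt_trans (rearr_ge0 v0) vt)) tu.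
have oo := le_lt_trans (mu_over_rearr v0) (ltry _).
have [z' zz' z'v] := exists_below lz oo.
apply: (band_crossed cF pF nuc _ _ lz zz') => //; last exact: ltW.
apply: le_lt_trans oo; apply: le_measure; rewrite ?inE; [exact: (measurable_band l cF)|exact: measurable_over|].
by move=> x [Ex /=]; rewrite in_itv/= => /andP[ax _]; split => //=; rewrite in_itv/= andbT.
Qed.

(** A superlevel set of measure at most the length of the circle misses a point of the
    circle: two crossings. *)
Lemma rearr_energy2 u v : 0 <= u -> u <= v -> v <= r - l ->
  4 * (rearr v - rearr u) ^+ 2 <= (v - u) * (rearr_potential v - rearr_potential u).
Proof.
move=> u0 uv vrl; have v0 := le_trans u0 uv.
rewrite (_ : 4 * _ = (2 * (rearr v - rearr u)) ^+ 2); last by rewrite exprMn; congr (_ * _); ring.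
apply: rearr_energy_gen => // t vt tu.
have [z lz tz] := over_neq0 u0 (ltW (le_lt_trans (rearr_ge0 v0) vt)) tu.
have ov := mu_over_rearr v0.
have oo := le_lt_trans ov (ltry _).
have [z' zz' z'v] := exists_below lz oo.
have [|y [ly yr yv]] := @exists_below_circle (rearr v).
  by rewrite (le_trans ov)// lee_fin.
apply: (band_crossed2 cF pF nuc lr Flr _ _ ly yr yv lz zz') => //; last exact: ltW.
apply: le_lt_trans oo; apply: le_measure; rewrite ?inE; [exact: (measurable_band l cF)|exact: measurable_over|].
by move=> x [Ex /=]; rewrite in_itv/= => /andP[ax _]; split => //=; rewrite in_itv/= andbT.
Qed.

End Rearrangement.

(** * The energy budget and its rearranged form *)

Section Pointwise.
Context {R : realType}.

Lemma fmap_ultra (X Y : Type) (f : X -> Y) (G : set_system X) :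
  UltraFilter G -> UltraFilter (f @ G).
Proof.
move=> UG; split => [|H PH sub]; first exact: fmap_proper_filter.
rewrite eqEsubset; split => // B HB.
have [//|GnB] := in_ultra_setVsetC (f @^-1` B) UG.
have nHB : H (~` B) by exact: sub.
have : H (B `&` ~` B) by exact: filterI.
by rewrite setICr => /filter_not_empty.
Qed.

(** Along an ultrafilter every bounded sequence converges, so one ultrafilter serves all
    points at once; this takes the place of extracting a subsequence. *)
Lemma pointwise_cluster (X : Type) (g : nat -> X -> R) (M : X -> R) :
  (forall n x, `|g n x| <= M x) ->
  exists (G : set_system nat) (p : X -> R),
    [/\ ProperFilter G, eventually `<=` G & forall x, g n x @[n --> G] --> p x].
Proof.
move=> gM.
have [G [UG sub]] := ultraFilterLemma eventually_filter.
have PG : ProperFilter G by exact: ultra_proper.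
have h x : exists p : R, (fun n => g n x) @ G --> p.
  have := @segment_compact R (- M x) (M x); rewrite compact_ultra.
  have UGx : UltraFilter (g n x @[n --> G]) by exact: fmap_ultra.
  move=> /(_ _ UGx)[|p [_ Gp]]; last by exists p.
  apply: (@filterS _ G _ setT); last exact: filterT.
  by move=> n _ /=; rewrite in_itv/= -ler_norml.
exists G, (fun x => sval (cid (h x))); split => // x.
by case: cid.
Qed.

End Pointwise.

Section Budget.
Context {R : realType}.
Implicit Types (F : R -> R).
Notation mu := (@lebesgue_measure R).
Context (a l r : R).
Hypotheses (a0 : 0 < a) (lr : l < r).
Local Notation E := `]l, +oo[%classic.

(** The condition B_omega(F) <= j on the unrolled tadpole, with a = -omega; F l = F r
    closes the circle. *)
Definition budget F j :=
  [/\ continuous F, F l = F r,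
     mu.-integrable E (EFin \o (fun x => F x ^+ 2)) &
     exists2 c, energy_bound l F c & c + a * \int[mu]_(x in E) F x ^+ 2 <= j].

Definition sextic F := \int[mu]_(x in E) F x ^+ 6.

Lemma energy_bound_ge0 F c : energy_bound l F c -> 0 <= c.
Proof. by move=> [A pA Ac]; have := Ac l (lexx l); rewrite subrr. Qed.

Lemma mass_ge0 F : 0 <= \int[mu]_(x in E) F x ^+ 2.
Proof. by apply: Rintegral_ge0 => x _; exact: sqr_ge0. Qed.

Lemma budget_ge0 F j : budget F j -> 0 <= j.
Proof.
move=> [_ _ _ [c /energy_bound_ge0 c0]]; apply: le_trans.
by rewrite addr_ge0// mulr_ge0 ?mass_ge0// ltW.
Qed.

Lemma budget_mass F j : budget F j -> \int[mu]_(x in E) F x ^+ 2 <= j / a.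
Proof.
move=> [_ _ _ [c /energy_bound_ge0 c0]] h; rewrite ler_pdivlMr// mulrC.
by move: h; lra.
Qed.

Lemma energy_bound_abs F c : energy_bound l F c -> energy_bound l (fun x => `|F x|) c.
Proof.
move=> [A pA Ac]; exists A => // x y lx xy; apply: le_trans (pA x y lx xy).
rewrite -[leLHS]real_normK ?num_real// -[leRHS]real_normK ?num_real//.
by rewrite lerXn2r ?nnegrE// ler_dist_dist.
Qed.

Lemma budget_abs F j : budget F j -> budget (fun x => `|F x|) j.
Proof.
move=> [cF Flr iF [c eF h]].
have E2 : (fun x => `|F x| ^+ 2) = (fun x => F x ^+ 2).
  by apply/funext => x; rewrite real_normK ?num_real.
split; rewrite ?E2//; last first.
- by exists c => //; exact: energy_bound_abs.
- by rewrite Flr.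
by move=> x; apply: continuous_comp; [exact: cF|exact: norm_continuous].
Qed.

Lemma sextic_abs F : sextic (fun x => `|F x|) = sextic F.
Proof.
apply: eq_Rintegral => x _.
by rewrite (_ : 6 = 2 * 3)%N// !exprM real_normK ?num_real.
Qed.

Lemma energy_bound_scale k F c : energy_bound l F c ->
  energy_bound l (fun x => k * F x) (k ^+ 2 * c).
Proof.
move=> [A pA Ac]; exists (fun x => k ^+ 2 * A x) => [x y lx xy|y ly].
  have := ler_wpM2l (sqr_ge0 k) (pA x y lx xy); rewrite /energy_le; lra.
by rewrite -mulrBr; apply: ler_wpM2l; [exact: sqr_ge0|exact: Ac].
Qed.

Lemma budget_scale k F j : budget F j -> budget (fun x => k * F x) (k ^+ 2 * j).
Proof.
move=> [cF Flr iF [c eF h]].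
have E2 : (fun x => (k * F x) ^+ 2) = (fun x => k ^+ 2 * F x ^+ 2).
  by apply/funext => x; rewrite exprMn.
split.
- by move=> x; apply: cvgM; [exact: cvg_cst|exact: cF].
- by rewrite Flr.
- by rewrite E2; exact: integrable_scale.
exists (k ^+ 2 * c); first exact: energy_bound_scale.
rewrite E2 RintegralZl// mulrCA -mulrDr.
by apply: ler_wpM2l => //; exact: sqr_ge0.
Qed.

(** The Sobolev inequality on the half-line. *)
Lemma budget_sup F j x : budget F j -> l <= x -> F x ^+ 2 <= 2 * (1 + a^-1) * j.
Proof.
move=> bF lx; have bm := budget_mass bF; have j0 := budget_ge0 bF.
move: (bF) => [cF Flr iF [c eF h]].
have [A [pA Ab]] := cumulative_potential cF eF.
apply: le_trans (energy_sup pA Ab iF lx) _.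
have : 0 <= a * \int[mu]_(x in E) F x ^+ 2 by rewrite mulr_ge0 ?mass_ge0// ltW.
move: bm; rewrite [j / a]mulrC; lra.
Qed.

Lemma sextic_le_pointwise F j x : budget F j -> l < x ->
  F x ^+ 6 <= (2 * (1 + a^-1) * j) ^+ 2 * F x ^+ 2.
Proof.
move=> bF lx; rewrite (_ : 6 = 2 * 2 + 2)%N// exprD ler_wpM2r ?sqr_ge0// exprM.
rewrite lerXn2r ?nnegrE ?sqr_ge0//.
  by rewrite !mulr_ge0 ?addr_ge0 ?invr_ge0 ?(ltW a0)// (budget_ge0 bF).
by apply: (budget_sup bF); exact: ltW.
Qed.

Lemma budget_sextic_integrable F j : budget F j ->
  mu.-integrable E (EFin \o (fun x => F x ^+ 6)).
Proof.
move=> bF; move: (bF) => [cF _ iF _].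
have h : mu.-integrable E (EFin \o (fun x => (2 * (1 + a^-1) * j) ^+ 2 * F x ^+ 2)).
  exact: integrable_scale.
apply: integrable_dom h _ => //.
  by apply: measurable_funX; apply: measurable_funS (continuous_measurable_fun cF).
move=> x; rewrite /= in_itv/= andbT => lx.
by rewrite ger0_norm ?(sextic_le_pointwise bF)// (exprM _ 3 2) sqr_ge0.
Qed.

Lemma budget_sextic_le F j : budget F j -> sextic F <= (2 * (1 + a^-1) * j) ^+ 2 * (j / a).
Proof.
move=> bF; have b6 := budget_sextic_integrable bF; move: (bF) => [cF _ iF _].
apply: (@le_trans _ _ ((2 * (1 + a^-1) * j) ^+ 2 * \int[mu]_(x in E) F x ^+ 2)); last first.
  by apply: ler_wpM2l; [exact: sqr_ge0|exact: budget_mass].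
rewrite -RintegralZl//; apply: le_Rintegral => //; first exact: integrable_scale.
by move=> x; rewrite /= in_itv/= andbT; exact: sextic_le_pointwise.
Qed.

End Budget.

Section Profile.
Context {R : realType}.
Implicit Types (F f A B D : R -> R).
Notation mu := (@lebesgue_measure R).
Context (a : R) (a0 : 0 < a).

(** What rearrangement leaves of a function of budget 1: a decreasing function f, a
    potential A for which the energy inequality improves by the factor 4 on [0, L],
    where L is the length of the circle, and primitives B and D of f^2 and f^6. All
    clauses are closed under pointwise limits, which is why primitives replace
    integrals. *)
Record profile L f A B D : Prop := Profile {
  profile_ge0 : forall x, 0 <= x -> 0 <= f x ;
  profile_nincr : forall x y, 0 <= x -> x <= y -> f y <= f x ;
  profile_energy : forall x y, 0 <= x -> x <= y -> energy_le f A x y ;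
  profile_energy2 : forall x y, 0 <= x -> x <= y -> y <= L ->
    4 * (f y - f x) ^+ 2 <= (y - x) * (A y - A x) ;
  profile_mass : forall x y, 0 <= x -> x <= y ->
    f y ^+ 2 * (y - x) <= B y - B x <= f x ^+ 2 * (y - x) ;
  profile_sextic : forall x y, 0 <= x -> x <= y ->
    f y ^+ 6 * (y - x) <= D y - D x <= f x ^+ 6 * (y - x) ;
  profile_mass0 : B 0 = 0 ;
  profile_sextic0 : D 0 = 0 ;
  profile_energy_ge0 : forall x, 0 <= x -> 0 <= A x ;
  profile_budget : forall x y, 0 <= x -> 0 <= y -> A x + a * B y <= 1 }.

(** The last clause is the tightness that the limit needs: f(x)^2 <= 1 / (a x), so the
    part of the sextic integral beyond x is at most (a x)^-2 times the mass. *)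
Lemma profile_of_budget l r F : l < r -> budget a l r F 1 -> (forall x, 0 <= F x) ->
  exists f A B D, profile (r - l) f A B D /\
    (forall x, 0 <= x -> `|f x| <= 2 * (1 + a^-1) + 1) /\
    (forall x, 0 < x -> sextic l F - (a * x) ^- 2 / a <= D x).
Proof.
move=> lr bF F0; have b6 := budget_sextic_integrable a0 bF.
have bm := budget_mass a0 bF.
move: (bF) => [cF Flr iF [c eF h]].
have [A [pA Ac]] := cumulative_potential cF eF.
set K := 2 * (1 + a^-1).
have p2 : (0 < 2)%N by []. have p6 : (0 < 6)%N by [].
have K0 : 0 <= K by rewrite mulr_ge0 ?addr_ge0 ?invr_ge0 ?(ltW a0).
have FM x : l <= x -> F x <= K + 1.
  by move=> /(budget_sup a0 bF); rewrite mulr1 -/K; nra.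
have M0 : 0 <= K + 1 by rewrite addr_ge0.
exists (rearr F l), (rearr_potential A F l),
  (rearr_primitive F l 2), (rearr_primitive F l 6).
have fge0 := rearr_ge0 M0 FM; have fle := rearr_leM M0 FM.
have ni := rearr_nincr cF M0 FM.
split; first split.
- by [].
- by [].
- exact: (rearr_energy cF pA Ac F0 iF M0 FM).
- exact: (rearr_energy2 cF pA Ac lr Flr F0 iF M0 FM).
- exact: (rearr_primitive_incr cF F0 iF M0 FM p2 iF).
- exact: (rearr_primitive_incr cF F0 iF M0 FM p6 b6).
- exact: (rearr_primitive0 cF F0 M0 FM iF).
- exact: (rearr_primitive0 cF F0 M0 FM b6).
- by move=> x _; have /andP[] := rearr_potential_bnd cF Ac x.
- move=> x y x0 y0; have /andP[_ h1] := rearr_potential_bnd cF Ac x.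
  have h2 := rearr_primitive_le cF F0 iF M0 FM p2 iF y0.
  apply: le_trans h; apply: lerD => //.
  by rewrite ler_pM2l.
split => [x x0|x x0]; first by rewrite ger0_norm ?fge0 ?fle.
apply: le_trans (rearr_primitive6_ge cF F0 iF M0 FM (ltW x0) b6).
rewrite lerD2l lerN2.
(* rearr is decreasing, so rearr(x)^2 x is at most the mass, hence at most 1 / a. *)
have h1 : rearr F l x ^+ 2 * x <= a^-1.
  have /andP[h1 _] := rearr_primitive_incr cF F0 iF M0 FM p2 iF (lexx 0) (ltW x0).
  rewrite (rearr_primitive0 cF F0 M0 FM iF) !subr0 in h1.
  apply: le_trans h1 _.
  apply: le_trans (rearr_primitive_le cF F0 iF M0 FM p2 iF (ltW x0)) _.
  by move: bm; rewrite div1r.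
have h2 : rearr F l x ^+ 2 <= (a * x)^-1.
  by rewrite invfM ler_pdivlMr.
have h3 := mass_ge0 l F.
rewrite (_ : 4 = 2 * 2)%N// exprM; apply: ler_pM => //.
- by rewrite sqr_ge0.
- by rewrite -exprVn lerXn2r ?nnegrE ?sqr_ge0 ?invr_ge0 ?mulr_ge0// ltW.
- by move: bm; rewrite div1r.
Qed.

Lemma profile_lim L (G : set_system nat) (f A B D : nat -> R -> R) f' A' B' D' :
  ProperFilter G ->
  (forall n, profile L (f n) (A n) (B n) (D n)) ->
  (forall x, 0 <= x -> f n x @[n --> G] --> f' x) ->
  (forall x, 0 <= x -> A n x @[n --> G] --> A' x) ->
  (forall x, 0 <= x -> B n x @[n --> G] --> B' x) ->
  (forall x, 0 <= x -> D n x @[n --> G] --> D' x) ->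
  profile L f' A' B' D'.
Proof.
move=> PG P cf cA cB cD.
have le (u v : nat -> R) (p q : R) : u n @[n --> G] --> p -> v n @[n --> G] --> q ->
    (forall n, u n <= v n) -> p <= q.
  by move=> cu cv uv; apply: (ler_cvg_to cu cv); apply: filterE.
have eqc (u : nat -> R) (p k : R) : u n @[n --> G] --> p -> (forall n, u n = k) -> p = k.
  move=> cu uk; apply/eqP; rewrite eq_le; apply/andP; split.
    by apply: (le _ _ _ _ cu (cvg_cst k)) => n; rewrite uk.
  by apply: (le _ _ _ _ (cvg_cst k) cu) => n; rewrite uk.
have cX q (u : nat -> R) (p : R) : u n @[n --> G] --> p -> (fun n => u n ^+ q) @ G --> p ^+ q.
  by move=> cu; apply: (@cvg_comp _ _ _ u (fun x : R => x ^+ q) _ _ _ cu); exact: exprn_continuous.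
split.
- by move=> x x0; apply: (le _ _ _ _ (cvg_cst 0) (cf x x0)) => n; exact: (profile_ge0 (P n)).
- move=> x y x0 xy; have y0 := le_trans x0 xy.
  by apply: (le _ _ _ _ (cf y y0) (cf x x0)) => n; exact: (profile_nincr (P n)).
- move=> x y x0 xy; have y0 := le_trans x0 xy.
  apply: (le (fun n => (f n y - f n x) ^+ 2) (fun n => (y - x) * (A n y - A n x))).
  + by apply: cX; apply: cvgB; [exact: cf|exact: cf].
  + by apply: cvgM; [exact: cvg_cst|apply: cvgB; [exact: cA|exact: cA]].
  + by move=> n; exact: (profile_energy (P n)).
- move=> x y x0 xy yL; have y0 := le_trans x0 xy.
  apply: (le (fun n => 4 * (f n y - f n x) ^+ 2) (fun n => (y - x) * (A n y - A n x))).
  + by apply: cvgM; [exact: cvg_cst|apply: cX; apply: cvgB; [exact: cf|exact: cf]].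
  + by apply: cvgM; [exact: cvg_cst|apply: cvgB; [exact: cA|exact: cA]].
  + by move=> n; exact: (profile_energy2 (P n)).
- move=> x y x0 xy; have y0 := le_trans x0 xy.
  have cBd : B n y - B n x @[n --> G] --> B' y - B' x by apply: cvgB; [exact: cB|exact: cB].
  apply/andP; split.
    apply: (le (fun n => f n y ^+ 2 * (y - x)) _ _ _ _ cBd).
      by apply: cvgM; [apply: cX; exact: cf|exact: cvg_cst].
    by move=> n; have /andP[] := profile_mass (P n) x0 xy.
  apply: (le _ (fun n => f n x ^+ 2 * (y - x)) _ _ cBd).
    by apply: cvgM; [apply: cX; exact: cf|exact: cvg_cst].
  by move=> n; have /andP[] := profile_mass (P n) x0 xy.
- move=> x y x0 xy; have y0 := le_trans x0 xy.
  have cDd : D n y - D n x @[n --> G] --> D' y - D' x by apply: cvgB; [exact: cD|exact: cD].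
  apply/andP; split.
    apply: (le (fun n => f n y ^+ 6 * (y - x)) _ _ _ _ cDd).
      by apply: cvgM; [apply: cX; exact: cf|exact: cvg_cst].
    by move=> n; have /andP[] := profile_sextic (P n) x0 xy.
  apply: (le _ (fun n => f n x ^+ 6 * (y - x)) _ _ cDd).
    by apply: cvgM; [apply: cX; exact: cf|exact: cvg_cst].
  by move=> n; have /andP[] := profile_sextic (P n) x0 xy.
- by apply: (eqc _ _ _ (cB 0 (lexx 0))) => n; exact: (profile_mass0 (P n)).
- by apply: (eqc _ _ _ (cD 0 (lexx 0))) => n; exact: (profile_sextic0 (P n)).
- by move=> x x0; apply: (le _ _ _ _ (cvg_cst 0) (cA x x0)) => n; exact: (profile_energy_ge0 (P n)).
- move=> x y x0 y0; apply: (le (fun n => A n x + a * B n y) (fun=> 1)).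
  + apply: cvgD; first exact: cA.
    by apply: cvgM; [exact: cvg_cst|exact: cB].
  + exact: cvg_cst.
  + by move=> n; exact: (profile_budget (P n)).
Qed.

End Profile.

(** * Folding a profile onto the tadpole *)

Section Fold.
Context {R : realType}.
Implicit Types (F f A B D : R -> R) (x y : R).
Notation mu := (@lebesgue_measure R).
Context (a h : R) (a0 : 0 < a) (h0 : 0 < h).

(** The length of the part of the tadpole within distance |x| of the middle of the
    circle: 2 |x| while that part is contained in the circle, |x| + h afterwards. *)
Definition ball_length x := `|x| + Num.min `|x| h.

(** The function on the tadpole that is symmetric around the middle of the circle and
    has f as its decreasing rearrangement. *)
Definition fold f x := f (ball_length x).

(** With A' = f'^2 in mind, the derivative is A'(2 |x|) on the circle, and A'(x + h) on
    the half-line; the constants make it continuous at 0 and at h. *)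
Definition fold_primitive A x :=
  if x <= 0 then - A (- (2 * x)) / 2
  else if x <= h then A (2 * x) / 2 - A 0 else A (x + h) - A (2 * h) / 2 - A 0.

Lemma fold_left f x : - h <= x -> x <= 0 -> fold f x = f (- (2 * x)).
Proof.
move=> hx x0; rewrite /fold /ball_length ler0_norm// min_l; last by have := h0; lra.
by congr f; lra.
Qed.

Lemma fold_mid f x : 0 <= x -> x <= h -> fold f x = f (2 * x).
Proof.
by move=> x0 xh; rewrite /fold /ball_length ger0_norm// min_l//; congr f; lra.
Qed.

Lemma fold_right f x : h <= x -> fold f x = f (x + h).
Proof.
move=> hx; rewrite /fold /ball_length ger0_norm; last exact: le_trans (ltW h0) hx.
by rewrite min_r.
Qed.

Lemma fold_primitive_left A x : x <= 0 -> fold_primitive A x = - A (- (2 * x)) / 2.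
Proof. by rewrite /fold_primitive => ->. Qed.

Lemma fold_primitive_mid A x : 0 <= x -> x <= h -> fold_primitive A x = A (2 * x) / 2 - A 0.
Proof.
rewrite /fold_primitive le_eqVlt => /predU1P[<- _|x0 ->].
  by rewrite lexx mulr0 oppr0; lra.
by rewrite leNgt x0.
Qed.

Lemma fold_primitive_right A x : h <= x ->
  fold_primitive A x = A (x + h) - A (2 * h) / 2 - A 0.
Proof.
move=> hx; rewrite /fold_primitive leNgt (lt_le_trans h0 hx)/=.
move: hx; rewrite le_eqVlt => /predU1P[<-|hx]; last by rewrite leNgt hx.
by rewrite lexx (_ : h + h = 2 * h); lra.
Qed.

Lemma ball_length_ge0 x : 0 <= ball_length x.
Proof. by rewrite addr_ge0// le_min normr_ge0 (ltW h0). Qed.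

Lemma ball_length_le x y : `|x| <= `|y| -> ball_length x <= ball_length y.
Proof.
by move=> xy; rewrite lerD// le_min !ge_min xy lexx orbT.
Qed.

Lemma ball_length_lip x y : `|x| <= `|y| -> ball_length y - ball_length x <= 2 * `|y - x|.
Proof.
move=> xy; have h1 : `|y| - `|x| <= `|y - x| by exact: lerB_dist.
have h2 : Num.min `|y| h <= Num.min `|x| h + (`|y| - `|x|).
  have [h3|h3] := leP `|x| h; first by rewrite ge_min; apply/orP; left; lra.
  by rewrite ge_min; apply/orP; right; lra.
by rewrite /ball_length; lra.
Qed.

Context (f A B D : R -> R).
Hypothesis (P : profile a (2 * h) f A B D).
Local Notation W := (fold f).

Lemma fold_ge0 x : 0 <= W x.
Proof. exact/(profile_ge0 P)/ball_length_ge0. Qed.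

Lemma fold_even x : W (- x) = W x.
Proof. by rewrite /fold /ball_length normrN. Qed.

Lemma fold_nincr x y : 0 <= x -> x <= y -> W y <= W x.
Proof.
move=> x0 xy; apply: (profile_nincr P); first exact: ball_length_ge0.
by apply: ball_length_le; rewrite !ger0_norm// (le_trans x0).
Qed.

Let A_le1 x : 0 <= x -> A x <= 1.
Proof.
by move=> x0; have := profile_budget P x0 (lexx 0); rewrite (profile_mass0 P) mulr0 addr0.
Qed.

(** The potential of a profile is at most 1, and the change of variables at most doubles
    distances. *)
Lemma fold_holder x y : (W y - W x) ^+ 2 <= 2 * `|y - x|.
Proof.
wlog xy : x y / `|x| <= `|y|.
  have [xy /(_ _ _ xy) //|/ltW yx /(_ _ _ yx)] := leP `|x| `|y|.
  by rewrite distrC; congr (_ <= _); ring.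
have bx := ball_length_ge0 x; have bxy := ball_length_le xy.
apply: le_trans (profile_energy P bx bxy) _.
have h1 := A_le1 (le_trans bx bxy); have h2 := profile_energy_ge0 P bx.
have h3 := ball_length_lip xy.
apply: le_trans h3; rewrite -[leRHS]mulr1; apply: ler_wpM2l; first by rewrite subr_ge0.
lra.
Qed.

Lemma fold_continuous : continuous W.
Proof.
move=> x; apply/cvgrPdist_le => /= e e0.
near=> y; rewrite -ler_sqr ?nnegrE ?(ltW e0)// real_normK ?num_real//.
apply: le_trans (fold_holder _ _) _.
suff : `|x - y| <= e ^+ 2 / 2 by lra.
near: y; apply: (@cvgr_dist_le _ _ _ _ _ idfun x) => //.
by rewrite divr_gt0// exprn_gt0.
Unshelve. all: by end_near. Qed.

(** On the circle (fold f)' has size 2 |f'(2 |x|)|, whose square is 4 f'^2; the factor 4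
    in the definition of a profile absorbs it. *)
Lemma fold_potential : potential (- h) W (fold_primitive A).
Proof.
have s1 x y : - h <= x -> x <= y -> y <= 0 -> energy_le W (fold_primitive A) x y.
  move=> hx xy y0; have x0 := le_trans xy y0; have hy := le_trans hx xy.
  rewrite /energy_le !fold_left// !fold_primitive_left//.
  have k1 : 0 <= - (2 * y) by lra.
  have k2 : - (2 * y) <= - (2 * x) by lra.
  have k3 : - (2 * x) <= 2 * h by lra.
  by have := profile_energy2 P k1 k2 k3; lra.
have s2 x y : 0 <= x -> x <= y -> y <= h -> energy_le W (fold_primitive A) x y.
  move=> x0 xy yh; have y0 := le_trans x0 xy; have xh := le_trans xy yh.
  rewrite /energy_le !fold_mid// !fold_primitive_mid//.
  have k1 : 0 <= 2 * x by lra.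
  have k2 : 2 * x <= 2 * y by lra.
  have k3 : 2 * y <= 2 * h by lra.
  by have := profile_energy2 P k1 k2 k3; lra.
have s3 x y : h <= x -> x <= y -> energy_le W (fold_primitive A) x y.
  move=> hx xy; have hy := le_trans hx xy.
  rewrite /energy_le !fold_right// !fold_primitive_right//.
  have k1 : 0 <= x + h by have := h0; lra.
  have k2 : x + h <= y + h by lra.
  by have := profile_energy P k1 k2; rewrite /energy_le; lra.
move=> x y hx xy.
have s23 u v : 0 <= u -> u <= v -> energy_le W (fold_primitive A) u v.
  move=> u0 uv; have [vh|hv] := leP v h; first exact: s2.
  have [hu|uh] := leP h u; first exact: s3.
  by apply: (@energy_le_trans _ _ _ u h v); rewrite ?(ltW uh) ?(ltW hv)//; [apply: s2 => //; exact: ltW|apply: s3 => //; exact: ltW].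
have [y0|y0] := leP y 0; first exact: s1.
have [x0|x0] := leP 0 x; first exact: s23.
by apply: (@energy_le_trans _ _ _ x 0 y); rewrite ?(ltW x0) ?(ltW y0)//; [apply: s1 => //; exact: ltW|apply: s23 => //; exact: ltW].
Qed.

(** C is a primitive of f^q, and the two halves of the circle together sweep [0, 2 h]
    once. *)
Lemma fold_primitive_on q (C : R -> R) X : C 0 = 0 ->
  (forall x y, 0 <= x -> x <= y ->
    f y ^+ q * (y - x) <= C y - C x <= f x ^+ q * (y - x)) ->
  primitive_on (- h) X (fun x => W x ^+ q) (fold_primitive C).
Proof.
move=> C0 sw.
apply: (@primitive_on_glue _ _ h).
  apply: (@primitive_on_glue _ _ 0); apply: primitive_on_monotone => x y hx xy y0; [left|right].
    have x0 := le_trans xy y0; have hy := le_trans hx xy.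
    rewrite !fold_left// !fold_primitive_left//.
    have k1 : 0 <= - (2 * y) by lra.
    have k2 : - (2 * y) <= - (2 * x) by lra.
    by have := sw _ _ k1 k2; lra.
  have x0 := hx; have y0' := le_trans x0 xy; have xh := le_trans xy y0.
  rewrite !fold_mid// !fold_primitive_mid//.
  have k1 : 0 <= 2 * x by lra.
  have k2 : 2 * x <= 2 * y by lra.
  by have := sw _ _ k1 k2; lra.
apply: primitive_on_monotone => x y hx xy _; right.
have hy := le_trans hx xy.
rewrite !fold_right// !fold_primitive_right//.
have k1 : 0 <= x + h by have := h0; lra.
have k2 : x + h <= y + h by lra.
by have := sw _ _ k1 k2; lra.
Qed.

Let fold_integral q (C : R -> R) X : C 0 = 0 ->
  (forall x y, 0 <= x -> x <= y ->
    f y ^+ q * (y - x) <= C y - C x <= f x ^+ q * (y - x)) -> h <= X ->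
  \int[mu]_(x in `[- h, X]) W x ^+ q = C (X + h).
Proof.
move=> C0 sw hX; rewrite (@Rintegral_primitive _ _ _ _ (fold_primitive C)).
- rewrite fold_primitive_right// fold_primitive_left; last by have := h0; lra.
  by rewrite C0 (_ : - (2 * - h) = 2 * h); lra.
- by have := h0; lra.
- move=> x; apply: (@continuous_comp _ _ _ W (fun x : R => x ^+ q)).
    exact: fold_continuous.
  exact: exprn_continuous.
- exact: fold_primitive_on.
Qed.

Let potential_le u : - h <= u ->
  exists2 z, 0 <= z & fold_primitive A u - fold_primitive A (- h) <= A z.
Proof.

have key y : h <= y -> fold_primitive A y - fold_primitive A (- h) <= A (y + h).
  move=> hy; rewrite fold_primitive_right// fold_primitive_left; last by have := h0; lra.
  have := profile_energy_ge0 P (lexx 0).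
  by rewrite (_ : - (2 * - h) = 2 * h); lra.
move=> hy; have [hy'|yh] := leP h u.
  by exists (u + h); [have := h0; lra|exact: key].
exists (h + h); first by have := h0; lra.
apply: le_trans (key h (lexx h)); rewrite lerD2r.
by apply: (potential_nd fold_potential) => //; exact: ltW.
Qed.

Lemma fold_budget : budget a (- h) h W 1.
Proof.
have mass_le y X : - h <= y -> h <= X ->
    \int[mu]_(x in `[- h, X]) W x ^+ 2 <= (1 - (fold_primitive A y - fold_primitive A (- h))) / a.
  move=> hy hX; rewrite (fold_integral (profile_mass0 P) (profile_mass P) hX).
  have [z z0 hz] := potential_le hy.
  have X0 : 0 <= X + h by have := h0; lra.
  by rewrite ler_pdivlMr//; have := profile_budget P z0 X0; lra.
have cW2 : continuous (fun x => W x ^+ 2).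
  move=> x; apply: (@continuous_comp _ _ _ W (fun x : R => x ^+ 2)).
    exact: fold_continuous.
  exact: exprn_continuous.
have main y : - h <= y -> mu.-integrable `]- h, +oo[ (EFin \o (fun x => W x ^+ 2)) /\
    \int[mu]_(x in `]- h, +oo[) W x ^+ 2 <= (1 - (fold_primitive A y - fold_primitive A (- h))) / a.
  move=> hy; apply: halfline_integrable => // [x|X hX]; first exact: sqr_ge0.
  have [hX'|Xh] := leP h X; first exact: mass_le.
  apply: le_trans (mass_le y h hy (lexx h)).
  apply: le_Rintegral_subset => //; try exact: measurable_itv.
  - by apply: subset_itvl; rewrite bnd_simp ltW.
  - exact: (@continuous_integrable_itv _ _ (- h) h).
  - by move=> x _; exact: sqr_ge0.
have [i1 _] := main (- h) (lexx _).
split => //.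
- exact: fold_continuous.
- by rewrite fold_even.
exists (1 - a * \int[mu]_(x in `]- h, +oo[) W x ^+ 2); last by have := h0; lra.
exists (fold_primitive A) => [|y hy]; first exact: fold_potential.
by have [_] := main y hy; rewrite ler_pdivlMr//; lra.
Qed.

Lemma fold_sextic X : h <= X -> D (X + h) <= sextic (- h) W.
Proof.
move=> hX; rewrite -(fold_integral (profile_sextic0 P) (profile_sextic P) hX).
have i6 := budget_sextic_integrable a0 fold_budget.
have sub : `]- h, X]%classic `<=` `]- h, +oo[%classic.
  by move=> x /=; rewrite !in_itv/= andbT => /andP[].
rewrite -Rintegral_itv_obnd_cbnd; last by apply: (integrableS _ _ _ i6).
apply: le_Rintegral_subset => //; try exact: measurable_itv.
by move=> x _; rewrite (exprM _ 3 2) sqr_ge0.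
Qed.

End Fold.

(** * Existence of a maximizer *)

Section Maximizer.
Context {R : realType}.
Implicit Types (F : R -> R) (x y : R).
Notation mu := (@lebesgue_measure R).
Context (a h : R) (a0 : 0 < a) (h0 : 0 < h).
Local Notation E := `]- h, +oo[%classic.

Let hh : - h < h. Proof. by have := h0; lra. Qed.

Definition sextics := [set sextic (- h) F | F in [set F | budget a (- h) h F 1]].
(** The best constant in the inequality [sextic_le_best]. *)
Definition best := sup sextics.

Lemma budget0 : budget a (- h) h (fun=> 0) 1.
Proof.
have E0 : (fun x : R => (0 : R) ^+ 2) = (fun=> 0) by apply/funext => x; rewrite expr0n.
split => //.
- by move=> x; exact: cvg_cst.
- rewrite E0; have := @integrable0 _ _ R mu E; apply: eq_integrable => //.
exists 0; first exists (fun=> 0) => [x y _ _|y _]; rewrite ?subrr//.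
  by rewrite /energy_le !subrr expr0n mulr0.
by rewrite E0 Rintegral_cst// mul0r mulr0 addr0.
Qed.

Lemma sextics_sup : has_sup sextics.
Proof.
split; first by exists (sextic (- h) (fun=> 0)), (fun=> 0) => //; exact: budget0.
exists ((2 * (1 + a^-1) * 1) ^+ 2 * (1 / a)) => _ [F /= bF <-].
exact: (budget_sextic_le a0 bF).
Qed.

Lemma sextic_scale k F j : budget a (- h) h F j ->
  sextic (- h) (fun x => k * F x) = k ^+ 6 * sextic (- h) F.
Proof.
move=> bF; have i6 := budget_sextic_integrable a0 bF.
by rewrite /sextic -RintegralZl//; apply: eq_Rintegral => x _; rewrite exprMn.
Qed.

(** By homogeneity: F / sqrt j has budget 1. If j = 0 the sextic integral is 0. *)
Lemma sextic_le_best F j : budget a (- h) h F j -> sextic (- h) F <= best * j ^+ 3.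
Proof.
move=> bF; have := budget_ge0 a0 bF; rewrite le_eqVlt => /predU1P[j0|j0].
  have := budget_sextic_le a0 bF; rewrite -j0 mulr0 !expr0n /=.
  by rewrite mul0r mulr0.
pose k := (Num.sqrt j)^-1.
have k0 : 0 < k by rewrite invr_gt0 sqrtr_gt0.
have k2 : k ^+ 2 = j^-1 by rewrite exprVn sqr_sqrtr// ltW.
have bk : budget a (- h) h (fun x => k * F x) 1.
  by have := budget_scale k bF; rewrite k2 mulVf// gt_eqF.
have : sextic (- h) (fun x => k * F x) <= best.
  apply: sup_upper_bound; first exact: sextics_sup.
  by exists (fun x => k * F x).
rewrite (sextic_scale k bF) (exprM k 2 3) k2 exprVn mulrC ler_pdivrMr//.
exact: exprn_gt0.
Qed.

(** All four functions of a profile are indexed together, so that one cluster point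
    serves them all. *)
Lemma exists_maximizer : exists W : R -> R,
  [/\ budget a (- h) h W 1, best <= sextic (- h) W, forall x, 0 <= W x,
      forall x, W (- x) = W x & forall x y, 0 <= x -> x <= y -> W y <= W x].
Proof.
have /choice[F bF] : forall n : nat, exists F, budget a (- h) h F 1 /\
    (forall x, 0 <= F x) /\ best - n.+1%:R^-1 <= sextic (- h) F.
  move=> n; have e0 : 0 < (n.+1%:R^-1 : R) by rewrite invr_gt0.
  have [_ [F /= bF <-] hF] := sup_adherent e0 sextics_sup.
  exists (fun x => `|F x|); split; first exact: budget_abs.
  by split => //; rewrite sextic_abs; exact: ltW.
have hLE : h - - h = 2 * h by rewrite opprK mulr2n mulrDl !mul1r.
have /choice[g Pg] : forall n : nat, exists g : (R -> R) * (R -> R) * (R -> R) * (R -> R),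
    profile a (2 * h) g.1.1.1 g.1.1.2 g.1.2 g.2 /\
    (forall x, 0 <= x -> `|g.1.1.1 x| <= 2 * (1 + a^-1) + 1) /\
    (forall x, 0 < x -> sextic (- h) (F n) - (a * x) ^- 2 / a <= g.2 x).
  move=> n; have [b1 [b2 b3]] := bF n.
  have [f [A [B [D PP]]]] := profile_of_budget a0 hh b1 b2.
  by exists (f, A, B, D); rewrite -hLE.
pose u (n : nat) (i : nat * R) : R := match i with
  | (0, x) => (g n).1.1.1 (Num.max x 0) | (1, x) => (g n).1.1.2 (Num.max x 0)
  | (2, x) => (g n).1.2 (Num.max x 0) | (_, x) => (g n).2 (Num.max x 0) end.
pose K := 2 * (1 + a^-1) + 1.
pose M (i : nat * R) : R := match i with
  | (0, x) => K | (1, x) => 1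
  | (2, x) => a^-1 | (_, x) => K ^+ 6 * Num.max x 0 end.
have uM n i : `|u n i| <= M i.
  have [PP [h1 h2]] := Pg n.
  have mx (x : R) : 0 <= Num.max x 0 by rewrite le_max lexx orbT.
  have bud x := profile_budget PP (mx x) (lexx 0).
  have bud' x := profile_budget PP (lexx 0) (mx x).
  have A0 := profile_energy_ge0 PP (lexx 0).
  have B0 := profile_mass0 PP; have D0 := profile_sextic0 PP.
  case: i => [] [|[|[|k]]] x /=.
  - exact: h1.
  - rewrite ger0_norm; last exact: (profile_energy_ge0 PP).
    by have := bud x; rewrite B0 mulr0 addr0.
  - have /andP[q1 q2] := profile_mass PP (lexx 0) (mx x).
    rewrite ger0_norm; last first.
      move: q1; rewrite B0 !subr0; apply: le_trans.
      by rewrite mulr_ge0// sqr_ge0.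
    rewrite -[a^-1]div1r ler_pdivlMr//; have := bud' x; lra.
  - have /andP[q1 q2] := profile_sextic PP (lexx 0) (mx x).
    rewrite D0 !subr0 in q1 q2.
    rewrite ger0_norm; last first.
      by apply: le_trans q1; rewrite mulr_ge0// (exprM _ 3 2) sqr_ge0.
    apply: (le_trans q2); rewrite ler_wpM2r//.
    have := h1 0 (lexx 0); have := profile_ge0 PP (lexx 0) => f0.
    rewrite ger0_norm// => fK; rewrite lerXn2r ?nnegrE//.
    exact: le_trans fK.
have [G [p [PG sub cG]]] := pointwise_cluster uM.
pose pf k x := p (k, x).
have P : profile a (2 * h) (pf 0) (pf 1) (pf 2) (pf 3).
  apply: (@profile_lim _ a _ G (fun n => (g n).1.1.1) (fun n => (g n).1.1.2)
    (fun n => (g n).1.2) (fun n => (g n).2)) => [n|x x0|x x0|x x0|x x0].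
  - by have [] := Pg n.
  - by have := cG (0%N, x); rewrite /u max_l.
  - by have := cG (1%N, x); rewrite /u max_l.
  - by have := cG (2%N, x); rewrite /u max_l.
  - by have := cG (3%N, x); rewrite /u max_l.
have D_ge x : 0 < x -> best - (a * x) ^- 2 / a <= pf 3 x.
  move=> x0.
  have c1 : (fun n : nat => best - n.+1%:R^-1 - (a * x) ^- 2 / a) @ G --> best - 0 - (a * x) ^- 2 / a.
    apply: cvgB; last exact: cvg_cst.
    apply: cvgB; first exact: cvg_cst.
    by apply: cvg_trans (@cvg_harmonic R); apply: cvg_app; exact: sub.
  have c2 : (fun n : nat => u n (3%N, x)) @ G --> pf 3 x by exact: cG.
  rewrite subr0 in c1.
  apply: (ler_cvg_to c1 c2); apply: filterE => n.
  have [b1 [b2 b3]] := bF n; have [_ [_ h3]] := Pg n.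
  rewrite /u max_l ?(ltW x0)//; apply: le_trans (h3 x x0).
  by rewrite lerD2r.
exists (fold h (pf 0)); split.
- exact: (fold_budget a0 h0 P).
- rewrite leNgt; apply/negP => lt_best.
  pose d := best - sextic (- h) (fold h (pf 0)).
  have d0 : 0 < d by rewrite subr_gt0.
  (* Beyond this X the tail (a X)^-2 / a is smaller than the supposed gap d. *)
  pose X := Num.max (2 * h) (a^-1 * (1 + (a * d)^-1)).
  have X1 : 2 * h <= X by rewrite le_max lexx.
  have X2 : a^-1 * (1 + (a * d)^-1) <= X by rewrite le_max lexx orbT.
  have X0 : 0 < X by apply: lt_le_trans X1; have := h0; lra.
  have ad : 0 < a * d by rewrite mulr_gt0.
  have hX : h <= X - h by have := h0; lra.
  have := fold_sextic a0 h0 P hX; rewrite subrK => h1.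
  have h2 := le_trans (D_ge X X0) h1.
  have h3 : 1 + (a * d)^-1 <= a * X by rewrite -ler_pdivrMl.
  have q1 : 0 < (a * d)^-1 by rewrite invr_gt0.
  have h4 : (a * d)^-1 < (a * X) ^+ 2.
    by rewrite expr2; nra.
  have h5 : (a * X) ^- 2 < a * d.
    rewrite -[ltRHS]invrK ltf_pV2// posrE// exprn_gt0//.
    by rewrite mulr_gt0.
  have h6 : (a * X) ^- 2 / a < d by rewrite ltr_pdivrMr// [d * a]mulrC.
  by move: h2 h6; rewrite /d; lra.
- exact: (fold_ge0 h0 P).
- exact: fold_even.
- exact: (fold_nincr h0 P).
Qed.

(** A tent on the circle has finite energy and a positive sextic integral. *)
Lemma best_gt0 : 0 < best.
Proof.
pose F x := Num.max 0 (h - `|x|).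
have F0 x : 0 <= F x by rewrite /F le_max lexx.
have Fh x : F x <= h by rewrite /F ge_max (ltW h0) gerBl normr_ge0.
have Fout x : h <= `|x| -> F x = 0 by move=> hx; rewrite /F max_l// subr_le0.
have cF : continuous F.
  rewrite /F => x; apply: (@continuous_max _ _ (fun=> 0) (fun x : R => h - `|x|)); first exact: cvg_cst.
  by apply: cvgB; [exact: cvg_cst|exact: norm_continuous].
have Flip x y : `|F y - F x| <= `|y - x|.
  rewrite ler_norml; have := lerB_dist x y; have := lerB_dist y x.
  rewrite [`|y - x|]distrC /F.
  by case: (leP 0 (h - `|x|)) => ?; case: (leP 0 (h - `|y|)) => ? ? ?; apply/andP; split; lra.
pose A x := Num.min x h.
have pA : potential (- h) F A.
  move=> x y hx xy; rewrite /energy_le.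
  have dA : 0 <= A y - A x.
    by rewrite subr_ge0 /A le_min !ge_min xy lexx orbT.
  have dA2 : A y - A x <= y - x.
    by rewrite /A; case: (leP y h) => ?; case: (leP x h) => ?; lra.
  have -> : F x = F (A x).
    by rewrite /A; case: (leP x h) => // hx'; rewrite !Fout// gtr0_norm// ?(ltW hx')// (lt_trans h0).
  have -> : F y = F (A y).
    by rewrite /A; case: (leP y h) => // hx'; rewrite !Fout// gtr0_norm// ?(ltW hx')// (lt_trans h0).
  have k1 := Flip (A x) (A y).
  rewrite -[leLHS]real_normK ?num_real//.
  apply: (@le_trans _ _ ((A y - A x) ^+ 2)).
    by rewrite lerXn2r ?nnegrE// (le_trans k1)// ger0_norm.
  by rewrite expr2 ler_wpM2r.
have eF : energy_bound (- h) F (2 * h).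
  exists A => // y hy; rewrite /A [Num.min (- h) h]min_l; last exact: ltW.
  by have : Num.min y h <= h by [rewrite ge_min lexx orbT]; have := h0; lra.
have muI (p q : R) : (mu `[p, q] < +oo)%E.
  by rewrite lebesgue_measure_itv/=; case: ifP => _; rewrite -?EFinB ltry.
have mI (p q : R) : measurable (`[p, q]%classic : set (measurableTypeR R)).
  exact: measurable_itv.
have iF : mu.-integrable E (EFin \o (fun x => F x ^+ 2)).
  have i1 : mu.-integrable E (EFin \o (fun x => h ^+ 2 * \1_(`[- h, h]) x)).
    by apply: integrable_indic_scale => //; exact: muI.
  apply: integrable_dom i1 _ => //.
    by apply: measurable_funX; apply: measurable_funS (continuous_measurable_fun cF).
  move=> x _; rewrite ger0_norm ?sqr_ge0// indicE.
  have [xh|hx] := leP `|x| h.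
    rewrite mem_set ?mulr1; last by rewrite /= in_itv/= -ler_norml.
    by rewrite lerXn2r ?nnegrE// ltW.
  by rewrite Fout ?(ltW hx)// expr0n mulr_ge0// sqr_ge0.
pose j := 2 * h + a * \int[mu]_(x in E) F x ^+ 2.
have bF : budget a (- h) h F j.
  by split => //; [rewrite !Fout ?normrN// ger0_norm// ltW|exists (2 * h)].
have i6 := budget_sextic_integrable a0 bF.
have sub : `[- (h / 2), h / 2]%classic `<=` E.
  move=> x /=; rewrite !in_itv/= andbT => /andP[h1 _].
  by have := h0; lra.
have mh : fine (mu `[- (h / 2), h / 2]%classic) = h.
  rewrite lebesgue_measure_itv/= lte_fin ifT; last by have := h0; lra.
  by rewrite -EFinB /=; lra.
have : (h / 2) ^+ 6 * h <= sextic (- h) F.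
  have -> : (h / 2) ^+ 6 * h = \int[mu]_(x in E) ((h / 2) ^+ 6 * \1_(`[- (h / 2), h / 2]) x).
    rewrite Rintegral_indic_scale//; [congr (_ * _)|exact: muI].
    exact: (esym mh).
  apply: le_Rintegral => //; first by apply: integrable_indic_scale => //; exact: muI.
  move=> x _; rewrite indicE.
  have [xh|hx] := leP `|x| (h / 2).
    rewrite mem_set ?mulr1; last by rewrite /= in_itv/= -ler_norml.
    have hF : h / 2 <= F x by rewrite le_max; apply/orP; right; lra.
    by rewrite lerXn2r ?nnegrE// divr_ge0// ltW.
  rewrite memNset ?mulr0; first by rewrite (exprM _ 3 2) sqr_ge0.
  by rewrite /= in_itv/= -ler_norml leNgt hx.
move=> h1; have := le_trans h1 (sextic_le_best bF).
have j0 : 0 <= j ^+ 3 by rewrite exprn_ge0// (budget_ge0 a0 bF).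
have h2 : 0 < (h / 2) ^+ 6 * h by rewrite mulr_gt0// exprn_gt0// divr_gt0.
move=> h3; rewrite ltNge; apply/negP => b0.
by have := mulr_le0_ge0 b0 j0; rewrite leNgt (lt_le_trans h2).
Qed.

End Maximizer.

(** * The Euler-Lagrange equation *)

Section Ramp.
Context {R : realType}.
Implicit Types (F : R -> R) (p q x y k : R).
Notation mu := (@lebesgue_measure R).

Definition ramp p q x := Num.min (Num.max x p) q.

Lemma ramp_le p q x : p <= q -> x <= p -> ramp p q x = p.
Proof. by move=> pq xp; rewrite /ramp max_r// min_l. Qed.

Lemma ramp_id p q x : p <= x -> x <= q -> ramp p q x = x.
Proof. by move=> px xq; rewrite /ramp max_l// min_l. Qed.

Lemma ramp_ge p q x : q <= x -> ramp p q x = q.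
Proof. by move=> qx; rewrite /ramp min_r// le_max qx. Qed.

Lemma ramp_continuous p q : continuous (ramp p q).
Proof.
move=> x; apply: (@continuous_min _ _ (fun x : R => Num.max x p) (fun=> q)); last exact: cvg_cst.
by apply: (@continuous_max _ _ (fun x : R => x) (fun=> p)); [exact: cvg_id|exact: cvg_cst].
Qed.

(** Adding k times a ramp changes F' into F' + k on [p, q] only. The energy changes by 2
    k (F q - F p) + k^2 (q - p), and the potential is corrected accordingly. *)
Lemma energy_bound_ramp l F c k p q : l <= p -> p <= q -> energy_bound l F c ->
  energy_bound l (fun x => F x + k * ramp p q x)
    (c + 2 * k * (F q - F p) + k ^+ 2 * (q - p)).
Proof.
move=> lp pq [A pA Ac].
pose A' x := A x + 2 * k * F (ramp p q x) + k ^+ 2 * ramp p q x.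
pose F' x := F x + k * ramp p q x.
have s1 x y : l <= x -> x <= y -> y <= p -> energy_le F' A' x y.
  move=> lx xy yp; rewrite /energy_le /F' /A' !ramp_le// ?(le_trans xy)//.
  by have := pA x y lx xy; rewrite /energy_le; lra.
have s2 x y : p <= x -> x <= y -> y <= q -> energy_le F' A' x y.
  move=> px xy yq; have py := le_trans px xy; have xq := le_trans xy yq.
  rewrite /energy_le /F' /A' !ramp_id//.
  by have := pA x y (le_trans lp px) xy; rewrite /energy_le; lra.
have s3 x y : q <= x -> x <= y -> energy_le F' A' x y.
  move=> qx xy; rewrite /energy_le /F' /A' !ramp_ge// ?(le_trans qx)//.
  by have := pA x y (le_trans lp (le_trans pq qx)) xy; rewrite /energy_le; lra.
have s23 x y : p <= x -> x <= y -> energy_le F' A' x y.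
  move=> px xy; have [yq|qy] := leP y q; first exact: s2.
  have [qx|xq] := leP q x; first exact: s3.
  apply: (@energy_le_trans _ _ _ x q y); rewrite ?(ltW xq) ?(ltW qy)//.
    by apply: s2 => //; exact: ltW.
  by apply: s3 => //; exact: ltW.
have pA' : potential l F' A'.
  move=> x y lx xy; have [yp|py] := leP y p; first exact: s1.
  have [px|xp] := leP p x; first exact: s23.
  apply: (@energy_le_trans _ _ _ x p y); rewrite ?(ltW xp) ?(ltW py)//.
    by apply: s1 => //; exact: ltW.
  by apply: s23 => //; exact: ltW.
have big y : q <= y -> A' y - A' l <= c + 2 * k * (F q - F p) + k ^+ 2 * (q - p).
  move=> qy; rewrite /A' !(ramp_le pq lp) !ramp_ge//.
  by have := Ac y (le_trans lp (le_trans pq qy)); lra.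
exists A' => // y ly; have [qy|yq] := leP q y; first exact: big.
apply: le_trans (big q (lexx q)); rewrite lerD2r.
by apply: (potential_nd pA') => //; exact: ltW.
Qed.

Lemma energy_bound_shift l F c k : energy_bound l F c ->
  energy_bound l (fun x => F x + k) c.
Proof.
move=> [A pA Ac]; exists A => // x y lx xy.
by have := pA x y lx xy; rewrite /energy_le (_ : F y + k - (F x + k) = F y - F x)//; ring.
Qed.

(** Integration by parts on [b, X], where the derivative of the ramp is the indicator
    function of [p, q]. *)
Lemma ramp_integral (H Z1 Z : R -> R) (b X p q : R) : continuous H -> continuous Z1 -> continuous Z ->
  b <= p -> p <= q -> q <= X ->
  (forall x, b < x -> is_derive x 1 Z1 (H x)) ->
  (forall x, b < x -> is_derive x 1 Z (Z1 x)) ->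
  \int[mu]_(x in `[b, X]) (H x * ramp p q x) =
    Z1 X * q - Z1 b * p - (Z q - Z p).
Proof.
move=> cH cZ1 cZ bp pq qX dZ1 dZ.
have cHr : continuous (fun x => H x * ramp p q x).
  by move=> x; apply: cvgM; [exact: cH|exact: ramp_continuous].
have i (u v : R) : mu.-integrable `[u, v] (EFin \o (fun x => H x * ramp p q x)).
  by apply: (@continuous_integrable_itv _ _ u v).
have bX := le_trans bp (le_trans pq qX).
have split (u v w : R) : u <= v -> v <= w ->
    \int[mu]_(x in `[u, w]) (H x * ramp p q x) =
    \int[mu]_(x in `[u, v]) (H x * ramp p q x) + \int[mu]_(x in `[v, w]) (H x * ramp p q x).
  move=> uv vw; have := @Rintegral_itvB R (fun x => H x * ramp p q x) (BLeft u) (BRight w) v (i u w).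
  rewrite !bnd_simp uv vw => /(_ isT isT) e.
  rewrite -(Rintegral_itv_obnd_cbnd (r := v)) -?e; first by rewrite addrC subrK.
  apply: (@continuous_integrable_itv _ _ v w) => //.
  by move=> x /=; rewrite !in_itv/= => /andP[/ltW -> ->].
rewrite (split b p X)// ?(le_trans pq)// (split p q X)//.
have e1 : \int[mu]_(x in `[b, p]) (H x * ramp p q x) = (Z1 p - Z1 b) * p.
  transitivity (\int[mu]_(x in `[b, p]) (H x * p)).
    by apply: eq_Rintegral; move=> x; rewrite inE/= in_itv/= => /andP[_ xp]; rewrite ramp_le.
  have c1 : continuous (fun x => H x * p) by move=> x; apply: cvgM; [exact: cH|exact: cvg_cst].
  have c2 : {within `[b, p], continuous (fun x => Z1 x * p)}.
    by apply: continuous_subspaceT => x; apply: cvgM; [exact: cZ1|exact: cvg_cst].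
  have d x : b < x -> x < p -> is_derive x 1 (fun x => Z1 x * p) (H x * p).
    move=> bx _; have := dZ1 x bx => d1.
    by apply: is_derive_eq; rewrite scaler0 add0r /GRing.scale/= mulrC.
  by rewrite (Rintegral_FTC bp c1 d c2) mulrBl.
have e2 : \int[mu]_(x in `[p, q]) (H x * ramp p q x) = Z1 q * q - Z1 p * p - (Z q - Z p).
  transitivity (\int[mu]_(x in `[p, q]) (H x * x)).
    by apply: eq_Rintegral; move=> x; rewrite inE/= in_itv/= => /andP[px xq]; rewrite ramp_id.
  have c1 : continuous (fun x => H x * x) by move=> x; apply: cvgM; [exact: cH|exact: cvg_id].
  have c2 : {within `[p, q], continuous (fun x => Z1 x * x - Z x)}.
    apply: continuous_subspaceT => x; apply: cvgB; last exact: cZ.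
    by apply: cvgM; [exact: cZ1|exact: cvg_id].
  have d x : p < x -> x < q -> is_derive x 1 (fun x => Z1 x * x - Z x) (H x * x).
    move=> px _; have bx : b < x by exact: le_lt_trans px.
    have := dZ1 x bx => d1; have := dZ x bx => d2.
    by apply: is_derive_eq; rewrite /GRing.scale/=; lra.
  by rewrite (Rintegral_FTC pq c1 d c2); lra.
have e3 : \int[mu]_(x in `[q, X]) (H x * ramp p q x) = (Z1 X - Z1 q) * q.
  transitivity (\int[mu]_(x in `[q, X]) (H x * q)).
    by apply: eq_Rintegral; move=> x; rewrite inE/= in_itv/= => /andP[qx _]; rewrite ramp_ge.
  have c1 : continuous (fun x => H x * q) by move=> x; apply: cvgM; [exact: cH|exact: cvg_cst].
  have c2 : {within `[q, X], continuous (fun x => Z1 x * q)}.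
    by apply: continuous_subspaceT => x; apply: cvgM; [exact: cZ1|exact: cvg_cst].
  have d x : q < x -> x < X -> is_derive x 1 (fun x => Z1 x * q) (H x * q).
    move=> qx _; have := dZ1 x (le_lt_trans (le_trans bp pq) qx) => d1.
    by apply: is_derive_eq; rewrite scaler0 add0r /GRing.scale/= mulrC.
  by rewrite (Rintegral_FTC qX c1 d c2) mulrBl.
by rewrite e1 e2 e3; lra.
Qed.

(** The convex function w |-> w^6 lies above its tangent. *)
Lemma sextic_tangent (w t : R) : w ^+ 6 + 6 * (w ^+ 5 * t) <= (w + t) ^+ 6.
Proof.
pose q := 2 * t ^+ 2 + 6 * w * t + 5 * w ^+ 2.
pose p := 2 * t + 5 * w.
have -> : (w + t) ^+ 6 = w ^+ 6 + 6 * (w ^+ 5 * t) +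
    t ^+ 2 * (4^-1 * (q ^+ 2 + w ^+ 2 * (p ^+ 2 + 10 * w ^+ 2))).
  have e : q ^+ 2 + w ^+ 2 * (p ^+ 2 + 10 * w ^+ 2) =
    4 * (15 * w ^+ 4 + 20 * w ^+ 3 * t + 15 * w ^+ 2 * t ^+ 2 + 6 * w * t ^+ 3 + t ^+ 4).
    by rewrite /q /p; ring.
  by rewrite e mulKf//; ring.
rewrite lerDl mulr_ge0 ?sqr_ge0// mulr_ge0 ?invr_ge0// addr_ge0 ?sqr_ge0//.
by rewrite mulr_ge0 ?sqr_ge0// addr_ge0 ?sqr_ge0// mulr_ge0 ?sqr_ge0.
Qed.

(** Both sides agree at e = 0, so the first-order terms in e agree. *)
Lemma cubic_stationary (M A K b : R) :
  (forall e, M + 6 * e * b <= M * (1 + 2 * e * A + e ^+ 2 * K) ^+ 3) -> b = M * A.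
Proof.
move=> h.
have step (k : R) (g : R -> R) : continuous g -> continuous (fun e : R => k + e * g e).
  move=> cg x; apply: cvgD; first exact: cvg_cst.
  by apply: cvgM; [exact: cvg_id|exact: cg].
(* The difference of the two sides is e (c1 + e Q e) >= 0 for e of both signs, so c1 = 0. *)
pose c1 := 6 * (M * A) - 6 * b.
pose Q (e : R) := M * (3 * K + 12 * A ^+ 2) + e * (M * (12 * A * K + 8 * A ^+ 3) +
  e * (M * (3 * K ^+ 2 + 12 * A ^+ 2 * K) + e * (M * (6 * A * K ^+ 2) + e * (M * K ^+ 3)))).
have cP : continuous (fun e : R => c1 + e * Q e).
  apply: (step); apply: (step); apply: (step); apply: (step) => x; apply: cvgD;
    [exact: cvg_cst|apply: cvgM; [exact: cvg_id|exact: cvg_cst]].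
have PE e : 0 <= e * (c1 + e * Q e).
  have := h e; rewrite -subr_ge0.
  suff -> : M * (1 + 2 * e * A + e ^+ 2 * K) ^+ 3 - (M + 6 * e * b) = e * (c1 + e * Q e) by [].
  by rewrite /Q /c1; ring.
have h1 : 0 <= c1 + 0 * Q 0.
  apply: (@ge0_at_right _ _ 0 1 _ (cP 0)) => // t t0 _.
  by have := PE t; rewrite pmulr_rge0.
have h2 : 0 <= - (c1 + 0 * Q 0).
  have cN : continuous (fun e : R => - (c1 + e * Q e)) by move=> x; apply: cvgN; exact: cP.
  apply: (@ge0_at_left _ _ 0 (-1) _ (cN 0)) => [|t _ t0]; first by lra.
  by have := PE t; rewrite nmulr_rge0// oppr_ge0.
by move: h1 h2; rewrite mul0r addr0 /c1; lra.
Qed.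

End Ramp.

Section EulerLagrange.
Context {R : realType}.
Implicit Types (F : R -> R) (p q x y : R).
Notation mu := (@lebesgue_measure R).
Context (a h : R) (a0 : 0 < a) (h0 : 0 < h) (W : R -> R).
Hypotheses (bW : budget a (- h) h W 1) (maxW : best a h <= sextic (- h) W).
Local Notation E := `]- h, +oo[%classic.
Local Notation k := (best a h).

Let hh : - h < h. Proof. by have := h0; lra. Qed.
Let cW : continuous W. Proof. by case: bW. Qed.

Lemma compact_support_integrable (g : R -> R) X : continuous g -> - h <= X ->
  (forall x, X <= x -> g x = 0) ->
  mu.-integrable E (EFin \o g) /\
  \int[mu]_(x in E) g x = \int[mu]_(x in `[- h, X]) g x.
Proof.
move=> cg hX g0.
have i1 : mu.-integrable `]- h, X] (EFin \o g).
  apply: (@continuous_integrable_itv _ _ (- h) X) => // x /=.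
  by rewrite !in_itv/= => /andP[/ltW -> ->].
have cut : (EFin \o g) \_ E = (EFin \o g) \_ `]- h, X]%classic.
  apply/funext => x; rewrite /patch; case: ifPn => [|xE].
    rewrite inE/= in_itv/= andbT => hx; case: ifPn => //.
    rewrite notin_setE/= in_itv/= hx/= => /negP; rewrite -ltNge => Xx.
    by rewrite g0// ltW.
  rewrite ifF//; apply/negbTE; apply: contra xE.
  by rewrite !inE/= !in_itv/= andbT => /andP[].
split.
  have m1 : measurable (E : set (measurableTypeR R)) by exact: measurable_itv.
  have m2 : measurable (`]- h, X]%classic : set (measurableTypeR R)) by exact: measurable_itv.
  by apply/(integrable_mkcond _ m1); rewrite cut; apply/(integrable_mkcond _ m2).
rewrite -Rintegral_itv_obnd_cbnd// /Rintegral; congr fine.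
by rewrite [LHS]integral_mkcond [RHS]integral_mkcond; congr integral; exact: cut.
Qed.

Let cX n (F : R -> R) : continuous F -> continuous (fun x => F x ^+ n).
Proof.
move=> cF x; apply: (@continuous_comp _ _ _ F (fun x : R => x ^+ n)); first exact: cF.
exact: exprn_continuous.
Qed.

(** Along W + e phi the sextic integral is at least its tangent, and at most best times
    the cube of the budget. Comparing terms of first order in e gives the equation. The
    coefficients L and K of the energy along this line are parameters, since they are
    explicit for piecewise affine phi. *)
Lemma euler_lagrange (phi : R -> R) (L K X : R) : continuous phi -> phi (- h) = phi h ->
  - h <= X -> (forall x, X <= x -> phi x = 0) ->
  (forall c e, energy_bound (- h) W c ->
     energy_bound (- h) (fun x => W x + e * phi x) (c + 2 * e * L + e ^+ 2 * K)) ->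
  \int[mu]_(x in `[- h, X]) ((a * W x - k^-1 * W x ^+ 5) * phi x) = - L.
Proof.
move=> cphi phih hX phi0 eb.
have k0 := best_gt0 a0 h0.
have cM (F G : R -> R) : continuous F -> continuous G -> continuous (fun x => F x * G x).
  by move=> cF cG x; apply: cvgM; [exact: cF|exact: cG].
have [i1 e1] := @compact_support_integrable (fun x => W x * phi x) X (cM _ _ cW cphi) hX
  (fun x Xx => etrans (congr1 _ (phi0 x Xx)) (mulr0 _)).
have [i2 e2] := @compact_support_integrable (fun x => phi x * phi x) X (cM _ _ cphi cphi) hX
  (fun x Xx => etrans (congr1 _ (phi0 x Xx)) (mulr0 _)).
have [i5 e5] := @compact_support_integrable (fun x => W x ^+ 5 * phi x) X (cM _ _ (cX cW) cphi) hX
  (fun x Xx => etrans (congr1 _ (phi0 x Xx)) (mulr0 _)).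
have i6 := budget_sextic_integrable a0 bW.
have [_ Wh iW [c ec hc]] := bW.
set I1 := \int[mu]_(x in E) (W x * phi x) in e1.
set I2 := \int[mu]_(x in E) (phi x * phi x) in e2.
set I5 := \int[mu]_(x in E) (W x ^+ 5 * phi x) in e5.
have main : I5 = k * (L + a * I1).
  apply: (@cubic_stationary _ k (L + a * I1) (K + a * I2)) => e.
  have ie1 : mu.-integrable E (EFin \o (fun x => 2 * e * (W x * phi x))) by exact: integrable_scale.
  have ie2 : mu.-integrable E (EFin \o (fun x => e ^+ 2 * (phi x * phi x))) by exact: integrable_scale.
  have ie12 : mu.-integrable E (EFin \o (fun x => 2 * e * (W x * phi x) + e ^+ 2 * (phi x * phi x))).
    exact: integrable_add.
  have sq : (fun x => (W x + e * phi x) ^+ 2) =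
     (fun x => W x ^+ 2 + (2 * e * (W x * phi x) + e ^+ 2 * (phi x * phi x))).
    by apply/funext => x; ring.
  have bF : budget a (- h) h (fun x => W x + e * phi x)
      (1 + 2 * e * (L + a * I1) + e ^+ 2 * (K + a * I2)).
    split.
    - by move=> x; apply: cvgD; [exact: cW|apply: cvgM; [exact: cvg_cst|exact: cphi]].
    - by rewrite Wh phih.
    - by rewrite sq; exact: integrable_add.
    exists (c + 2 * e * L + e ^+ 2 * K); first exact: eb.
    rewrite sq RintegralD// RintegralD// !RintegralZl// -/I1 -/I2.
    by move: hc; lra.
  apply: (le_trans _ (sextic_le_best a0 bF)).
  have i6' := budget_sextic_integrable a0 bF.
  have ie5 : mu.-integrable E (EFin \o (fun x => 6 * e * (W x ^+ 5 * phi x))) by exact: integrable_scale.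
  apply: (@le_trans _ _ (\int[mu]_(x in E) (W x ^+ 6 + 6 * e * (W x ^+ 5 * phi x)))).
    by rewrite RintegralD// RintegralZl// -/I5 lerD2r.
  apply: le_Rintegral => //; first exact: integrable_add.
  by move=> x _; have := sextic_tangent (W x) (e * phi x); lra.
have j1 : mu.-integrable `[- h, X] (EFin \o (fun x => W x * phi x)).
  by apply: (@continuous_integrable_itv _ _ (- h) X) => //; exact: cM.
have j5 : mu.-integrable `[- h, X] (EFin \o (fun x => W x ^+ 5 * phi x)).
  by apply: (@continuous_integrable_itv _ _ (- h) X) => //; apply: cM => //; exact: cX.
transitivity (\int[mu]_(x in `[- h, X]) (a * (W x * phi x) - k^-1 * (W x ^+ 5 * phi x))).
  by apply: eq_Rintegral => x _; ring.
rewrite RintegralB//; [|exact: integrable_scale|exact: integrable_scale].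
rewrite !RintegralZl// -e1 -e5 main mulKf ?gt_eqF//.
by lra.
Qed.

End EulerLagrange.

(** * Regularity and Kirchhoff's condition *)

(** Both edge solutions and their derivatives extend beyond the ends of their edges,
    which turns the one-sided derivatives at the vertex into ordinary ones. *)
Record smooth_solution {R : realType} (a nu h : R) (W u u1 v v1 : R -> R) : Prop := Smooth {
  smooth_u : forall x, - h - 1 < x -> is_derive x 1 u (u1 x) ;
  smooth_u1 : forall x, - h - 1 < x -> is_derive x 1 u1 (a * W x - nu * W x ^+ 5) ;
  smooth_v : forall x, - h - 1 < x -> is_derive x 1 v (v1 x) ;
  smooth_v1 : forall x, - h - 1 < x -> is_derive x 1 v1 (a * W x - nu * W x ^+ 5) ;
  smooth_circle : forall x, - h <= x -> x <= h -> W x = u x ;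
  smooth_halfline : forall x, h <= x -> W x = v x ;
  smooth_kirchhoff : u1 h - u1 (- h) = v1 h ;
  smooth_cu : continuous u ; smooth_cu1 : continuous u1 ;
  smooth_cv : continuous v ; smooth_cv1 : continuous v1 }.

Section Regularity.
Context {R : realType}.
Implicit Types (F : R -> R) (p q x y : R).
Notation mu := (@lebesgue_measure R).
Context (a h : R) (a0 : 0 < a) (h0 : 0 < h) (W : R -> R).
Hypotheses (bW : budget a (- h) h W 1) (maxW : best a h <= sextic (- h) W).

Definition nls_force x := a * W x - (best a h)^-1 * W x ^+ 5.
Local Notation H := nls_force.

Lemma nls_force_continuous : continuous H.
Proof.
have cW : continuous W by case: bW.
move=> x; apply: cvgB; (apply: cvgM; first exact: cvg_cst); first exact: cW.
apply: (@continuous_comp _ _ _ W (fun x : R => x ^+ 5)); first exact: cW.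
exact: exprn_continuous.
Qed.

Section Primitive.
Context (Z1 Z : R -> R).
Hypotheses (cZ1 : continuous Z1) (cZ : continuous Z).
Hypothesis dZ1 : forall x, - h - 1 < x -> is_derive x 1 Z1 (H x).
Hypothesis dZ : forall x, - h - 1 < x -> is_derive x 1 Z (Z1 x).
Local Notation Y := (fun x => W x - Z x).

(** The Euler-Lagrange equation for a piecewise affine phi vanishing beyond q3,
    integrated by parts twice: only the values of Y = W - Z at the break points remain. *)
Lemma three_ramps p1 q1 p2 q2 p3 q3 k0 k1 k2 k3 :
  - h <= p1 -> p1 <= q1 -> q1 <= p2 -> p2 <= q2 -> q2 <= p3 -> p3 <= q3 ->
  let phi x := k0 + (k1 * ramp p1 q1 x + k2 * ramp p2 q2 x + k3 * ramp p3 q3 x) in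
  phi h = phi (- h) -> k0 + (k1 * q1 + k2 * q2 + k3 * q3) = 0 ->
  k1 * (Y q1 - Y p1) + k2 * (Y q2 - Y p2) + k3 * (Y q3 - Y p3) = Z1 (- h) * phi (- h).
Proof.
move=> hp1 pq1 qp1 pq2 qp2 pq3 phi phih phiX.
have hp2 : - h <= p2 by rewrite (le_trans hp1)// (le_trans pq1).
have hp3 : - h <= p3 by rewrite (le_trans hp2)// (le_trans pq2).
have q1X : q1 <= q3 by rewrite (le_trans qp1)// (le_trans pq2)// (le_trans qp2).
have q2X : q2 <= q3 by rewrite (le_trans qp2).
have hX : - h <= q3 by rewrite (le_trans hp3).
pose L := k1 * (W q1 - W p1) + k2 * (W q2 - W p2) + k3 * (W q3 - W p3).
pose K := k1 ^+ 2 * (q1 - p1) + k2 ^+ 2 * (q2 - p2) + k3 ^+ 2 * (q3 - p3).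
have cphi : continuous phi.
  move=> x; apply: cvgD; first exact: cvg_cst.
  by do 2?apply: cvgD; (apply: cvgM; [exact: cvg_cst|exact: ramp_continuous]).
have phi0 x : q3 <= x -> phi x = 0.
  move=> qx; rewrite /phi !ramp_ge// ?(le_trans q1X)// ?(le_trans q2X)//.
have EL := @euler_lagrange _ a h a0 h0 W bW maxW phi L K q3 cphi (esym phih) hX phi0.
have {}EL : \int[mu]_(x in `[- h, q3]) (H x * phi x) = - L.
  apply: EL => c e ec.
  have e1 := energy_bound_ramp (e * k1) hp1 pq1 ec.
  have e2 := energy_bound_ramp (e * k2) hp2 pq2 e1.
  have e3 := energy_bound_ramp (e * k3) hp3 pq3 e2.
  have q1q2 : q1 <= q2 by rewrite (le_trans qp1).
  have q1p3 : q1 <= p3 by rewrite (le_trans q1q2).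
  have := energy_bound_shift (e * k0) e3.
  rewrite (ramp_ge p1 qp1) (ramp_ge p1 q1q2) (ramp_ge p1 q1p3) (ramp_ge p1 q1X).
  rewrite (ramp_ge p2 qp2) (ramp_ge p2 q2X).
  by congr energy_bound; [apply/funext => x|]; rewrite /phi /L /K; ring.
have cH := nls_force_continuous.
have bl (x : R) : - h < x -> - h - 1 < x by lra.
have ri p q : - h <= p -> p <= q -> q <= q3 ->
    \int[mu]_(x in `[- h, q3]) (H x * ramp p q x) = Z1 q3 * q - Z1 (- h) * p - (Z q - Z p).
  move=> hp pq qq; apply: ramp_integral => // x hx; [exact/dZ1/bl|exact/dZ/bl].
have H1 : \int[mu]_(x in `[- h, q3]) H x = Z1 q3 - Z1 (- h).
  have d x : - h < x -> x < q3 -> is_derive x 1 Z1 (H x) by move=> hx _; exact/dZ1/bl.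
  by rewrite (Rintegral_FTC hX cH d)//; exact: continuous_subspaceT.
have ii (g : R -> R) : continuous g -> mu.-integrable `[- h, q3] (EFin \o g).
  by move=> cg; apply: (@continuous_integrable_itv _ _ (- h) q3).
have cHr p q : continuous (fun x => H x * ramp p q x).
  by move=> x; apply: cvgM; [exact: cH|exact: ramp_continuous].
have ir k p q : mu.-integrable `[- h, q3] (EFin \o (fun x => k * (H x * ramp p q x))).
  by apply: integrable_scale => //; exact: ii.
have iH : mu.-integrable `[- h, q3] (EFin \o (fun x => k0 * H x)).
  by apply: integrable_scale => //; exact: ii.
have := EL; have -> : \int[mu]_(x in `[- h, q3]) (H x * phi x) =
  \int[mu]_(x in `[- h, q3]) (k0 * H x + (k1 * (H x * ramp p1 q1 x) +
    (k2 * (H x * ramp p2 q2 x) + k3 * (H x * ramp p3 q3 x)))).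
  by apply: eq_Rintegral => x _; rewrite /phi; ring.
rewrite RintegralD//; last by do 2?apply: integrable_add.
rewrite RintegralD//; last by apply: integrable_add.
rewrite RintegralD// !RintegralZl//; try exact: ii.
rewrite H1 !ri//.
have phiE : phi (- h) = k0 + (k1 * p1 + k2 * p2 + k3 * p3).
  by rewrite /phi !ramp_le.
rewrite phiE /L => e.
have k0E : k0 = - (k1 * q1 + k2 * q2 + k3 * q3) by lra.
move: e; rewrite k0E; lra.
Qed.

(** With a hat function over [p, q] with top at c. The hat must stay within one edge:
    this is the alternative in the hypothesis. *)
Lemma hat_identity p c q : - h <= p -> p < c -> c < q -> q <= h \/ h <= p ->
  (Y c - Y p) / (c - p) = (Y q - Y c) / (q - c).
Proof.
move=> hp pc cq hor.
have cp0 : 0 < c - p by rewrite subr_gt0.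
have qc0 : 0 < q - c by rewrite subr_gt0.
have pq := lt_trans pc cq.
set u := (c - p)^-1; set v := (q - c)^-1.
have u1 : u * (c - p) = 1 by rewrite mulVf// gt_eqF.
have v1 : v * (q - c) = 1 by rewrite mulVf// gt_eqF.
(* The constant term makes the combination of ramps vanish beyond q. *)
have := @three_ramps p c c q q q (v * q - u * c) u (- v) 0 hp (ltW pc) (lexx _) (ltW cq) (lexx _) (lexx _).
have phil : v * q - u * c + (u * ramp p c (- h) + - v * ramp c q (- h) + 0 * ramp q q (- h)) = 0.
  rewrite !ramp_le// ?(ltW pc) ?(ltW cq) ?(le_trans hp) ?(ltW pc) ?(ltW pq)//; lra.
rewrite /= phil => /(_ _)/wrap[|].
  case: hor => [qh|hp'].
    rewrite !ramp_ge// ?(le_trans (ltW cq))//; lra.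
  rewrite !ramp_le// ?(ltW pc) ?(ltW cq) ?(le_trans hp') ?(ltW pc) ?(ltW pq)//; lra.
move=> /(_ _)/wrap[|]; first by lra.
lra.
Qed.

(** With the function that is 1 at the vertex and falls to 0 at the middle of the
    circle, on both sides, and at distance h on the half-line. *)
Lemma vertex_identity :
  - (Y 0 - Y (- h)) / h + (Y h - Y 0) / h - (Y (2 * h) - Y h) / h = Z1 (- h).
Proof.
have hh : 0 < h := h0.
have v1 : h^-1 * h = 1 by rewrite mulVf// gt_eqF.
have g1 : - h <= 0 by lra.
have g2 : 0 <= h by lra.
have g3 : h <= 2 * h by lra.
have := @three_ramps (- h) 0 0 h h (2 * h) 1 (- h^-1) h^-1 (- h^-1)
  (lexx _) g1 (lexx _) g2 (lexx _) g3.
rewrite /= (@ramp_ge _ (- h) 0 h)// (@ramp_ge _ 0 h h)// (@ramp_le _ h (2 * h) h)//.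
rewrite (@ramp_le _ (- h) 0 (- h))// (@ramp_le _ 0 h (- h))//.
rewrite (@ramp_le _ h (2 * h) (- h)); [|lra|lra].
move=> /(_ _)/wrap[|]; first by lra.
move=> /(_ _)/wrap[|]; first by lra.
have -> : 1 + (- h^-1 * - h + h^-1 * 0 + - h^-1 * h) = 1 by lra.
by rewrite mulr1 => <-; ring.
Qed.

End Primitive.

Let affine3 (Y : R -> R) (p c q : R) : p < c -> c < q ->
  (Y c - Y p) / (c - p) = (Y q - Y c) / (q - c) ->
  (Y c - Y p) * (q - p) = (Y q - Y p) * (c - p).
Proof.
move=> pc cq; have c0 : c - p != 0 by rewrite subr_eq0 gt_eqF.
have q0 : q - c != 0 by rewrite subr_eq0 gt_eqF.
by move=> /eqP; rewrite (eqr_div _ _ c0 q0) => /eqP; lra.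
Qed.

(** Y = W - Z has equal slopes over adjacent intervals, so it is affine on each edge,
    and W is Z plus an affine function; the vertex identity compares the slopes. *)
Lemma maximizer_smooth : exists u u1 v v1, smooth_solution a (best a h)^-1 h W u u1 v v1.
Proof.
have hh : 0 < h := h0.
have [Z1 cZ1 dZ1] := antiderivative (- h - 1) nls_force_continuous.
have [Z cZ dZ] := antiderivative (- h - 1) cZ1.
have hat := hat_identity cZ1 cZ dZ1 dZ.
have vertex := vertex_identity cZ1 cZ dZ1 dZ.
pose Y x := W x - Z x.
pose al := (Y h - Y (- h)) / (2 * h).
pose be := (Y (2 * h) - Y h) / h.
have alE : al * (2 * h) = Y h - Y (- h) by rewrite divfK// gt_eqF// mulr_gt0.
have beE : be * h = Y (2 * h) - Y h by rewrite divfK// gt_eqF.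
have circle x : - h <= x -> x <= h -> Y x = Y (- h) + al * (x + h).
  rewrite le_eqVlt => /predU1P[<- _|hx]; first by lra.
  rewrite le_eqVlt => /predU1P[->|xh]; first by lra.
  have e := @affine3 Y _ _ _ hx xh (hat _ _ _ (lexx _) hx xh (or_introl (lexx _))).
  by apply: (mulIf (_ : 2 * h != 0)); [rewrite gt_eqF// mulr_gt0|]; have k : al * (x + h) * (2 * h) = (Y h - Y (- h)) * (x + h) by [rewrite -alE; ring]; rewrite /=; lra.
have halfline x : h <= x -> Y x = Y h + be * (x - h).
  have h2 : h < 2 * h by lra.
  have hm : - h <= h by lra.
  rewrite le_eqVlt => /predU1P[<-|hx]; first by lra.
  have [x2|x2|->] := ltgtP x (2 * h); last by lra.
    have e := @affine3 Y _ _ _ hx x2 (hat _ _ _ hm hx x2 (or_intror (lexx _))).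
    by apply: (mulIf (_ : h != 0)); [rewrite gt_eqF|]; have k : be * (x - h) * h = (Y (2 * h) - Y h) * (x - h) by [rewrite -beE; ring]; rewrite /=; lra.
  have e := @affine3 Y _ _ _ h2 x2 (hat _ _ _ hm h2 x2 (or_intror (lexx _))).
  by apply: (mulIf (_ : h != 0)); [rewrite gt_eqF|]; have k : be * (x - h) * h = (Y (2 * h) - Y h) * (x - h) by [rewrite -beE; ring]; rewrite /=; lra.
exists (fun x => Z x + (Y (- h) + al * (x + h))), (fun x => Z1 x + al),
  (fun x => Z x + (Y h + be * (x - h))), (fun x => Z1 x + be).
split.
- move=> x hx; have := dZ x hx => d; apply: is_derive_eq.
  by rewrite /GRing.scale/=; lra.
- move=> x hx; have := dZ1 x hx => d; apply: is_derive_eq.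
  by rewrite addr0.
- move=> x hx; have := dZ x hx => d; apply: is_derive_eq.
  by rewrite /GRing.scale/=; lra.
- move=> x hx; have := dZ1 x hx => d; apply: is_derive_eq.
  by rewrite addr0.
- by move=> x hx xh; rewrite -circle// /Y; lra.
- by move=> x hx; rewrite -halfline// /Y; lra.
- have c0 : Y 0 = Y (- h) + al * (0 + h) by apply: circle; lra.
  have : - (Y 0 - Y (- h)) / h + (Y h - Y 0) / h = 0.
    have -> : - (Y 0 - Y (- h)) / h + (Y h - Y 0) / h = (Y h - Y (- h) - 2 * (Y 0 - Y (- h))) / h by ring.
    by rewrite c0 -alE (_ : _ - _ = 0) ?mul0r//; ring.
  by have := vertex; rewrite -/be; rewrite /be /Y; lra.
- move=> x; apply: cvgD; first exact: cZ.
  apply: cvgD; first exact: cvg_cst.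
  by apply: cvgM; [exact: cvg_cst|apply: cvgD; [exact: cvg_id|exact: cvg_cst]].
- by move=> x; apply: cvgD; [exact: cZ1|exact: cvg_cst].
- move=> x; apply: cvgD; first exact: cZ.
  apply: cvgD; first exact: cvg_cst.
  by apply: cvgM; [exact: cvg_cst|apply: cvgB; [exact: cvg_id|exact: cvg_cst]].
- by move=> x; apply: cvgD; [exact: cZ1|exact: cvg_cst].
Qed.

End Regularity.

Section Gronwall.
Context {R : realType}.
Implicit Types (f g : R -> R) (p q x y K : R).

(** Gronwall: f^2 + f1^2 has a logarithmic derivative of size at most 1 + K. *)
Lemma second_order_unique f (f1 : R -> R) g K p q (x0 : R) : 0 <= K ->
  (forall x, p <= x -> x <= q -> is_derive x 1 f (f1 x)) ->
  (forall x, p <= x -> x <= q -> is_derive x 1 f1 (g x)) ->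
  (forall x, p <= x -> x <= q -> `|g x| <= K * `|f x|) ->
  p <= x0 -> x0 <= q -> f x0 = 0 -> f1 x0 = 0 ->
  forall x, p <= x -> x <= q -> f x = 0 /\ f1 x = 0.
Proof.
move=> K0 df df1 gK px0 x0q fx0 f1x0.
pose m := 1 + K.
pose e s x := (f x ^+ 2 + f1 x ^+ 2) * expR (s * x).
have de s x : p <= x -> x <= q -> is_derive x 1 (e s)
    ((2 * f x * f1 x + 2 * f1 x * g x + s * (f x ^+ 2 + f1 x ^+ 2)) * expR (s * x)).
  move=> px xq; have := df x px xq => d1; have := df1 x px xq => d2.
  by rewrite /e; apply: is_derive_eq; rewrite /GRing.scale/=; ring.
have bnd x : p <= x -> x <= q ->
    `|2 * f x * f1 x + 2 * f1 x * g x| <= m * (f x ^+ 2 + f1 x ^+ 2).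
  move=> px xq.
  have -> : 2 * f x * f1 x + 2 * f1 x * g x = 2 * f1 x * (f x + g x) by ring.
  rewrite normrM normrM (ger0_norm (_ : 0 <= 2 :> R))//.
  have h1 : `|f x + g x| <= m * `|f x|.
    by apply: le_trans (ler_normD _ _) _; rewrite mulrDl mul1r lerD2l; exact: gK.
  have := ler_wpM2l (mulr_ge0 (ler0n R 2) (normr_ge0 (f1 x))) h1; move/le_trans; apply.
  rewrite -(real_normK (num_real (f x))) -(real_normK (num_real (f1 x))).
  have := sqr_ge0 (`|f x| - `|f1 x|).
  have m0 : 0 <= m by rewrite addr_ge0.
  move=> /(mulr_ge0 m0); lra.
have ex0 s : e s x0 = 0 by rewrite /e fx0 f1x0 !expr0n addr0 mul0r.
have zero s x : e s x <= 0 -> f x = 0 /\ f1 x = 0.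
  rewrite /e pmulr_lle0 ?expR_gt0// => h.
  have h1 := sqr_ge0 (f x); have h2 := sqr_ge0 (f1 x).
  by split; apply/eqP; rewrite -sqrf_eq0 eq_le; apply/andP; split; lra.
have ce s u w : p <= u -> w <= q -> {within `[u, w], continuous (e s)}.
  move=> pu wq; apply: derivable_within_continuous => x; rewrite in_itv/= => /andP[ux xw].
  by have [] := de s x (le_trans pu ux) (le_trans xw wq).
move=> x px xq; have [xx0|x0x] := leP x x0.
  apply: (zero m); rewrite -(ex0 m).
  apply: (@ger0_derive1_ndecr R (e m) x x0) => //.
  - move=> t; rewrite in_itv/= => /andP[xt tx].
    by have [] := de m t (le_trans px (ltW xt)) (le_trans (ltW tx) x0q).
  - move=> t; rewrite in_itv/= => /andP[xt tx].
    have pt := le_trans px (ltW xt); have tq := le_trans (ltW tx) x0q.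
    have [_] := de m t pt tq; rewrite derive1E => ->.
    rewrite mulr_ge0 ?expR_ge0//.
    by have := bnd t pt tq; rewrite ler_norml => /andP[]; lra.
  - exact: ce.
apply: (zero (- m)); rewrite -(ex0 (- m)).
apply: (@ler0_derive1_nincr R (e (- m)) x0 x) => //.
- move=> t; rewrite in_itv/= => /andP[xt tx].
  by have [] := de (- m) t (le_trans px0 (ltW xt)) (le_trans (ltW tx) xq).
- move=> t; rewrite in_itv/= => /andP[xt tx].
  have pt := le_trans px0 (ltW xt); have tq := le_trans (ltW tx) xq.
  have [_] := de (- m) t pt tq; rewrite derive1E => ->.
  rewrite mulr_le0_ge0 ?expR_ge0//.
  by have := bnd t pt tq; rewrite ler_norml => /andP[]; lra.
- exact: ce.
- exact: ltW.
Qed.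

End Gronwall.

(** * Strict monotonicity and positivity *)

Section Monotonicity.
Context {R : realType}.
Implicit Types (x y : R).
Notation mu := (@lebesgue_measure R).
Context (a nu h : R) (a0 : 0 < a) (nu0 : 0 < nu) (h0 : 0 < h).
Context (W u u1 v v1 : R -> R).
Hypotheses (sm : smooth_solution a nu h W u u1 v v1).
Hypotheses (W0 : forall x, 0 <= W x) (evenW : forall x, W (- x) = W x)
  (nincrW : forall x y, 0 <= x -> x <= y -> W y <= W x).

Definition quintic w := a * w - nu * w ^+ 5.

Let quintic_lip w c : 0 <= w -> w <= W 0 -> 0 <= c -> c <= W 0 ->
  `|quintic w - quintic c| <= (a + 5 * nu * W 0 ^+ 4) * `|w - c|.
Proof.
move=> w0 wM c0 cM.
have -> : quintic w - quintic c = (a - nu * (w ^+ 4 + w ^+ 3 * c + w ^+ 2 * c ^+ 2 + w * c ^+ 3 + c ^+ 4)) * (w - c).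
  by rewrite /quintic; ring.
rewrite normrM ler_wpM2r//; apply: le_trans (ler_normB _ _) _.
rewrite (gtr0_norm a0) lerD2l normrM (gtr0_norm nu0).
rewrite (_ : 5 * nu * W 0 ^+ 4 = nu * (5 * W 0 ^+ 4)); last by ring.
apply: ler_wpM2l; first exact: ltW.
have pw (i j : nat) : w ^+ i * c ^+ j <= W 0 ^+ (i + j).
  by rewrite exprD ler_pM ?exprn_ge0// lerXn2r ?nnegrE.
have pp (i j : nat) : 0 <= w ^+ i * c ^+ j by rewrite mulr_ge0// exprn_ge0.
have := pw 4%N 0%N; have := pw 3%N 1%N; have := pw 2%N 2%N; have := pw 1%N 3%N; have := pw 0%N 4%N.
have := pp 4%N 0%N; have := pp 3%N 1%N; have := pp 2%N 2%N; have := pp 1%N 3%N; have := pp 0%N 4%N.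
rewrite !expr1 !expr0 !mul1r !mulr1 /= => ? ? ? ? ? ? ? ? ? ?.
rewrite ger0_norm; lra.
Qed.

(** A solution that is constant on an interval takes there a zero of the force, and that
    constant is the solution with the same Cauchy data. *)
Let constant_edge (f f1 : R -> R) p q x y c : - h <= p -> 0 <= x -> p <= x -> x < y -> y <= q ->
  (forall t, - h - 1 < t -> is_derive t 1 f (f1 t)) ->
  (forall t, - h - 1 < t -> is_derive t 1 f1 (quintic (W t))) ->
  (forall t, p <= t -> t <= q -> W t = f t) ->
  (forall t, x <= t -> t <= y -> W t = c) ->
  quintic c = 0 /\ forall t, p <= t -> t <= q -> W t = c /\ f1 t = 0.
Proof.
move=> hp x0 px xy yq df df1 Wf Wc.
have bl t : p <= t -> - h - 1 < t by move=> pt; lra.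
have near_c t : x < t -> t < y -> \forall s \near t, f s = c.
  move=> xt ty; near=> s.
  have xs : x < s by near: s; exact: lt_nbhsr.
  have sy : s < y by near: s; exact: lt_nbhsl.
  by rewrite -Wf ?Wc ?(ltW xs) ?(ltW sy)// (le_trans px (ltW xs), le_trans (ltW sy) yq).
have f10 t : x < t -> t < y -> f1 t = 0.
  move=> xt ty; have pt := le_trans px (ltW xt).
  have [_ <-] := df t (bl _ pt).
  have [_ e] : is_derive t 1 f 0.
    apply: (near_eq_is_derive _ (is_derive_cst c t 1)).
    by near=> s; rewrite (near (near_c t xt ty) s).
  exact: e.
pose m := (x + y) / 2.
have xm : x < m by rewrite /m; lra.
have my : m < y by rewrite /m; lra.
have pm := le_trans px (ltW xm); have mq := le_trans (ltW my) yq.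
have Wm : W m = c by apply: Wc; exact: ltW.
have Fc : quintic c = 0.
  have [_ e1] := df1 m (bl _ pm); rewrite -Wm -e1.
  have [_ e] : is_derive m 1 f1 0.
    apply: (near_eq_is_derive _ (is_derive_cst (0 : R) m 1)).
    near=> s; apply/esym/f10; near: s; [exact: lt_nbhsr|exact: lt_nbhsl].
  exact: e.
split=> // t pt tq.
have WM z : W z <= W 0.
  have [z0|z0] := leP 0 z; first exact: nincrW.
  by rewrite -evenW nincrW// oppr_ge0 ltW.
have K0 : 0 <= a + 5 * nu * W 0 ^+ 4.
  by rewrite addr_ge0 ?(ltW a0)// mulr_ge0 ?exprn_ge0// mulr_ge0// ltW.
have d1 z : p <= z -> z <= q -> is_derive z 1 (fun s => f s - c) (f1 z).
  move=> pz zq; have := df z (bl _ pz) => d; apply: is_derive_eq.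
  by rewrite subr0.
have d2 z : p <= z -> z <= q -> is_derive z 1 f1 (quintic (W z)).
  by move=> pz zq; exact: df1 (bl _ pz).
have d3 z : p <= z -> z <= q -> `|quintic (W z)| <= (a + 5 * nu * W 0 ^+ 4) * `|f z - c|.
  move=> pz zq; rewrite -Wf// (_ : quintic (W z) = quintic (W z) - quintic c); last by rewrite Fc subr0.
  by apply: quintic_lip; rewrite -?Wm.
have e0 : f m - c = 0 by rewrite -Wf// Wm subrr.
have [/eqP + e2] := second_order_unique K0 d1 d2 d3 pm mq e0 (f10 m xm my) pt tq.
by rewrite subr_eq0 => /eqP e1; rewrite Wf.
Unshelve. all: by end_near. Qed.

(** W is even, hence so is its restriction to the circle; continuity extends the oddness
    of the derivative to the end points. *)
Let u1_odd : u1 (- h) = - u1 h.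
Proof.
have hh := h0.
have bl t : - h <= t -> - h - 1 < t by move=> ht; lra.
have odd t : - h < t -> t < h -> u1 t + u1 (- t) = 0.
  move=> ht th.
  have d1 := smooth_u sm (bl _ (ltW ht)).
  have ht' : - h <= - t by lra.
  have d2 := smooth_u sm (bl _ ht').
  have d2' : is_derive t 1 (fun s => u (- s)) (- u1 (- t)).
    by apply: is_derive_eq; rewrite /GRing.scale/=; lra.
  have [_ e1] : is_derive t 1 u (- u1 (- t)).
    apply: (near_eq_is_derive _ d2').
    near=> s.
    have hs : - h < s by near: s; exact: lt_nbhsr.
    have sh : s < h by near: s; exact: lt_nbhsl.
    rewrite -!(smooth_circle sm) ?evenW//; lra.
  by have [_ e2] := d1; rewrite -e2 e1; lra.
have c1 : u1 t @[t --> h] --> u1 h.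
  by apply: is_derive_continuous (smooth_u1 sm (bl _ _)); lra.
have c2 : u1 (- t) @[t --> h] --> u1 (- h).
  apply: (@continuous_comp _ _ _ (fun t : R => - t) u1 h); first exact: opp_continuous.
  by apply: is_derive_continuous (smooth_u1 sm (bl _ (lexx _))).
have g1 : 0 <= u1 h + u1 (- h).
  apply: (@ge0_at_left _ (fun t => u1 t + u1 (- t)) h (- h)); [lra|exact: cvgD|].
  by move=> t ht th; rewrite odd.
have g2 : 0 <= - (u1 h + u1 (- h)).
  apply: (@ge0_at_left _ (fun t => - (u1 t + u1 (- t))) h (- h)); [lra|by apply: cvgN; exact: cvgD|].
  by move=> t ht th; rewrite odd// oppr0.
lra.
Unshelve. all: by end_near. Qed.

(** From the edge where W is flat, the vanishing derivatives pass through the vertex to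
    the other edge: Kirchhoff's condition gives v1 h = 0 from the circle, and on the
    circle the symmetry splits u1 h - u1 (-h) = 0 into two zeros. *)
Let constant_everywhere x y : 0 <= x -> x < y -> W x = W y ->
  forall t, - h <= t -> W t = W x.
Proof.
move=> x0 xy e; have hh := h0.
have flat t : x <= t -> t <= y -> W t = W x.
  move=> xt ty; apply/eqP; rewrite eq_le nincrW// e nincrW//; exact: le_trans xt.
have hm : - h <= h by lra.
have WM z : W z <= W 0.
  have [z0|z0] := leP 0 z; first exact: nincrW.
  by rewrite -evenW nincrW// oppr_ge0 ltW.
have K0 : 0 <= a + 5 * nu * W 0 ^+ 4.
  by rewrite addr_ge0 ?(ltW a0)// mulr_ge0 ?exprn_ge0// mulr_ge0// ltW.
(* Uniqueness, started from the Cauchy data at the vertex, carries the constant to the whole edge. *)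
have edge (f f1 : R -> R) p q : - h <= p ->
    (forall t, - h - 1 < t -> is_derive t 1 f (f1 t)) ->
    (forall t, - h - 1 < t -> is_derive t 1 f1 (quintic (W t))) ->
    (forall t, p <= t -> t <= q -> W t = f t) -> p <= h -> h <= q ->
    quintic (W x) = 0 -> W h = W x -> f1 h = 0 ->
    forall t, p <= t -> t <= q -> W t = W x.
  move=> hp df df1 Wf ph hq Fc Wh f1h t pt tq.
  have bl z : p <= z -> - h - 1 < z by move=> pz; lra.
  have d1 z : p <= z -> z <= q -> is_derive z 1 (fun s => f s - W x) (f1 z).
    move=> pz zq; have := df z (bl _ pz) => d; apply: is_derive_eq.
    by rewrite subr0.
  have d2 z : p <= z -> z <= q -> is_derive z 1 f1 (quintic (W z)).
    by move=> pz zq; exact: df1 (bl _ pz).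
  have d3 z : p <= z -> z <= q -> `|quintic (W z)| <= (a + 5 * nu * W 0 ^+ 4) * `|f z - W x|.
    move=> pz zq; rewrite -Wf// (_ : quintic (W z) = quintic (W z) - quintic (W x)); last by rewrite Fc subr0.
    exact: quintic_lip.
  have e0 : f h - W x = 0 by rewrite -Wf// Wh subrr.
  have [/eqP + _] := second_order_unique K0 d1 d2 d3 ph hq e0 f1h pt tq.
  by rewrite subr_eq0 => /eqP e1; rewrite Wf.
have du t (ht : - h - 1 < t) := smooth_u sm ht.
have du1 t (ht : - h - 1 < t) := smooth_u1 sm ht.
have dv t (ht : - h - 1 < t) := smooth_v sm ht.
have dv1 t (ht : - h - 1 < t) := smooth_v1 sm ht.
have Wu t (p1 : - h <= t) (p2 : t <= h) := smooth_circle sm p1 p2.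
have Wv X t (p1 : h <= t) (_ : t <= X) := smooth_halfline sm p1.
have kir := smooth_kirchhoff sm.
have [xh|hx] := ltP x h.
  have xy' : x < Num.min y h by rewrite lt_min xy.
  have yh' : Num.min y h <= h by rewrite ge_min lexx orbT.
  have flat' t : x <= t -> t <= Num.min y h -> W t = W x.
    by move=> xt; rewrite le_min => /andP[ty _]; exact: flat.
  have hx : - h <= x by lra.
  have [Fc cst] := constant_edge (lexx (- h)) x0 hx xy' yh' du du1 Wu flat'.
  have [Wh uh] := cst h hm (lexx h); have [_ uh'] := cst (- h) (lexx _) hm.
  have vh : v1 h = 0 by rewrite -kir uh uh' subrr.
  move=> t ht; have [th|th] := leP t h; first by have [] := cst t ht th.
  exact: (edge v v1 h t hm dv dv1 (Wv t) (lexx h) (ltW th) Fc Wh vh t (ltW th) (lexx t)).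
move=> t ht.
pose X := Num.max y t.
have yX : y <= X by rewrite le_max lexx.
have tX : t <= X by rewrite le_max lexx orbT.
have hX : h <= X by rewrite (le_trans hx)// (le_trans (ltW xy)).
have [Fc cst] := constant_edge hm x0 hx xy yX dv dv1 (Wv X) flat.
have [th|th] := leP h t; first by have [] := cst t th tX.
have [Wh vh] := cst h (lexx h) hX.
have uh : u1 h = 0 by move: kir; rewrite u1_odd vh; lra.
exact: (edge u u1 (- h) h (lexx _) du du1 Wu hm (lexx h) Fc Wh uh t ht (ltW th)).
Qed.

Hypothesis (iW : mu.-integrable `]- h, +oo[ (EFin \o (fun x => W x ^+ 2))).
Hypothesis (Wneq0 : exists2 x, - h <= x & W x != 0).

(** Otherwise W would be a nonzero constant, of infinite mass. *)
Lemma smooth_decreasing x y : 0 <= x -> x < y -> W y < W x.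
Proof.
move=> x0 xy; have hh := h0; rewrite lt_neqAle nincrW ?(ltW xy)// andbT.
apply/negP => /eqP e.
have cst := constant_everywhere x0 xy (esym e).
have [z hz] := Wneq0; rewrite (cst z hz) => c0.
have c2 : 0 < W x ^+ 2 by rewrite exprn_even_gt0.
set I := \int[mu]_(x in `]- h, +oo[) W x ^+ 2.
pose X := (I + 1) / W x ^+ 2.
have I0 : 0 <= I by apply: Rintegral_ge0 => t _; exact: sqr_ge0.
have X0 : 0 < X by rewrite divr_gt0// ltr_wpDl.
have sub : `]0, X[%classic `<=` `]- h, +oo[%classic.
  by move=> t /=; rewrite !in_itv/= andbT => /andP[t0 _]; lra.
have := @le_Rintegral_subset _ _ _ mu `]- h, +oo[%classic (measurable_itv _)
  `]0, X[%classic (fun x => W x ^+ 2) (measurable_itv _) sub iW (fun t _ => sqr_ge0 _).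
have -> : \int[mu]_(t in `]0, X[) W t ^+ 2 = \int[mu]_(t in `]0, X[) (W x ^+ 2).
  apply: eq_Rintegral => t; rewrite inE/= in_itv/= => /andP[t0 _].
  by rewrite cst//; lra.
rewrite Rintegral_cst//.
have -> : fine (mu `]0, X[%classic) = X.
  by rewrite lebesgue_measure_itv/= lte_fin X0 -EFinB subr0.
by rewrite /X mulrC divfK ?gt_eqF// -/I; lra.
Qed.

Lemma smooth_gt0 x : 0 < W x.
Proof.
have pos y : 0 <= y -> 0 < W y.
  by move=> y0; apply: le_lt_trans (W0 (y + 1)) _; apply: smooth_decreasing => //; rewrite ltrDl.
have [x0|x0] := leP 0 x; first exact: pos.
by rewrite -evenW pos// oppr_ge0 ltW.
Qed.

End Monotonicity.

(** * Test functions of class C^1 *)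

Section Cutoff.
Context {R : realType}.
Implicit Types (p q x y d : R).
Notation mu := (@lebesgue_measure R).

Definition pos_part_sqr x := Num.max 0 x ^+ 2.

Lemma pos_part_continuous : continuous (fun x : R => Num.max 0 x).
Proof. by move=> x; apply: (@continuous_max _ _ (fun=> 0) (fun x : R => x)); [exact: cvg_cst|exact: cvg_id]. Qed.

Lemma is_derive_pos_part_sqr x : is_derive x 1 pos_part_sqr (2 * Num.max 0 x).
Proof.
apply: (@is_derive_near _ (fun x => 2 * Num.max 0 x) _ _ 1) => //.
  by apply: cvgM; [exact: cvg_cst|exact: pos_part_continuous].
move=> y _ k1 k2.
have : Num.min x y <= Num.max x y by rewrite le_max ge_min lexx.
move: (Num.min x y) (Num.max x y) => u v uv h.
have := h u (lexx u) uv; have := h v uv (lexx v).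
rewrite /pos_part_sqr; have [v0|v0] := leP 0 v; have [u0|u0] := leP 0 u => /andP[v1 v2] /andP[u1 u2].
- by apply/andP; split; nra.
- by apply/andP; split; nra.
- by lra.
- by apply/andP; split; nra.
Qed.

(** The quadratic spline with second derivative d^-2 on [0, d] and -d^-2 on [d, 2 d]: a
    C^1 step from 0 to 1. *)
Definition smooth_step d x := (2 * d ^+ 2)^-1 *
  (pos_part_sqr x - 2 * pos_part_sqr (x - d) + pos_part_sqr (x - 2 * d)).

Definition smooth_step' d x := d ^- 2 *
  (Num.max 0 x - 2 * Num.max 0 (x - d) + Num.max 0 (x - 2 * d)).

Lemma is_derive_smooth_step d c x : d != 0 ->
  is_derive x 1 (fun x => smooth_step d (x - c)) (smooth_step' d (x - c)).
Proof.
move=> d0.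
have H k : is_derive x 1 (fun x => pos_part_sqr (x - k)) (2 * Num.max 0 (x - k)).
  have h1 := is_derive_pos_part_sqr (x - k).
  have h2 : is_derive x 1 (fun x : R => x - k) 1 by apply: is_derive_eq; rewrite subr0.
  by have := @is_derive1_comp _ pos_part_sqr (fun x : R => x - k) _ _ _ h1 h2; rewrite mulr1.
have h1 := H c; have h2 := H (c + d); have h3 := H (c + 2 * d).
have -> : (fun x => smooth_step d (x - c)) = (fun x => (2 * d ^+ 2)^-1 *
  (pos_part_sqr (x - c) - 2 * pos_part_sqr (x - (c + d)) + pos_part_sqr (x - (c + 2 * d)))).
  by apply/funext => t; rewrite /smooth_step !opprD !addrA.
apply: is_derive_eq; rewrite /smooth_step' /GRing.scale/= !opprD !addrA invfM.
by field.
Qed.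

Lemma smooth_step'_continuous d c : continuous (fun x => smooth_step' d (x - c)).
Proof.
have h k : continuous (fun x : R => Num.max 0 (x - k)).
  move=> x; apply: (@continuous_max _ _ (fun=> 0) (fun x : R => x - k)); first exact: cvg_cst.
  by apply: cvgB; [exact: cvg_id|exact: cvg_cst].
have -> : (fun x => smooth_step' d (x - c)) =
    (fun x => d ^- 2 * (Num.max 0 (x - c) - 2 * Num.max 0 (x - (c + d)) + Num.max 0 (x - (c + 2 * d)))).
  by apply/funext => t; rewrite /smooth_step' !opprD !addrA.
move=> x.
apply: cvgM; first exact: cvg_cst.
apply: cvgD; last exact: h.
by apply: cvgB; [exact: h|apply: cvgM; [exact: cvg_cst|exact: h]].
Qed.

Lemma smooth_step_le0 d x : 0 < d -> x <= 0 -> smooth_step d x = 0.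
Proof.
move=> d0 x0; rewrite /smooth_step /pos_part_sqr !max_l; [|lra|lra|lra].
by rewrite expr0n; ring.
Qed.

Lemma smooth_step_ge1 d x : 0 < d -> 2 * d <= x -> smooth_step d x = 1.
Proof.
move=> d0 x0; rewrite /smooth_step /pos_part_sqr !max_r; [|lra|lra|lra].
have d1 : d != 0 by rewrite gt_eqF.
by field.
Qed.

Lemma smooth_step'_out d x : 0 < d -> x <= 0 \/ 2 * d <= x -> smooth_step' d x = 0.
Proof.
move=> d0 [x0|x0]; rewrite /smooth_step'.
  by rewrite !max_l; [ring|lra|lra|lra].
by rewrite !max_r; [ring|lra|lra|lra].
Qed.

Lemma smooth_step'_ge0 d x : 0 < d -> 0 <= smooth_step' d x.
Proof.
move=> d0; rewrite /smooth_step' mulr_ge0 ?invr_ge0 ?sqr_ge0//.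
by case: (leP 0 x) => ?; case: (leP 0 (x - d)) => ?; case: (leP 0 (x - 2 * d)) => ?; lra.
Qed.

Lemma smooth_step_itv d x : 0 < d -> 0 <= smooth_step d x <= 1.
Proof.
move=> d0; have d1 : 0 < 2 * d ^+ 2 by rewrite mulr_gt0// exprn_gt0.
rewrite /smooth_step mulrC; apply/andP; split.
  rewrite divr_ge0 ?(ltW d1)// /pos_part_sqr.
  by case: (leP 0 x) => ?; case: (leP 0 (x - d)) => ?; case: (leP 0 (x - 2 * d)) => ?; nra.
rewrite ler_pdivrMr// mul1r /pos_part_sqr.
by case: (leP 0 x) => ?; case: (leP 0 (x - d)) => ?; case: (leP 0 (x - 2 * d)) => ?; nra.
Qed.

(** A C^1 plateau, rising on [p, p + 2 d] and falling on [q - 2 d, q]. *)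
Definition bump d p q x := smooth_step d (x - p) - smooth_step d (x - (q - 2 * d)).

Definition bump' d p q x := smooth_step' d (x - p) - smooth_step' d (x - (q - 2 * d)).

Context (d p q : R) (d0 : 0 < d) (pq : p + 4 * d <= q).

Lemma is_derive_bump x : is_derive x 1 (bump d p q) (bump' d p q x).
Proof.
have dn : d != 0 by rewrite gt_eqF.
have h1 := is_derive_smooth_step p x dn; have h2 := is_derive_smooth_step (q - 2 * d) x dn.
exact: is_deriveB.
Qed.

Lemma bump'_continuous : continuous (bump' d p q).
Proof. by move=> x; apply: cvgB; exact: smooth_step'_continuous. Qed.

Lemma bump_out x : x <= p \/ q <= x -> bump d p q x = 0.
Proof.
have d00 := d0; have pq' := pq; move=> [xp|qx]; rewrite /bump.
  by rewrite !smooth_step_le0 ?subrr//; lra.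
by rewrite !smooth_step_ge1 ?subrr//; lra.
Qed.

Lemma bump'_out x : x <= p \/ q <= x -> bump' d p q x = 0.
Proof.
have d00 := d0; have pq' := pq; move=> [xp|qx]; rewrite /bump'.
  by rewrite !smooth_step'_out ?subrr//; left; lra.
by rewrite !smooth_step'_out ?subrr//; right; lra.
Qed.

Lemma bump_in x : p + 2 * d <= x -> x <= q - 2 * d -> bump d p q x = 1.
Proof.
move=> px xq; rewrite /bump smooth_step_ge1 ?smooth_step_le0 ?subr0//.
  by lra.
by rewrite lerBrDl.
Qed.

Lemma bump_itv x : 0 <= bump d p q x <= 1.
Proof.
have d00 := d0; have pq' := pq; rewrite /bump.
have /andP[a1 a2] := smooth_step_itv (x - p) d0.
have /andP[b1 b2] := smooth_step_itv (x - (q - 2 * d)) d0.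
have [h|h] := leP (p + 2 * d) x.
  by rewrite smooth_step_ge1//; [apply/andP; split; lra|lra].
by rewrite [X in _ - X]smooth_step_le0//; [apply/andP; split; lra|lra].
Qed.

Lemma bump_C1c (D : set R) : `[p, q]%classic `<=` D -> C1c D (bump d p q).
Proof.
move=> sub.
have supp : closure [set x | bump d p q x != 0] `<=` `[p, q]%classic.
  have cl : closed (`[p, q]%classic : set R) by exact: interval_closed.
  rewrite closureE; apply: smallest_sub => // x /=; rewrite in_itv/=.
  apply: contraNT; rewrite negb_and -!ltNge => /orP[xp|qx]; apply/eqP/bump_out; [left|right]; exact: ltW.
split.
- by move=> x; have [] := is_derive_bump x.
- have -> : derive1 (bump d p q) = bump' d p q; last exact: bump'_continuous.
  by apply/funext => x; rewrite derive1E; have [] := is_derive_bump x.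
- apply: (subclosed_compact _ (@segment_compact _ p q)) => //.
  exact: closed_closure.
- exact: subset_trans sub.
Qed.

End Cutoff.

(** * Weak derivatives control increments *)

Section WeakDerivative.
Context {R : realType}.
Implicit Types (p q x y d l : R) (D : set R) (f g : R -> R).
Notation mu := (@lebesgue_measure R).

Definition weak_test D f g := forall phi, C1c D phi ->
  \int[mu]_(x in D) (f x * derive1 phi x) = - \int[mu]_(x in D) (g x * phi x).

Lemma Rintegral_support (D I : set (measurableTypeR R)) (f : R -> R) : I `<=` D ->
  (forall x, D x -> ~ I x -> f x = 0) ->
  \int[mu]_(x in D) f x = \int[mu]_(x in I) f x.
Proof.
move=> ID f0; rewrite Rintegral_mkcond [RHS]Rintegral_mkcond; congr Rintegral.
apply/funext => x; rewrite /patch.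
case: ifPn => [/set_mem Dx|/negP xD].
  by case: ifPn => // /negP xI; rewrite f0// => Ix; apply: xI; exact/mem_set.
by case: ifPn => // /set_mem /ID Dx; case: xD; exact/mem_set.
Qed.

Lemma derive1_bump d p q : 0 < d -> derive1 (bump d p q) = bump' d p q.
Proof.
move=> d0; apply/funext => x; rewrite derive1E.
by have [] := is_derive_bump p q d0 x.
Qed.

Lemma bump_continuous d p q : 0 < d -> continuous (bump d p q).
Proof. by move=> d0 x; exact: is_derive_continuous (is_derive_bump p q d0 x). Qed.

Let itv_integrable (f : R -> R) p q : continuous f -> mu.-integrable `[p, q] (EFin \o f).
Proof. by move=> cf; apply: (@continuous_integrable_itv _ _ p q). Qed.

Lemma itv_length p q : p <= q -> fine (mu `[p, q]%classic) = q - p.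
Proof.
rewrite le_eqVlt => /predU1P[->|pq]; first by rewrite set_itv1 lebesgue_measure_set1 subrr.
by rewrite lebesgue_measure_itv/= lte_fin pq -EFinB.
Qed.

Lemma smooth_step'_integral d c p q : 0 < d -> p <= c -> c + 2 * d <= q ->
  \int[mu]_(x in `[p, q]) smooth_step' d (x - c) = 1.
Proof.
move=> d0 pc cq; have dn : d != 0 by rewrite gt_eqF.
have pq : p <= q by lra.
have D x : p < x -> x < q -> is_derive x 1 (fun x => smooth_step d (x - c)) (smooth_step' d (x - c)).
  by move=> _ _; exact: is_derive_smooth_step.
rewrite (Rintegral_FTC pq (@smooth_step'_continuous _ d c) D).
  by rewrite smooth_step_ge1 ?smooth_step_le0 ?subr0//; lra.
apply: continuous_subspaceT => x.
exact: is_derive_continuous (is_derive_smooth_step c x dn).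
Qed.

(** Testing against the derivative of a plateau function sees the increment of f between
    the end points, up to its oscillation near them. *)
Lemma bump'_integral d p q f eta : 0 < d -> p + 4 * d <= q -> continuous f -> 0 <= eta ->
  (forall x, p <= x -> x <= p + 2 * d -> `|f x - f p| <= eta) ->
  (forall x, q - 2 * d <= x -> x <= q -> `|f x - f q| <= eta) ->
  `|\int[mu]_(x in `[p, q]) (f x * bump' d p q x) - (f p - f q)| <= 2 * eta.
Proof.
move=> d0 pq cf eta0 fp fq.
have cs c : continuous (fun x => smooth_step' d (x - c)) := @smooth_step'_continuous _ d c.
have i0 c : mu.-integrable `[p, q] (EFin \o (fun x => smooth_step' d (x - c))).
  exact: itv_integrable (cs c).
have i1 k : mu.-integrable `[p, q] (EFin \o (fun x => k * smooth_step' d (x - p))).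
  by apply: itv_integrable => x; apply: cvgM; [exact: cvg_cst|exact: cs].
have i2 k : mu.-integrable `[p, q] (EFin \o (fun x => k * smooth_step' d (x - (q - 2 * d)))).
  by apply: itv_integrable => x; apply: cvgM; [exact: cvg_cst|exact: cs].
have i3 : mu.-integrable `[p, q] (EFin \o (fun x => f x * bump' d p q x)).
  by apply: itv_integrable => x; apply: cvgM; [exact: cf|exact: bump'_continuous].
have val k1 k2 : \int[mu]_(x in `[p, q]) (k1 * smooth_step' d (x - p)
    - k2 * smooth_step' d (x - (q - 2 * d))) = k1 - k2.
  have one c k : p <= c -> c + 2 * d <= q -> \int[mu]_(x in `[p, q]) (k * smooth_step' d (x - c)) = k.
    by move=> pc cq; rewrite RintegralZl// smooth_step'_integral// mulr1.
  by rewrite RintegralB// !one//; lra.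
have key x : p <= x -> x <= q ->
    (f p - eta) * smooth_step' d (x - p) - (f q + eta) * smooth_step' d (x - (q - 2 * d))
     <= f x * bump' d p q x
     <= (f p + eta) * smooth_step' d (x - p) - (f q - eta) * smooth_step' d (x - (q - 2 * d)).
  move=> px xq; rewrite /bump'.
  have s1 := smooth_step'_ge0 (x - p) d0; have s2 := smooth_step'_ge0 (x - (q - 2 * d)) d0.
  have t1 : `|f x - f p| * smooth_step' d (x - p) <= eta * smooth_step' d (x - p).
    have [h|h] := leP x (p + 2 * d); first by rewrite ler_wpM2r// fp.
    by rewrite smooth_step'_out ?mulr0//; right; lra.
  have t2 : `|f x - f q| * smooth_step' d (x - (q - 2 * d)) <= eta * smooth_step' d (x - (q - 2 * d)).
    have [h|h] := leP (q - 2 * d) x; first by rewrite ler_wpM2r// fq.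
    by rewrite smooth_step'_out ?mulr0//; left; lra.
  have u1 := ler_wpM2r s1 (ler_norm (f x - f p)).
  have u2 := ler_wpM2r s1 (ler_norm (- (f x - f p))).
  have u3 := ler_wpM2r s2 (ler_norm (f x - f q)).
  have u4 := ler_wpM2r s2 (ler_norm (- (f x - f q))).
  rewrite normrN in u2; rewrite normrN in u4.
  by apply/andP; split; lra.
have lo : f p - eta - (f q + eta) <= \int[mu]_(x in `[p, q]) (f x * bump' d p q x).
  rewrite -val; apply: le_Rintegral => //; first by apply: integrable_sub => //.
  by move=> x; rewrite /= in_itv/= => /andP[px xq]; have /andP[] := key x px xq.
have hi : \int[mu]_(x in `[p, q]) (f x * bump' d p q x) <= f p + eta - (f q - eta).
  rewrite -val; apply: le_Rintegral => //; first by apply: integrable_sub => //.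
  by move=> x; rewrite /= in_itv/= => /andP[px xq]; have /andP[] := key x px xq.
by rewrite ler_norml; apply/andP; split; lra.
Qed.

(** As the flanks of the plateau get steep, the left-hand side of the weak equation
    tends to the increment of f; on the other side the plateau is at most 1, and the
    inequality of Cauchy and Schwarz applies. *)
Lemma weak_increment D f g p q : p < q -> `[p, q]%classic `<=` D -> continuous f ->
  measurable (D : set (measurableTypeR R)) ->
  measurable_fun (D : set (measurableTypeR R)) g ->
  mu.-integrable D (EFin \o (fun x => g x ^+ 2)) -> weak_test D f g ->
  (f q - f p) ^+ 2 <= (q - p) * \int[mu]_(x in `[p, q]) g x ^+ 2.
Proof.
move=> pq sub cf mD mg ig2 wt.
set G := \int[mu]_(x in `[p, q]) g x ^+ 2.
have qp0 : 0 < q - p by rewrite subr_gt0.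
(* With the mean slope k, the inequality 2 k g <= g^2 + k^2 replaces that of Cauchy and Schwarz. *)
pose k := (f q - f p) / (q - p).
have kE : k * (q - p) = f q - f p by rewrite divfK// gt_eqF.
suff main eta : 0 < eta -> (f q - f p) ^+ 2 / (q - p) <= G + 4 * `|k| * eta.
  rewrite mulrC -ler_pdivrMr//; apply/ler_addgt0Pr => e e0.
  have k1 : 0 < 4 * `|k| + 1 by rewrite ltr_wpDl// mulr_ge0.
  have := main (e / (4 * `|k| + 1)); rewrite divr_gt0// => /(_ isT) /le_trans; apply.
  rewrite lerD2l mulrA ler_pdivrMr// [e * _]mulrC ler_wpM2r ?ltW//.
  by rewrite ltrDl.
move=> eta0.
have /cvgrPdist_le/(_ _ eta0)/nbhs_ballP[e1 /= e10 h1] := cf p.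
have /cvgrPdist_le/(_ _ eta0)/nbhs_ballP[e2 /= e20 h2] := cf q.
pose d := Num.min (Num.min e1 e2) (q - p) / 4.
have m0 : 0 < Num.min (Num.min e1 e2) (q - p) by rewrite !lt_min e10 e20 qp0.
have d0 : 0 < d by rewrite divr_gt0.
have d1 : 4 * d <= e1 by rewrite mulrC divfK// !ge_min lexx.
have d2 : 4 * d <= e2 by rewrite mulrC divfK// !ge_min lexx !orbT.
have d3 : 4 * d <= q - p by rewrite mulrC divfK// !ge_min lexx !orbT.
have pdq : p + 4 * d <= q by lra.
have fp x : p <= x -> x <= p + 2 * d -> `|f x - f p| <= eta.
  move=> px xp; rewrite distrC; apply: h1 => /=.
  by rewrite /ball/= distrC ger0_norm ?subr_ge0//; lra.
have fq x : q - 2 * d <= x -> x <= q -> `|f x - f q| <= eta.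
  move=> qx xq; rewrite distrC; apply: h2 => /=.
  by rewrite /ball/= ger0_norm ?subr_ge0//; lra.
have := bump'_integral d0 pdq cf (ltW eta0) fp fq.
have bC : C1c D (bump d p q) by exact: bump_C1c.
have mI : measurable (`[p, q]%classic : set (measurableTypeR R)) by exact: measurable_itv.
have out x : ~ (`[p, q]%classic x) -> x <= p \/ q <= x.
  by rewrite /= in_itv/= => /negP; rewrite negb_and -!ltNge => /orP[xp|qx]; [left|right]; exact: ltW.
have := wt _ bC; rewrite derive1_bump//.
rewrite (@Rintegral_support D `[p, q]%classic (fun x => f x * bump' d p q x))//; last first.
  by move=> x _ /out xI; rewrite bump'_out ?mulr0.
rewrite (@Rintegral_support D `[p, q]%classic (fun x => g x * bump d p q x))//; last first.
  by move=> x _ /out xI; rewrite bump_out ?mulr0.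
move=> ->; set I := \int[mu]_(x in `[p, q]) (g x * bump d p q x).
have iI2 : mu.-integrable `[p, q] (EFin \o (fun x => g x ^+ 2)) by apply: (integrableS _ _ _ ig2).
have ic c : mu.-integrable `[p, q] (EFin \o (fun=> c)) by apply: itv_integrable; exact: cst_continuous.
have iI : mu.-integrable `[p, q] (EFin \o (fun x => g x * bump d p q x)).
  have i2 : mu.-integrable `[p, q] (EFin \o (fun x => g x ^+ 2 + 1)) by exact: integrable_add.
  apply: integrable_dom i2 _ => //.
    apply: measurable_funM; first exact: measurable_funS mg.
    by apply: measurable_funS (continuous_measurable_fun (bump_continuous d0)).
  move=> x _; have /andP[b0 b1] := bump_itv d0 pdq x.
  rewrite normrM (ger0_norm b0); apply: (@le_trans _ _ `|g x|).
    by rewrite -[leRHS]mulr1 ler_wpM2l.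
  have := sqr_ge0 (`|g x| - 1); have := real_normK (num_real (g x)); have := normr_ge0 (g x); nra.
have young : 2 * k * I <= G + k ^+ 2 * (q - p).
  have -> : k ^+ 2 * (q - p) = \int[mu]_(x in `[p, q]) (k ^+ 2).
    by rewrite Rintegral_cst//; congr (_ * _); exact: (esym (itv_length (ltW pq))).
  rewrite /G /I -RintegralD// -RintegralZl//; apply: le_Rintegral => //.
  - exact: integrable_scale.
  - exact: integrable_add.
  move=> x _ /=; have /andP[b0 b1] := bump_itv d0 pdq x.
  have := sqr_ge0 (g x - k * bump d p q x).
  have : bump d p q x ^+ 2 <= 1 by rewrite expr_le1.
  have := sqr_ge0 k; nra.
rewrite ler_norml => /andP[a1 a2].
have -> : (f q - f p) ^+ 2 / (q - p) = k ^+ 2 * (q - p).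
  by rewrite -kE; field; rewrite gt_eqF.
have b1 : 2 * k * (k * (q - p)) <= 2 * k * I + 4 * `|k| * eta.
  have : `|k * (k * (q - p) - I)| <= `|k| * (2 * eta).
    by rewrite normrM ler_wpM2l// kE ler_norml; apply/andP; split; lra.
  by move/(le_trans (ler_norm _)); lra.
by move: young b1; lra.
Qed.

End WeakDerivative.

(** * Weak derivatives and classical derivatives *)

Section Uniqueness.
Context {R : realType}.
Implicit Types (p q x y d l : R) (f g : R -> R).
Notation mu := (@lebesgue_measure R).
Implicit Type D : set (measurableTypeR R).

Lemma sqr_integrable_fin (K : set (measurableTypeR R)) g : measurable K -> (mu K < +oo)%E ->
  measurable_fun K g -> mu.-integrable K (EFin \o (fun x => g x ^+ 2)) ->
  mu.-integrable K (EFin \o g).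
Proof.
move=> mK fK mg ig.
have i1 : mu.-integrable K (EFin \o (fun x => 1 * (\1_K x : R))) by exact: integrable_indic_scale.
have i2 : mu.-integrable K (EFin \o (fun x => g x ^+ 2 + 1 * (\1_K x : R))) by exact: integrable_add.
apply: integrable_dom i2 _ => // x Kx; rewrite indicE mem_set// mulr1.
have := sqr_ge0 (`|g x| - 1); have := real_normK (num_real (g x)); have := normr_ge0 (g x); nra.
Qed.

Let oc_length l q : l <= q -> fine (mu `]l, q]%classic) = q - l.
Proof.
rewrite le_eqVlt => /predU1P[->|lq].
  by rewrite set_itv_ge ?bnd_simp ?ltxx// measure0 subrr.
by rewrite lebesgue_measure_itv/= lte_fin lq -EFinB.
Qed.

(** A plateau function nearly 1 on ]l, q] loses little of the integral of g. The loss is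
    bounded by Young's inequality with a large weight K, and widths of order K^-2. *)
Lemma weak_zero_integral l D g q : (forall x, D x -> l < x) ->
  (forall x, D x -> `]l, x]%classic `<=` D) -> measurable D -> measurable_fun D g ->
  mu.-integrable D (EFin \o (fun x => g x ^+ 2)) ->
  (forall phi, C1c D phi -> \int[mu]_(x in D) (g x * phi x) = 0) ->
  D q -> \int[mu]_(x in `]l, q]) g x = 0.
Proof.
move=> Dl Dsub mD mg ig2 wt Dq; have lq := Dl q Dq.
have sub := Dsub q Dq.
have mI : measurable (`]l, q]%classic : set (measurableTypeR R)) by exact: measurable_itv.
have fI : (mu `]l, q]%classic < +oo)%E.
  by rewrite lebesgue_measure_itv/= lte_fin lq -EFinB ltry.
have mgI : measurable_fun (`]l, q]%classic : set (measurableTypeR R)) g by exact: measurable_funS mg.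
have i2 : mu.-integrable `]l, q] (EFin \o (fun x => g x ^+ 2)) by apply: (integrableS _ _ _ ig2).
have i1 := sqr_integrable_fin mI fI mgI i2.
set G := \int[mu]_(x in `]l, q]) g x ^+ 2.
set I := \int[mu]_(x in `]l, q]) g x.
suff main K : 0 < K -> 2 * K * `|I| <= G + 5.
  apply/eqP; rewrite -normr_eq0 eq_le normr_ge0 andbT leNgt; apply/negP => I0.
  have G0 : 0 <= G by apply: Rintegral_ge0 => x _; exact: sqr_ge0.
  have := main ((G + 6) / `|I|); rewrite divr_gt0 ?ltr_wpDl// => /(_ isT).
  by rewrite -mulrA divfK ?gt_eqF//; lra.
move=> K0.
(* The plateau differs from 1 on a length of at most 5 d, so that the weight K^2 costs at most 5. *)
pose d := Num.min ((q - l) / 5) (K ^- 2).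
have d0 : 0 < d by rewrite lt_min divr_gt0 ?subr_gt0//= invr_gt0 exprn_gt0.
have d1 : 5 * d <= q - l.
  have : d <= (q - l) / 5 by rewrite ge_min lexx.
  lra.
have d2 : K ^+ 2 * d <= 1.
  have : d <= K ^- 2 by rewrite ge_min lexx orbT.
  by move=> h; rewrite mulrC -ler_pdivlMr ?exprn_gt0// div1r.
have pdq : l + d + 4 * d <= q by lra.
pose b := bump d (l + d) q.
have bC : C1c D b.
  apply: bump_C1c => // x /=; rewrite in_itv/= => /andP[h1 h2].
  by apply: sub => /=; rewrite in_itv/= h2 andbT; lra.
have b01 x : 0 <= b x <= 1 by exact: bump_itv.
have bI : \int[mu]_(x in `]l, q]) (g x * b x) = 0.
  rewrite -(wt _ bC); apply/esym/Rintegral_support => // x Dx xI.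
  rewrite /b bump_out ?mulr0//; right; rewrite leNgt; apply/negP => xq; apply: xI.
  by rewrite /= in_itv/= Dl// ltW.
have cb : continuous b by exact: bump_continuous.
have ib : mu.-integrable `]l, q] (EFin \o b).
  by apply: (@continuous_integrable_itv _ _ l q) => // x /=; rewrite !in_itv/= => /andP[/ltW -> ->].
have ic k : mu.-integrable `]l, q] (EFin \o (fun=> k)).
  apply: (@continuous_integrable_itv _ _ l q); first exact: cst_continuous.
  by move=> x /=; rewrite !in_itv/= => /andP[/ltW -> ->].
have igb : mu.-integrable `]l, q] (EFin \o (fun x => g x * b x)).
  have i3 : mu.-integrable `]l, q] (EFin \o (fun x => `|g x|)) by exact: integrable_norm.
  apply: integrable_dom i3 _ => //.
    by apply: measurable_funM => //; apply: measurable_funS (continuous_measurable_fun cb).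
  move=> x _; have /andP[b0 b1] := b01 x.
  by rewrite normrM (ger0_norm b0) -[leRHS]mulr1 ler_wpM2l.
have i1b : mu.-integrable `]l, q] (EFin \o (fun x => 1 - b x)) by exact: integrable_sub.
have small : \int[mu]_(x in `]l, q]) (1 - b x) <= 5 * d.
  rewrite RintegralB// Rintegral_cst// mul1r oc_length ?(ltW lq)//.
  suff : q - l - 5 * d <= \int[mu]_(x in `]l, q]) b x by lra.
  have sub2 : `[l + d + 2 * d, q - 2 * d]%classic `<=` `]l, q]%classic.
    by move=> x /=; rewrite !in_itv/= => /andP[h1 h2]; apply/andP; split; lra.
  apply: le_trans (le_Rintegral_subset mI _ sub2 ib _); last 2 first.
  - exact: measurable_itv.
  - by move=> x _; have /andP[] := b01 x.
  have -> : \int[mu]_(x in `[l + d + 2 * d, q - 2 * d]) b x = \int[mu]_(x in `[l + d + 2 * d, q - 2 * d]) 1.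
    by apply: eq_Rintegral => x; rewrite inE/= in_itv/= => /andP[h1 h2]; rewrite /b bump_in.
  rewrite Rintegral_cst// mul1r itv_length; lra.
have IE : I = \int[mu]_(x in `]l, q]) (g x - g x * b x) by rewrite RintegralB// bI subr0.
have iK : mu.-integrable `]l, q] (EFin \o (fun x => K ^+ 2 * (1 - b x))) by exact: integrable_scale.
have iabs : mu.-integrable `]l, q] (EFin \o (fun x => g x - g x * b x)) by exact: integrable_sub.
have i5 : mu.-integrable `]l, q] (EFin \o (fun x => `|g x - g x * b x|)) by exact: integrable_norm.
have : 2 * K * `|I| <= G + K ^+ 2 * \int[mu]_(x in `]l, q]) (1 - b x).
  apply: (@le_trans _ _ (2 * K * \int[mu]_(x in `]l, q]) `|g x - g x * b x|)).
    by apply: ler_wpM2l; [lra|rewrite IE; exact: le_normr_Rintegral].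
  rewrite -!RintegralZl// -RintegralD//; apply: le_Rintegral => //.
  - exact: integrable_scale.
  - exact: integrable_add.
  move=> x _ /=; have /andP[b0 b1] := b01 x.
  have -> : `|g x - g x * b x| = `|g x| * (1 - b x).
    by rewrite -[X in X - _]mulr1 -mulrBr normrM (ger0_norm (_ : 0 <= 1 - b x)) ?subr_ge0.
  rewrite -[g x ^+ 2]real_normK ?num_real//.
  have h1 := sqr_ge0 (`|g x| - K * (1 - b x)).
  have h2 : (K * (1 - b x)) ^+ 2 <= K ^+ 2 * (1 - b x).
    rewrite exprMn ler_wpM2l ?sqr_ge0// expr2 -[leRHS]mul1r ler_wpM2r ?subr_ge0//.
    by rewrite gerBl.
  lra.
have h3 := ler_wpM2l (sqr_ge0 K) small.
move=> /le_trans; apply; rewrite lerD2l (le_trans h3)// mulrCA -[leRHS]mulr1.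
by rewrite ler_wpM2l.
Qed.

(** All integrals of g from l on vanish, so g vanishes by Lebesgue's differentiation
    theorem. *)
Lemma weak_zero_ae l D g : open (D : set R) -> (forall x, D x -> l < x) ->
  (forall x, D x -> `]l, x]%classic `<=` D) -> measurable D -> measurable_fun D g ->
  mu.-integrable D (EFin \o (fun x => g x ^+ 2)) ->
  (forall phi, C1c D phi -> \int[mu]_(x in D) (g x * phi x) = 0) ->
  {ae mu, forall x, D x -> g x = 0}.
Proof.
move=> oD Dl Dsub mD mg ig2 wt.
have zero := weak_zero_integral Dl Dsub mD mg ig2 wt.
pose G := g \_ D.
have mG : measurable_fun setT G by apply/(measurable_restrictT g mD).
have G2 : (EFin \o (fun x => G x ^+ 2)) = (EFin \o (fun x => g x ^+ 2)) \_ D.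
  by apply/funext => x; rewrite /G /patch/=; case: ifPn => // _; rewrite expr0n.
have iG2 : mu.-integrable setT (EFin \o (fun x => G x ^+ 2)).
  by rewrite G2; apply/(integrable_mkcond _ mD).
have iG (K : set (measurableTypeR R)) : measurable K -> (mu K < +oo)%E -> mu.-integrable K (EFin \o G).
  move=> mK fK; apply: sqr_integrable_fin => //; first exact: measurable_funS mG.
  by apply: (integrableS _ _ _ iG2).
have h1 y : mu.-integrable [set` Interval (BRight l) (BRight y)] (EFin \o G).
  apply: iG; first exact: measurable_itv.
  by rewrite lebesgue_measure_itv/=; case: ifP => _; rewrite -?EFinB ltry.
have h2 : locally_integrable [set: R] G.
  split => //; first exact: openT.
  move=> K _ cK; have mK : measurable (K : set (measurableTypeR R)) by exact: compact_measurable.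
  have fK : (mu K < +oo)%E by exact: compact_finite_measure.
  by have /integrableP[_] := iG K mK fK.
have := FTC1 h1 h2; apply: filterS; first exact: (ae_filter_ringOfSetsType mu).
move=> x /= hx Dx.
have lx := Dl x Dx.
have [_ e] := hx lx.
have Gx : G x = g x by rewrite /G /patch mem_set.
rewrite -Gx -e derive1E.
have Gzero y : D y -> \int[mu]_(t in [set` Interval (BRight l) (BRight y)]) G t = 0.
  move=> Dy; rewrite -(zero y Dy); apply: eq_Rintegral => t; rewrite inE => /(Dsub y Dy) Dt.
  by rewrite /G /patch mem_set.
have [_ e0] : is_derive x 1 (fun y => \int[mu]_(t in [set` Interval (BRight l) (BRight y)]) G t) 0.
  apply: (near_eq_is_derive _ (is_derive_cst (0 : R) x 1)).
  near=> y; apply/esym/Gzero; near: y.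
  exact: open_nbhs_nbhs.
exact: e0.
Unshelve. all: by end_near. Qed.

Lemma C1_integration_by_parts D phi (Y Y1 : R -> R) p q : C1c D phi -> p <= q ->
  phi p = 0 -> phi q = 0 -> closure [set x | phi x != 0] `<=` `[p, q]%classic ->
  (forall x, p <= x -> x <= q -> is_derive x 1 Y (Y1 x)) ->
  (forall x, p <= x -> x <= q -> Y1 t @[t --> x] --> Y1 x) ->
  \int[mu]_(x in D) (Y x * derive1 phi x) = - \int[mu]_(x in D) (Y1 x * phi x).
Proof.
move=> [dphi cphi' _ supD] pq phip phiq suppq dY cY1.
set S := closure [set x | phi x != 0] in supD suppq.
have phi0 x : ~ S x -> phi x = 0.
  by move=> Sx; apply/eqP; apply/negPn/negP => px; apply: Sx; exact: subset_closure.
have dphi0 x : ~ S x -> derive1 phi x = 0.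
  move=> Sx; rewrite derive1E.
  have [_ e0] : is_derive x 1 phi 0.
    apply: (near_eq_is_derive _ (is_derive_cst (0 : R) x 1)).
    have oS : open (~` S) by exact/closed_openC/closed_closure.
    near=> y; apply/esym/phi0; near: y.
    exact: (@open_nbhs_nbhs _ x (~` S)).
  exact: e0.
have move_supp (f : R -> R) : (forall x, ~ S x -> f x = 0) ->
    \int[mu]_(x in D) f x = \int[mu]_(x in `[p, q]) f x.
  move=> f0.
  transitivity (\int[mu]_(x in setT) f x).
    apply/esym/Rintegral_support => // x _ Dx; apply: f0 => /supD; exact: Dx.
  apply: Rintegral_support => // x _ Ix; apply: f0 => /suppq; exact: Ix.
rewrite (move_supp (fun x => Y x * derive1 phi x)); last first.
  by move=> x /dphi0 ->; rewrite mulr0.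
rewrite (move_supp (fun x => Y1 x * phi x)); last first.
  by move=> x /phi0 ->; rewrite mulr0.
have cphi x : phi t @[t --> x] --> phi x.
  by apply: differentiable_continuous; apply/derivable1_diffP; exact: dphi.
have cY x : p <= x -> x <= q -> Y t @[t --> x] --> Y x.
  by move=> px xq; exact: is_derive_continuous (dY x px xq).
have within (f : R -> R) : (forall x, p <= x -> x <= q -> f t @[t --> x] --> f x) -> {within `[p, q], continuous f}.
  by move=> cf; apply: continuous_in_subspaceT => x; rewrite inE/= in_itv/= => /andP[px xq]; exact: cf.
have w1 : {within `[p, q], continuous (fun x => Y x * derive1 phi x)}.
  by apply: within => x px xq; apply: cvgM; [exact: cY|exact: cphi'].
have w2 : {within `[p, q], continuous (fun x => Y1 x * phi x)}.
  by apply: within => x px xq; apply: cvgM; [exact: cY1|exact: cphi].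
have w12 : {within `[p, q], continuous (fun x => Y x * derive1 phi x + Y1 x * phi x)}.
  apply: within => x px xq; apply: cvgD; apply: cvgM;
    [exact: cY|exact: cphi'|exact: cY1|exact: cphi].
have w3 : {within `[p, q], continuous (fun x => Y x * phi x)}.
  by apply: within => x px xq; apply: cvgM; [exact: cY|exact: cphi].
have d x : p < x -> x < q -> is_derive x 1 (fun x => Y x * phi x) (Y x * derive1 phi x + Y1 x * phi x).
  move=> /ltW px /ltW xq; have d1 := dY x px xq.
  have d2 : is_derive x 1 phi (derive1 phi x) by apply: DeriveDef; [exact: dphi|rewrite derive1E].
  by apply: is_derive_eq; rewrite /GRing.scale/=; ring.
have := Rintegral_FTC_within pq w12 d w3.
rewrite phip phiq !mulr0 subrr RintegralD//; last 2 first.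
- apply: continuous_compact_integrable => //; exact: segment_compact.
- apply: continuous_compact_integrable => //; exact: segment_compact.
by move=> /eqP; rewrite addr_eq0 => /eqP.
Unshelve. all: by end_near. Qed.

End Uniqueness.

(** * Unrolling: energy and integrals on two edges *)

Section Transfer.
Context {R : realType}.
Implicit Types (p q x y l : R) (f F A e : R -> R).
Notation mu := (@lebesgue_measure R).
Implicit Type D : set (measurableTypeR R).

(** The supremum of the points x with D0 p <= D0 x is such a point and cannot be less
    than q. *)
Lemma locally_nondecreasing_le (D0 : R -> R) p q : p <= q ->
  (forall x, p <= x -> x <= q -> exists2 d, 0 < d & forall y, p <= y -> y <= q ->
     `|y - x| < d -> (x <= y -> D0 x <= D0 y) /\ (y <= x -> D0 y <= D0 x)) ->
  D0 p <= D0 q.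
Proof.
move=> pq loc.
pose S : set R := [set x | [/\ p <= x, x <= q & D0 p <= D0 x]].
have Sp : S p by split.
have hS : has_sup S.
  by split; [exists p|exists q => x []].
have ub x : S x -> x <= sup S by move=> Sx; exact: (sup_upper_bound hS).
have ps : p <= sup S by exact: ub.
have sq : sup S <= q by apply: ge_sup; [exists p|move=> x []].
have [d d0 hd] := loc _ ps sq.
have Ss : D0 p <= D0 (sup S).
  have [x Sx dx] := sup_adherent d0 hS.
  have xs := ub _ Sx; case: Sx => px xq hx.
  apply: (le_trans hx); apply: (hd x px xq _).2 => //.
  by rewrite ler0_norm ?subr_le0//; lra.
have [sltq|qs] := ltP (sup S) q; last by have <- : sup S = q by lra.
pose y := Num.min q (sup S + d / 2).
have yq : y <= q by rewrite /y ge_min lexx.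
have sy : sup S < y by rewrite /y lt_min sltq ltrDl divr_gt0.
have yd : y <= sup S + d / 2 by rewrite /y ge_min lexx orbT.
have : S y.
  split => //; first by lra.
  apply: (le_trans Ss); apply: (hd y _ yq _).1; [lra| |exact: ltW].
  by rewrite gtr0_norm ?subr_gt0//; lra.
by move=> /ub; rewrite leNgt sy.
Qed.

(** The potential dominates the energy of a C^1 function: up to eps x, the difference
    between A and a primitive of f1^2 is locally nondecreasing, by the mean value
    theorem and continuity of f1. *)
Lemma derivative_energy f f1 A p q : p <= q -> continuous f -> continuous f1 ->
  (forall x, p < x -> is_derive x 1 f (f1 x)) ->
  (forall x y, p <= x -> x <= y -> y <= q -> energy_le f A x y) ->
  \int[mu]_(x in `[p, q]) f1 x ^+ 2 <= A q - A p.
Proof.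
move=> pq cf cf1 df en.
have cf2 : continuous (fun x => f1 x ^+ 2).
  by move=> x; apply: cvgM; exact: cf1.
have [B cB dB] := antiderivative p cf2.
rewrite (Rintegral_FTC pq cf2 (fun x px _ => dB x px) (continuous_subspaceT cB)).
apply/ler_addgt0Pr => eps eps0.
move: (pq); rewrite le_eqVlt => /predU1P[->|plq]; first by rewrite !subrr add0r ltW.
pose s := eps / (q - p).
have s0 : 0 < s by rewrite divr_gt0 ?subr_gt0.
have es : eps = s * (q - p) by rewrite /s divfK// subr_eq0 gt_eqF.
suff : A p - B p + s * p <= A q - B q + s * q by rewrite es; lra.
apply: (@locally_nondecreasing_le (fun x => A x - B x + s * x)) => // x px xq.
have s20 : 0 < s / 2 by rewrite divr_gt0.
have [d /= d0 hd] : exists2 d, 0 < d & forall z, `|z - x| < d -> `|f1 z ^+ 2 - f1 x ^+ 2| < s / 2.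
  have /cvgrPdist_lt/(_ _ s20) := cf2 x.
  move=> /nbhs_ballP[d /= d0 hd]; exists d => // z zx; rewrite distrC; apply: hd.
  by rewrite /ball/= distrC.
have step a b : p <= a -> a < b -> b <= q -> (forall z, a < z -> z < b -> `|z - x| < d) ->
    A a - B a + s * a <= A b - B b + s * b.
  move=> pa ab bq near.
  have inab (z : R) : z \in `]a, b[%R -> p < z by rewrite in_itv/= => /andP[az _]; exact: le_lt_trans az.
  have [c cab ec] := @MVT R f f1 a b ab
    (fun z zab => df z (inab z zab)) (continuous_subspaceT cf).
  have [c' cab' ec'] := @MVT R B (fun x => f1 x ^+ 2) a b ab
    (fun z zab => dB z (inab z zab)) (continuous_subspaceT cB).
  have := en a b pa (ltW ab) bq; rewrite /energy_le ec exprMn.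
  rewrite [X in _ * X]expr2 mulrA [X in _ <= X]mulrC ler_pM2r ?subr_gt0// => h1.
  move: cab cab'; rewrite !in_itv/= => /andP[ac cb] /andP[ac' cb'].
  have := hd c (near _ ac cb); have := hd c' (near _ ac' cb').
  rewrite !ltr_norml => /andP[_ h2] /andP[h3 _].
  have : (f1 c ^+ 2 - f1 c' ^+ 2 + s) * (b - a) >= 0.
    by apply: mulr_ge0; [lra|rewrite subr_ge0 ltW].
  have -> : (f1 c ^+ 2 - f1 c' ^+ 2 + s) * (b - a) = f1 c ^+ 2 * (b - a) - f1 c' ^+ 2 * (b - a) + s * (b - a) by ring.
  by rewrite -ec'; lra.
exists d => // y py yq yx; split.
  rewrite le_eqVlt => /predU1P[->//|xy]; apply: step => // z xz zy.
  by move: yx; rewrite !gtr0_norm ?subr_gt0//; lra.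
rewrite le_eqVlt => /predU1P[->//|xy]; apply: step => // z xz zy.
by move: yx; rewrite !ltr0_norm ?subr_lt0//; lra.
Qed.

(** The left-hand side is continuous and A is monotone, so the inequality extends to the
    end points from inside. *)
Lemma energy_le_closed F A p q : p < q -> continuous F ->
  (forall x y, p <= x -> x <= y -> y <= q -> A x <= A y) ->
  (forall x y, p < x -> x < y -> y < q -> energy_le F A x y) ->
  forall x y, p <= x -> x <= y -> y <= q -> energy_le F A x y.
Proof.
move=> pq cF ndA en x y px; rewrite le_eqVlt => /predU1P[->|xy] yq.
  by rewrite /energy_le !subrr expr0n mulr0.
rewrite /energy_le -subr_ge0.
pose f t := (y - x) * (A y - A x) - (F (y - t) - F (x + t)) ^+ 2.
have -> : (y - x) * (A y - A x) - (F y - F x) ^+ 2 = f 0 by rewrite /f subr0 addr0.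
apply: (@ge0_at_right _ f 0 ((y - x) / 2)); first by rewrite divr_gt0 ?subr_gt0.
  apply: cvgB; first exact: cvg_cst.
  have c1 : (F (y - t) - F (x + t)) @[t --> 0] --> F (y - 0) - F (x + 0).
    apply: cvgB; (apply: cvg_comp; last exact: cF).
      by apply: cvgB; [exact: cvg_cst|exact: cvg_id].
    by apply: cvgD; [exact: cvg_cst|exact: cvg_id].
  by apply: cvgM.
move=> t t0 tz; rewrite /f subr_ge0.
have h1 : p < x + t by lra.
have h2 : x + t < y - t by lra.
have h3 : y - t < q by lra.
apply: (le_trans (en _ _ h1 h2 h3)).
have a1 : A (y - t) <= A y by apply: ndA => //; lra.
have a2 : A x <= A (x + t) by apply: ndA => //; lra.
have a3 : A (x + t) <= A (y - t) by apply: ndA => //; lra.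
by apply: ler_pM; rewrite ?subr_ge0//; lra.
Qed.

Lemma tadpole_integral p q (G : R -> R) : p < q -> continuous G -> (forall x, 0 <= G x) ->
  (\int[mu]_(x in `]p, +oo[) (G x)%:E =
   \int[mu]_(x in `]p, q[) (G x)%:E + \int[mu]_(x in `]0%R, +oo[) (G (x + q))%:E)%E.
Proof.
move=> pq cG G0.
have mG (K : set (measurableTypeR R)) : measurable_fun K (EFin \o G).
  by apply/measurable_EFinP; apply: measurable_funS (continuous_measurable_fun cG).
have mGq (K : set (measurableTypeR R)) : measurable_fun K (EFin \o (fun x => G (x + q))).
  apply/measurable_EFinP; apply: measurable_funS (continuous_measurable_fun _) => //.
  by move=> x; apply: cvg_comp; last exact: cG; apply: cvgD; [exact: cvg_id|exact: cvg_cst].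
have -> : (`]p, +oo[%classic : set R) = `]p, q[%classic `|` `[q, +oo[%classic.
  apply/seteqP; split=> x /=; rewrite !in_itv/= ?andbT.
    by move=> px; have [xq|qx] := ltP x q; [left; rewrite px|right].
  by case=> [/andP[]//|]; apply: lt_le_trans.
have disj : [disjoint `]p, q[%classic & `[q, +oo[%classic].
  apply/disj_setPS => x [/=]; rewrite !in_itv/= andbT => /andP[_ h1] h2.
  by have := le_lt_trans h2 h1; rewrite ltxx.
have nn (K : set R) x : K x -> (0 <= (G x)%:E)%E by move=> _; rewrite lee_fin.
rewrite (ge0_integral_setU _ _ _ (mG _) (nn _) disj)//.
congr (_ + _)%E.
rewrite integral_itv_obnd_cbnd//; last exact: mGq.
have dF x : is_derive x 1 (fun t : R => t + q) 1.
  by apply: is_derive_eq; rewrite addr0.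
have F' : derive1 (fun t : R => t + q) = cst 1.
  by apply/funext => x; rewrite derive1E derive_val.
have cF : continuous (fun t : R => t + q).
  by move=> x; apply: cvgD; [exact: cvg_id|exact: cvg_cst].
have -> : (`[q, +oo[%classic : set R) = `[0 + q, +oo[%classic by rewrite add0r.
rewrite (@increasing_ge0_integration_by_substitutiony R (fun t => t + q) G 0).
- by apply: eq_integral => x _; rewrite /= F' mulr1.
- by move=> x y _ _; rewrite ltrD2r.
- by rewrite F' => x _; exact: cvg_cst.
- by rewrite F'; exact: is_cvg_cst.
- by rewrite F'; exact: is_cvg_cst.
- split; last by apply: cvg_at_right_filter; exact: cF.
  by move=> x _; exact: ex_derive.
- by apply: cvg_addrr_Ny || apply: cvg_addrr; exact: cvg_id.
- exact: continuous_subspaceT.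
- by move=> x _; exact: G0.
Qed.

(** With e = |f'|^2 this is the potential of f on the edge D. *)
Definition mass_below D e x := \int[mu]_(t in D `&` `]-oo, x[%classic) e t.

Section MassBelow.
Context (D : set (measurableTypeR R)) (e : R -> R).
Hypotheses (mD : measurable D) (ie : mu.-integrable D (EFin \o e)) (e0 : forall x, 0 <= e x).

Let mDx x : measurable (D `&` `]-oo, x[%classic : set (measurableTypeR R)).
Proof. exact: measurableI. Qed.

Lemma mass_below_nd x y : x <= y -> mass_below D e x <= mass_below D e y.
Proof.
move=> xy; apply: le_Rintegral_subset => //.
- by move=> t [Dt /=]; rewrite in_itv/= => tx; split => //; rewrite /= in_itv/= (lt_le_trans tx).
- by apply: (integrableS _ _ _ ie) => // t [].
Qed.

Lemma mass_below_bnd x : 0 <= mass_below D e x <= \int[mu]_(t in D) e t.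
Proof.
apply/andP; split; first by apply: Rintegral_ge0 => t _; exact: e0.
by apply: le_Rintegral_subset => // t [].
Qed.

Lemma mass_below_itv x y : x <= y -> `[x, y]%classic `<=` D ->
  \int[mu]_(t in `[x, y]) e t <= mass_below D e y - mass_below D e x.
Proof.
move=> xy sub.
have sub' : `[x, y[%classic `<=` D.
  by move=> t /= h; apply: sub; move: h; rewrite /= !in_itv/= => /andP[-> /ltW ->].
have -> : \int[mu]_(t in `[x, y]) e t = \int[mu]_(t in `[x, y[) e t.
  apply/esym/Rintegral_itv_bndo_bndc.
  by apply: (integrableS _ _ _ ie).
rewrite lerBrDl /mass_below -Rintegral_setU//; last 2 first.
- by apply: (integrableS _ _ _ ie) => // [|t]; [exact: measurableU|case=> [[]//|/sub']].
- apply/disj_setPS => t [[_ /=]]; rewrite !in_itv/= => h1 /andP[h2 _].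
  by have := le_lt_trans h2 h1; rewrite ltxx.
apply: le_Rintegral_subset => //.
- exact: measurableU.
- move=> t [[Dt /=]|]; rewrite ?in_itv/=.
    by move=> tx; exact: (conj Dt (lt_le_trans tx xy)).
  by move=> h; split; [exact: sub'|move: h; rewrite /= !in_itv/= => /andP[]].
- by apply: (integrableS _ _ _ ie) => // t [].
Qed.

End MassBelow.
End Transfer.

(** * Functions on the tadpole as functions of one real variable *)

Section ComplexEdge.
Context {R : realType}.
Implicit Types (p q x y c m : R) (r : R -> R) (f g : R -> R[i]) (z w : R[i]).
Notation mu := (@lebesgue_measure R).
Implicit Type D : set (measurableTypeR R).

Lemma cabs_ge0 z : 0 <= cabs z.
Proof. by case: z => s t; exact: sqrtr_ge0. Qed.

Lemma cabs_sqr z : cabs z ^+ 2 = complex.Re z ^+ 2 + complex.Im z ^+ 2.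
Proof. by case: z => s t; rewrite /cabs/= sqr_sqrtr// addr_ge0// sqr_ge0. Qed.

Lemma cabs_real c : cabs c%:C = `|c|.
Proof. by rewrite /cabs/= expr0n addr0 sqrtr_sqr. Qed.

(** The reverse triangle inequality, in coordinates. *)
Lemma sqr_cabs_sub z w : (cabs z - cabs w) ^+ 2 <=
  (complex.Re z - complex.Re w) ^+ 2 + (complex.Im z - complex.Im w) ^+ 2.
Proof.
have := cabs_sqr z; have := cabs_sqr w; have z0 := cabs_ge0 z; have w0 := cabs_ge0 w.
move: (cabs z) (cabs w) (complex.Re z) (complex.Im z) (complex.Re w) (complex.Im w) z0 w0.
move=> k n s t s' t' k0 n0 en ek.
suff : s * s' + t * t' <= k * n by nra.
apply: (le_trans (ler_norm _)); rewrite -(ler_pXn2r (_ : (0 < 2)%N)) ?nnegrE ?mulr_ge0//.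
rewrite real_normK ?num_real// exprMn ek en.
by have := sqr_ge0 (s * t' - t * s'); nra.
Qed.

Lemma mem_closure_itv (D : set R) p q x : p < q -> `]p, q[%classic `<=` D -> p <= x -> x <= q ->
  closure D x.
Proof.
move=> pq sub px xq B /nbhs_ballP[d /= d0 dB].
pose e := Num.min (d / 2) ((q - p) / 3).
have e0 : 0 < e by rewrite lt_min !divr_gt0// subr_gt0.
have e1 : e <= d / 2 by rewrite ge_min lexx.
have e2 : e <= (q - p) / 3 by rewrite ge_min lexx orbT.
suff [y [h1 h2 h3]] : exists y, [/\ p < y, y < q & `|x - y| <= e].
  exists y; split; first by apply: sub; rewrite /= in_itv/= h1.
  by apply: dB; rewrite /ball/=; lra.
have [xm|xm] := leP x ((p + q) / 2).
  exists (x + e); split; [lra|lra|].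
  by rewrite opprD addNKr normrN gtr0_norm.
exists (x - e); split; [lra|lra|].
by rewrite opprB addrCA subrr addr0 gtr0_norm.
Qed.

(** A function that is continuous only on A becomes continuous on the line when it is
    composed with a retraction onto A. *)
Lemma continuous_retract (A : set R) (k : R -> R) r : continuous r -> (forall x, A (r x)) ->
  {within A, continuous k} -> continuous (k \o r).
Proof.
move=> cr rA ck x B nB.
have h := ck (r x) B nB.
have {}h : within A (nbhs (r x)) (k @^-1` B) by rewrite nbhs_subspace_in.
by apply: (@filterS _ (nbhs x) _ _ _ _ (cr x _ h)) => t; apply; exact: rA.
Qed.

Lemma in_L2_measurable_sqr D f : measurable D -> in_L2 D f ->
  measurable_fun D (fun x => cabs (f x) ^+ 2).
Proof.
move=> mD [mr mi _].
under [X in measurable_fun _ X]eq_fun do rewrite cabs_sqr.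
by apply: measurable_funD; apply: measurable_funX.
Qed.

Lemma in_L2_integrable D f : measurable D -> in_L2 D f ->
  mu.-integrable D (EFin \o (fun x => cabs (f x) ^+ 2)).
Proof.
move=> mD L; apply/integrableP; split; first by apply/measurable_EFinP; exact: in_L2_measurable_sqr.
case: L => _ _; apply: le_lt_trans; rewrite le_eqVlt; apply/orP; left; apply/eqP.
by apply: eq_integral => x _ /=; rewrite ger0_norm ?sqr_ge0.
Qed.

Lemma in_L2_Re D f : measurable D -> in_L2 D f ->
  mu.-integrable D (EFin \o (fun x => complex.Re (f x) ^+ 2)).
Proof.
move=> mD L; apply: integrable_dom (in_L2_integrable mD L) _ => //.
  by case: L => mr _ _; exact: measurable_funX.
by move=> x _; rewrite ger0_norm ?sqr_ge0// cabs_sqr lerDl sqr_ge0.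
Qed.

Lemma in_L2_Im D f : measurable D -> in_L2 D f ->
  mu.-integrable D (EFin \o (fun x => complex.Im (f x) ^+ 2)).
Proof.
move=> mD L; apply: integrable_dom (in_L2_integrable mD L) _ => //.
  by case: L => _ mi _; exact: measurable_funX.
by move=> x _; rewrite ger0_norm ?sqr_ge0// cabs_sqr lerDr sqr_ge0.
Qed.

Lemma Re_mulr z c : complex.Re (z * c%:C) = complex.Re z * c.
Proof. by case: z => s t /=; rewrite mulr0 subr0. Qed.

Lemma Im_mulr z c : complex.Im (z * c%:C) = complex.Im z * c.
Proof. by case: z => s t /=; rewrite mulr0 add0r. Qed.

Lemma Cintegral_mulr D f (k : R -> R) : Cintegral D (fun x => f x * (k x)%:C) =
  (\int[mu]_(x in D) (complex.Re (f x) * k x)) +i* (\int[mu]_(x in D) (complex.Im (f x) * k x)).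
Proof.
by rewrite /Cintegral; congr Complex; apply: eq_Rintegral => x _; rewrite ?Re_mulr ?Im_mulr.
Qed.

Lemma weak_derivativeP D f g : is_weak_derivative D f g <->
  [/\ in_L2 D g, weak_test D (fun x => complex.Re (f x)) (fun x => complex.Re (g x)) &
      weak_test D (fun x => complex.Im (f x)) (fun x => complex.Im (g x))].
Proof.
split=> [[L wt]|[L wr wi]]; split=> //.
- by move=> phi /wt; rewrite !Cintegral_mulr => -[].
- by move=> phi /wt; rewrite !Cintegral_mulr => -[].
- by move=> phi hphi; rewrite !Cintegral_mulr; congr Complex; [exact: wr|exact: wi].
Qed.

(** The increments of the real and imaginary parts are controlled by their weak
    derivatives, and the modulus varies less than the function. The retraction r extends
    f continuously beyond the edge. *)
Lemma edge_energy D p q f g r : measurable D -> p < q -> `]p, q[%classic `<=` D ->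
  continuous r -> (forall x, closure D (r x)) -> (forall x, D x -> r x = x) ->
  continuous_on (closure D) f -> is_weak_derivative D f g ->
  continuous (fun x => cabs (f (r x))) /\
  forall x y, p <= x -> x <= y -> y <= q ->
    energy_le (fun x => cabs (f (r x))) (mass_below D (fun x => cabs (g x) ^+ 2)) x y.
Proof.
move=> mD pq sub cr rD rid [cRe cIm] /weak_derivativeP[Lg wr wi].
have cR := continuous_retract cr rD cRe; have cI := continuous_retract cr rD cIm.
have cF : continuous (fun x => cabs (f (r x))).
  have -> : (fun x => cabs (f (r x))) =
      (fun x => Num.sqrt (complex.Re (f (r x)) ^+ 2 + complex.Im (f (r x)) ^+ 2)).
    by apply/funext => x; rewrite -cabs_sqr sqrtr_sqr ger0_norm// cabs_ge0.
  move=> x; apply: continuous_comp; last exact: sqrt_continuous.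
  by apply: cvgD; apply: cvgM; first [exact: cR|exact: cI].
split=> //.
have test (k k' : R -> R) (ck : weak_test D k k') : weak_test D (k \o r) k'.
  move=> phi hphi; rewrite -(ck phi hphi); apply: eq_Rintegral => x; rewrite inE => Dx /=.
  by rewrite rid.
have ig := in_L2_integrable mD Lg.
have e0 x : 0 <= cabs (g x) ^+ 2 by exact: sqr_ge0.
apply: energy_le_closed pq cF _ _.
  by move=> x y _ xy _; exact: (mass_below_nd mD ig e0).
move=> x y px xy yq; rewrite /energy_le.
have sub' : `[x, y]%classic `<=` D.
  move=> t /=; rewrite in_itv/= => /andP[xt ty]; apply: sub.
  by rewrite /= in_itv/= (lt_le_trans px xt) (le_lt_trans ty yq).
have [mr mi _] := Lg.
have iR := weak_increment xy sub' cR mD mr (in_L2_Re mD Lg) (test _ _ wr).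
have iI := weak_increment xy sub' cI mD mi (in_L2_Im mD Lg) (test _ _ wi).
have im := mass_below_itv mD ig e0 (ltW xy) sub'.
apply: (le_trans (sqr_cabs_sub _ _)); apply: (le_trans (lerD iR iI)).
rewrite -mulrDr ler_pM2l ?subr_gt0//; apply: le_trans im.
have mI : measurable (`[x, y]%classic : set (measurableTypeR R)) by exact: measurable_itv.
rewrite -RintegralD//; last 2 first.
- exact: (integrableS _ _ _ (in_L2_Re mD Lg)).
- exact: (integrableS _ _ _ (in_L2_Im mD Lg)).
by rewrite le_eqVlt; apply/orP; left; apply/eqP; apply: eq_Rintegral => t _; rewrite cabs_sqr.
Qed.

End ComplexEdge.

Section Unrolling.
Context {R : realType}.
Implicit Types (x y : R) (U V : tfun R) (q : nat).
Notation mu := (@lebesgue_measure R).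
Notation E := (`](- pi), +oo[%classic).

Lemma circE x : circ x <-> - pi < x /\ x < pi :> R.
Proof. by rewrite /circ/= in_itv/=; split=> [/andP[]|[-> ->]]. Qed.

Lemma halflineE x : halfline x <-> 0 < x :> R.
Proof. by rewrite /halfline/= in_itv/= andbT. Qed.

Lemma measurable_circ : measurable (@circ R : set (measurableTypeR R)).
Proof. exact: measurable_itv. Qed.

Lemma measurable_halfline : measurable (@halfline R : set (measurableTypeR R)).
Proof. exact: measurable_itv. Qed.

Lemma pi_itv : - pi < pi :> R. Proof. by rewrite gtrN// pi_gt0. Qed.

(** The q-th power of the L^q norm. *)
Definition power_sum q U : \bar R :=
  (\int[mu]_(x in circ) (cabs (U.1 x) ^+ q)%:E +
   \int[mu]_(x in halfline) (cabs (U.2 x) ^+ q)%:E)%E.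

Lemma power_sum_ge0 q U : (0 <= power_sum q U)%E.
Proof.
by apply: adde_ge0; apply: integral_ge0 => x _; rewrite lee_fin exprn_ge0// cabs_ge0.
Qed.

Lemma fine_Lqnorm q U : (0 < q)%N -> fine (Lqnorm q U) ^+ q = fine (power_sum q U).
Proof.
move=> q0; rewrite /Lqnorm fine_poweR -powR_mulrn ?powR_ge0//.
by rewrite -powRrM mulVf ?pnatr_eq0 -?lt0n// powRr1// fine_ge0// power_sum_ge0.
Qed.

Lemma Lqnorm_eq1 q U : (0 < q)%N -> Lqnorm q U = 1%E <-> power_sum q U = 1%E.
Proof.
move=> q0; split=> [h|h]; last by rewrite /Lqnorm -/(power_sum q U) h poweR_EFin powR1.
have f1 : fine (power_sum q U) = 1 by rewrite -fine_Lqnorm// h/= expr1n.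
case: (power_sum q U) f1 => [s /= ->//| |] /= /eqP; by rewrite eq_sym oner_eq0.
Qed.

Lemma integral_eq_Rintegral (D : set (measurableTypeR R)) (e : R -> R) :
  measurable D -> mu.-integrable D (EFin \o e) ->
  (\int[mu]_(x in D) (e x)%:E)%E = (\int[mu]_(x in D) e x)%:E.
Proof. by move=> mD ie; rewrite /Rintegral fineK//; exact: (integrable_fin_num mD ie). Qed.

(** The modulus of U as one function on the line, equal to cabs (U.1 x) on the circle
    and to cabs (U.2 (x - pi)) beyond it. Each edge function is frozen at its end points
    by a retraction, so that a sum replaces a case distinction and continuity is
    immediate. *)
Definition unroll U x : R :=
  cabs (U.1 (ramp (- pi) pi x)) + cabs (U.2 (Num.max 0 (x - pi))) - cabs (U.2 0).

Lemma unroll_circ U x : - pi <= x -> x <= pi -> unroll U x = cabs (U.1 x).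
Proof. by move=> h1 h2; rewrite /unroll ramp_id// max_l ?subr_le0// addrK. Qed.

Lemma unroll_halfline U x : U.1 pi = U.2 0 -> 0 <= x -> unroll U (x + pi) = cabs (U.2 x).
Proof.
move=> e x0; rewrite /unroll ramp_ge ?lerDr// addrK max_r// e.
by rewrite addrAC subrr add0r.
Qed.

Lemma unroll_power_sum q U : U.1 pi = U.2 0 -> continuous (unroll U) -> (forall x, 0 <= unroll U x) ->
  (\int[mu]_(x in E) (unroll U x ^+ q)%:E)%E = power_sum q U.
Proof.
move=> e cF F0; rewrite (tadpole_integral pi_itv); last 2 first.
- move=> x; apply: (@continuous_comp _ _ _ (unroll U) (fun x : R => x ^+ q)); first exact: cF.
  exact: exprn_continuous.
- by move=> x; exact: exprn_ge0.
congr (_ + _)%E; apply: eq_integral => x; rewrite inE /=.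
  by move=> /circE[h1 h2]; rewrite unroll_circ// ltW.
by move=> /halflineE h; rewrite unroll_halfline// ltW.
Qed.

Lemma weak_derivative_spec (D : set R) f : (exists g, is_weak_derivative D f g) ->
  is_weak_derivative D f (weak_derivative D f).
Proof. exact: xgetPex. Qed.

Lemma B_formE (omega : R) U : B_form omega U =
  fine (power_sum 2 (grad U)) - omega * fine (power_sum 2 U).
Proof. by rewrite /B_form !fine_Lqnorm. Qed.

(** The potential is the sum of the masses of |U'|^2 on the two edges; the energy
    inequality holds on each edge and is concatenated at the vertex. *)
Lemma unroll_budget (omega : R) U : omega < 0 -> H1C U ->
  [/\ budget (- omega) (- pi) pi (unroll U) (B_form omega U) & 
      (\int[mu]_(x in E) (unroll U x ^+ 6)%:E)%E = power_sum 6 U].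
Proof.
move=> w0 [[L1 ex1 c1] [L2 ex2 c2] e1 e2].
have e3 : U.1 pi = U.2 0 by rewrite e1.
have mc := measurable_circ; have mh := measurable_halfline.
have W1 := weak_derivative_spec ex1; have W2 := weak_derivative_spec ex2.
have G1 : in_L2 circ (grad U).1 by case: W1.
have G2 : in_L2 halfline (grad U).2 by case: W2.
pose A1 := mass_below circ (fun x => cabs ((grad U).1 x) ^+ 2).
pose A2 := mass_below halfline (fun x => cabs ((grad U).2 x) ^+ 2).
pose m1 x := cabs (U.1 (ramp (- pi) pi x)); pose m2 x := cabs (U.2 (Num.max 0 x)).
have [cm1 en1] : continuous m1 /\ forall x y, - pi <= x -> x <= y -> y <= pi -> energy_le m1 A1 x y.
  apply: (edge_energy mc pi_itv) c1 W1 => //; first exact: ramp_continuous.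
    move=> x; apply: (@mem_closure_itv _ _ (- pi) pi) => //; first exact: pi_itv.
      by rewrite /ramp le_min le_max lexx orbT ltW// pi_itv.
    by rewrite /ramp ge_min lexx orbT.
  by move=> x /circE[h1 h2]; rewrite ramp_id// ltW.
have half_edge (b : R) : 0 < b -> continuous m2 /\
    forall x y, 0 <= x -> x <= y -> y <= b -> energy_le m2 A2 x y.
  move=> b0; apply: (edge_energy mh b0) c2 W2 => //.
  - by move=> x /=; rewrite in_itv/= => /andP[h _]; exact/halflineE.
  - exact: pos_part_continuous.
  - move=> x; apply: (@mem_closure_itv _ _ 0 (Num.max 0 x + 1)) => //.
    + by rewrite ltr_wpDl// le_max lexx.
    + by move=> t /=; rewrite in_itv/= => /andP[h _]; exact/halflineE.
    + by rewrite le_max lexx.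
    + by rewrite lerDl.
  - by move=> x /halflineE h; rewrite max_r// ltW.
have [cm2 _] := half_edge 1 ltr01.
have en2 x y : 0 <= x -> x <= y -> energy_le m2 A2 x y.
  by move=> x0 xy; apply: (half_edge (y + 1) _).2; lra.
have m20 : cabs (U.2 0) = m2 0 by rewrite /m2 max_l.
have FE : unroll U = fun x => m1 x + m2 (x - pi) - m2 0.
  by apply/funext => x; rewrite /unroll m20.
have cF : continuous (unroll U).
  rewrite FE => x; apply: cvgB; last exact: cvg_cst.
  apply: cvgD; first exact: cm1.
  apply: (@continuous_comp _ _ _ (fun t => t - pi) m2); last exact: cm2.
  by apply: cvgB; [exact: cvg_id|exact: cvg_cst].
have F0 x : 0 <= unroll U x.
  have [xpi|/ltW pix] := leP x pi.
    by rewrite FE /m2 (@max_l _ _ _ (x - pi)) ?subr_le0// max_l// addrK cabs_ge0.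
  by rewrite -[x](subrK pi) unroll_halfline ?subr_ge0// cabs_ge0.
split; last exact: unroll_power_sum.
have I1 := in_L2_integrable mc G1; have I2 := in_L2_integrable mh G2.
have nn1 x : 0 <= cabs ((grad U).1 x) ^+ 2 by exact: sqr_ge0.
have nn2 x : 0 <= cabs ((grad U).2 x) ^+ 2 by exact: sqr_ge0.
have nd1 x y : x <= y -> A1 x <= A1 y by move=> xy; exact: (mass_below_nd mc I1 nn1).
have nd2 x y : x <= y -> A2 x <= A2 y by move=> xy; exact: (mass_below_nd mh I2 nn2).
have psum2 : power_sum 2 U = (\int[mu]_(x in circ) cabs (U.1 x) ^+ 2 +
    \int[mu]_(x in halfline) cabs (U.2 x) ^+ 2)%:E.
  by rewrite /power_sum !integral_eq_Rintegral//; exact: in_L2_integrable.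
have gsum2 : power_sum 2 (grad U) = (\int[mu]_(x in circ) cabs ((grad U).1 x) ^+ 2 +
    \int[mu]_(x in halfline) cabs ((grad U).2 x) ^+ 2)%:E.
  by rewrite /power_sum !integral_eq_Rintegral.
have mass : (\int[mu]_(x in E) (unroll U x ^+ 2)%:E)%E = power_sum 2 U.
  exact: unroll_power_sum.
split=> //.
- by rewrite !unroll_circ ?lexx ?(ltW pi_itv)// e1.
- apply/integrableP; split.
    apply/measurable_EFinP; apply: measurable_funX.
    exact: measurable_funS (continuous_measurable_fun cF).
  apply: (@le_lt_trans _ _ (power_sum 2 U)); last by rewrite psum2 ltry.
  rewrite -mass le_eqVlt; apply/orP; left; apply/eqP; apply: eq_integral => x _ /=.
  by rewrite ger0_norm ?sqr_ge0.
exists (fine (power_sum 2 (grad U))); last first.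
  by rewrite B_formE /Rintegral mass mulNr.
exists (fun x => A1 x + A2 (x - pi)).
  have left x y : - pi <= x -> x <= y -> y <= pi -> energy_le (unroll U) (fun x => A1 x + A2 (x - pi)) x y.
    move=> px xy yp; rewrite /energy_le !unroll_circ ?(le_trans px xy)// ?(le_trans xy yp)//.
    have := en1 x y px xy yp; rewrite /energy_le /m1 !ramp_id ?(le_trans px xy)// ?(le_trans xy yp)//.
    move=> /le_trans; apply; apply: ler_wpM2l; first by rewrite subr_ge0.
    have : A2 (x - pi) <= A2 (y - pi) by apply: nd2; rewrite lerB.
    lra.
  have right x y : pi <= x -> x <= y -> energy_le (unroll U) (fun x => A1 x + A2 (x - pi)) x y.
    move=> px xy; have py := le_trans px xy.
    rewrite /energy_le FE /m1 !ramp_ge//.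
    have := en2 (x - pi) (y - pi); rewrite subr_ge0 lerB// => /(_ px isT); rewrite /energy_le.
    have -> : y - pi - (x - pi) = y - x by lra.
    set s := cabs _; have -> : s + m2 (y - pi) - m2 0 - (s + m2 (x - pi) - m2 0) = m2 (y - pi) - m2 (x - pi) by lra.
    move=> /le_trans; apply; apply: ler_wpM2l; first by rewrite subr_ge0.
    by have := nd1 x y xy; lra.
  move=> x y px xy; have [yp|/ltW py] := leP y pi; first exact: left.
  have [xp|/ltW xp] := leP x pi; last exact: right.
  by apply: (energy_le_trans xp py); [exact: left|exact: right].
move=> y py; rewrite gsum2/=.
have /andP[_ b1] := mass_below_bnd mc I1 nn1 y.
have /andP[b1' _] := mass_below_bnd mc I1 nn1 (- pi).
have /andP[_ b2] := mass_below_bnd mh I2 nn2 (y - pi).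
have /andP[b2' _] := mass_below_bnd mh I2 nn2 (- pi - pi).
rewrite -/A1 -/A2 in b1 b1' b2 b2' *; lra.
Qed.

Lemma constraint_budget (omega : R) U : omega < 0 -> constraint_set U ->
  budget (- omega) (- pi) pi (unroll U) (B_form omega U) /\ sextic (- pi) (unroll U) = 1.
Proof.
move=> w0 [/(unroll_budget w0)[b s]]; have p6 : (0 < 6)%N by [].
by move=> /(Lqnorm_eq1 _ p6) n6; split=> //; rewrite /sextic /Rintegral s n6.
Qed.

End Unrolling.

(** * Classical functions as Sobolev functions *)

Section WeakUniqueness.
Context {R : realType}.
Implicit Types (p q x y c m : R) (f g : R -> R[i]) (Y : R -> R).
Notation mu := (@lebesgue_measure R).
Implicit Type D : set (measurableTypeR R).

Lemma test_bounded D phi : C1c D phi -> exists2 M, 0 <= M &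
  forall x, `|phi x| <= M /\ (closure [set x | phi x != 0] x -> `|x| <= M).
Proof.
move=> [dphi _ cK KD]; set K := closure _ in cK KD *.
have cphi : continuous phi.
  by move=> x; apply: differentiable_continuous; apply/derivable1_diffP; exact: dphi.
have [M1 [_ h1]] := compact_bounded (continuous_compact (continuous_subspaceT cphi) cK).
have [M2 [_ h2]] := compact_bounded cK.
pose M := Num.max 0 (Num.max (M1 + 1) (M2 + 1)).
exists M; first by rewrite le_max lexx.
have l1 : M1 < M by rewrite lt_max lt_max ltrDl ltr01 orbT.
have l2 : M2 < M by rewrite lt_max lt_max (ltrDl M2) ltr01 !orbT.
move=> x; split; last by move=> Kx; exact: (h2 M l2 x Kx).
have [->|px] := eqVneq (phi x) 0; first by rewrite normr0 le_max lexx.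
by apply: (h1 M l1); exists x => //; exact: subset_closure.
Qed.

Lemma test_outside D phi x : C1c D phi -> ~ D x -> phi x = 0.
Proof.
move=> [_ _ _ KD] Dx; apply/eqP/negPn/negP => px; apply/Dx/KD; exact: subset_closure.
Qed.

Lemma test_continuous D phi : C1c D phi -> continuous phi.
Proof.
by move=> [dphi _ _ _] x; apply: differentiable_continuous; apply/derivable1_diffP; exact: dphi.
Qed.

(** The product is dominated by a multiple of Y^2 plus the indicator of the support. *)
Lemma integrable_test D phi Y : measurable D -> C1c D phi -> measurable_fun D Y ->
  mu.-integrable D (EFin \o (fun x => Y x ^+ 2)) ->
  mu.-integrable D (EFin \o (fun x => Y x * phi x)).
Proof.
move=> mD hphi mY iY; have [M M0 hM] := test_bounded hphi.
have cphi := test_continuous hphi.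
have [_ _ cK _] := hphi; set K : set (measurableTypeR R) := closure _ in cK hM.
have mK : measurable K by exact: compact_measurable.
have fK : (mu K < +oo)%E by exact: compact_finite_measure.
have i1 : mu.-integrable D (EFin \o (fun x => 1 * (\1_K x : R))) by exact: integrable_indic_scale.
have i2 : mu.-integrable D (EFin \o (fun x => M * (Y x ^+ 2 + 1 * (\1_K x : R)))).
  by apply: integrable_scale => //; exact: integrable_add.
apply: integrable_dom i2 _ => //.
  by apply: measurable_funM => //; exact: measurable_funS (continuous_measurable_fun cphi).
move=> x Dx; have [h _] := hM x.
have [Kx|Kx] := pselect (K x); last first.
  have -> : phi x = 0 by apply/eqP/negPn/negP => px; apply: Kx; exact: subset_closure.
  by rewrite mulr0 normr0 mulr_ge0// addr_ge0 ?sqr_ge0// indicE mul1r; case: (_ \in _).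
rewrite indicE mem_set// mulr1 normrM mulrC.
apply: (@le_trans _ _ (M * `|Y x|)); first exact: ler_wpM2r.
apply: ler_wpM2l => //; rewrite -[Y x ^+ 2]real_normK ?num_real//.
by have := sqr_ge0 (`|Y x| - 1); have := normr_ge0 (Y x); nra.
Qed.

Lemma weak_test_unique l D Y (G G' : R -> R) : open (D : set R) -> (forall x, D x -> l < x) ->
  (forall x, D x -> `]l, x]%classic `<=` D) -> measurable D ->
  measurable_fun D G -> mu.-integrable D (EFin \o (fun x => G x ^+ 2)) ->
  measurable_fun D G' -> mu.-integrable D (EFin \o (fun x => G' x ^+ 2)) ->
  weak_test D Y G -> weak_test D Y G' -> {ae mu, forall x, D x -> G x = G' x}.
Proof.
move=> oD Dl Dsub mD mG iG mG' iG' wG wG'.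
have : {ae mu, forall x, D x -> G x - G' x = 0}.
  apply: (weak_zero_ae oD Dl Dsub mD).
  - exact: measurable_funB.
  - have i2 : mu.-integrable D (EFin \o (fun x => 2 * (G x ^+ 2 + G' x ^+ 2))).
      by apply: integrable_scale => //; exact: integrable_add.
    apply: integrable_dom i2 _ => //; first by apply: measurable_funX; exact: measurable_funB.
    by move=> x _; rewrite ger0_norm ?sqr_ge0//; have := sqr_ge0 (G x + G' x); nra.
  move=> phi hphi; have e1 := wG phi hphi; have e2 := wG' phi hphi.
  transitivity (\int[mu]_(x in D) (G x * phi x - G' x * phi x)).
    by apply: eq_Rintegral => x _; rewrite mulrBl.
  rewrite RintegralB//; [|exact: integrable_test|exact: integrable_test].
  by apply/eqP; rewrite subr_eq0 -eqr_opp -e1 -e2.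
apply: filterS; first exact: (ae_filter_ringOfSetsType mu).
by move=> x /= h Dx; apply/eqP; rewrite -subr_eq0 h.
Qed.

Lemma weak_derivative_unique l D f g g' : open (D : set R) -> (forall x, D x -> l < x) ->
  (forall x, D x -> `]l, x]%classic `<=` D) -> measurable D ->
  is_weak_derivative D f g -> is_weak_derivative D f g' ->
  {ae mu, forall x, D x -> g x = g' x}.
Proof.
move=> oD Dl Dsub mD /weak_derivativeP[L wr wi] /weak_derivativeP[L' wr' wi'].
have [mr mi _] := L; have [mr' mi' _] := L'.
have hr := weak_test_unique oD Dl Dsub mD mr (in_L2_Re mD L) mr' (in_L2_Re mD L') wr wr'.
have hi := weak_test_unique oD Dl Dsub mD mi (in_L2_Im mD L) mi' (in_L2_Im mD L') wi wi'.
move: hr hi; apply: filterS2; first exact: (ae_filter_ringOfSetsType mu).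
move=> x /= hr hi Dx; move: (hr Dx) (hi Dx).
by case: (g x) (g' x) => [s t] [s' t'] /= -> ->.
Qed.

(** Needed because a gradient is an arbitrary representative, which the Laplacian
    differentiates again. *)
Lemma is_weak_derivative_ae D f f' g : measurable D -> in_L2 D f -> in_L2 D f' ->
  {ae mu, forall x, D x -> f x = f' x} -> is_weak_derivative D f g -> is_weak_derivative D f' g.
Proof.
move=> mD [mr mi _] [mr' mi' _] ff' /weak_derivativeP[Lg wr wi].
have key (h h' k : R -> R) : measurable_fun D h -> measurable_fun D h' ->
    {ae mu, forall x, D x -> h x = h' x} -> weak_test D h k -> weak_test D h' k.
  move=> mh mh' hh' wt phi hphi; rewrite -(wt phi hphi) /Rintegral; congr fine.
  have cphi' : continuous (derive1 phi) by case: hphi.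
  have mphi' : measurable_fun D (derive1 phi) by exact: measurable_funS (continuous_measurable_fun cphi').
  apply: ae_eq_integral => //; try by apply/measurable_EFinP; exact: measurable_funM.
  move: hh'; apply: filterS; first exact: (ae_filter_ringOfSetsType mu).
  by move=> x /= e Dx; rewrite e.
apply/weak_derivativeP; split=> //.
- apply: key wr => //; move: ff'; apply: filterS; first exact: (ae_filter_ringOfSetsType mu).
  by move=> x /= e Dx; rewrite e.
- apply: key wi => //; move: ff'; apply: filterS; first exact: (ae_filter_ringOfSetsType mu).
  by move=> x /= e Dx; rewrite e.
Qed.

Lemma in_L2_real D Y : measurable D -> continuous Y ->
  mu.-integrable D (EFin \o (fun x => Y x ^+ 2)) -> in_L2 D (fun x => (Y x)%:C).
Proof.
move=> mD cY iY; split => /=.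
- exact: measurable_funS (continuous_measurable_fun cY).
- exact: measurable_cst.
have /integrableP[_] := iY; apply: le_lt_trans; rewrite le_eqVlt; apply/orP; left; apply/eqP.
have e x : cabs (Y x)%:C ^+ 2 = `|Y x ^+ 2|.
  by rewrite cabs_real real_normK ?num_real// ger0_norm ?sqr_ge0.
by apply: eq_integral => x _; exact: (congr1 EFin (e x)).
Qed.

(** The test function vanishes at p, which is not in D, and far to the right. *)
Lemma weak_derivative_real p D Y (Y1 : R -> R) : measurable D -> (forall x, D x -> p < x) ->
  continuous Y1 -> (forall x, p <= x -> is_derive x 1 Y (Y1 x)) ->
  mu.-integrable D (EFin \o (fun x => Y1 x ^+ 2)) ->
  is_weak_derivative D (fun x => (Y x)%:C) (fun x => (Y1 x)%:C).
Proof.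
move=> mD Dp cY1 dY iY1; apply/weak_derivativeP; split; first exact: in_L2_real.
  move=> phi hphi /=; have [M M0 hM] := test_bounded hphi.
  pose q := Num.max p (M + 1).
  have pq : p <= q by rewrite le_max lexx.
  have Mq : M < q by rewrite lt_max ltrDl ltr01 orbT.
  apply: (@C1_integration_by_parts _ _ _ _ _ p q) => //.
  - by apply: (test_outside hphi) => /Dp; rewrite ltxx.
  - apply/eqP/negPn/negP => pq0; have := (hM q).2 (@subset_closure R [set x | phi x != 0] q pq0).
    by rewrite leNgt (lt_le_trans Mq)// ler_norm.
  - move=> x Kx; rewrite /= in_itv/=; have [_ _ _ KD] := hphi.
    rewrite ltW ?(Dp _ (KD _ Kx))//= (le_trans (ler_norm _))//.
    by rewrite (le_trans ((hM x).2 Kx))// ltW.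
  - by move=> x px _; exact: dY.
  - by move=> x _ _; exact: cY1.
move=> phi _ /=; transitivity (\int[mu]_(x in D) (0 : R)).
  by apply: eq_Rintegral => x _; rewrite mul0r.
rewrite Rintegral_cst// mul0r (_ : (fun x => 0 * phi x) = fun=> 0); last first.
  by apply/funext => x; rewrite mul0r.
by rewrite Rintegral_cst// mul0r oppr0.
Qed.

Lemma in_H1_real p D Y (Y1 : R -> R) : measurable D -> (forall x, D x -> p < x) ->
  continuous Y -> continuous Y1 -> (forall x, p <= x -> is_derive x 1 Y (Y1 x)) ->
  mu.-integrable D (EFin \o (fun x => Y x ^+ 2)) ->
  mu.-integrable D (EFin \o (fun x => Y1 x ^+ 2)) ->
  in_H1 D (fun x => (Y x)%:C).
Proof.
move=> mD Dp cY cY1 dY iY iY1; split; first exact: in_L2_real.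
  by exists (fun x => (Y1 x)%:C); exact: (weak_derivative_real mD Dp).
by split=> /=; apply: continuous_subspaceT => //; exact: cst_continuous.
Qed.

Section ClassicalEdge.
Context (l : R) (D : set (measurableTypeR R)) (Y Y1 Y2 : R -> R).
Hypotheses (oD : open (D : set R)) (Dl : forall x, D x -> l < x)
  (Dsub : forall x, D x -> `]l, x]%classic `<=` D) (mD : measurable D)
  (cY : continuous Y) (cY1 : continuous Y1) (cY2 : continuous Y2)
  (dY : forall x, l <= x -> is_derive x 1 Y (Y1 x))
  (dY1 : forall x, l <= x -> is_derive x 1 Y1 (Y2 x))
  (iY : mu.-integrable D (EFin \o (fun x => Y x ^+ 2)))
  (iY1 : mu.-integrable D (EFin \o (fun x => Y1 x ^+ 2)))
  (iY2 : mu.-integrable D (EFin \o (fun x => Y2 x ^+ 2))).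
Local Notation Yc := (fun x => (Y x)%:C).
Local Notation Y1c := (fun x => (Y1 x)%:C).
Local Notation Y2c := (fun x => (Y2 x)%:C).

Let wY : is_weak_derivative D Yc Y1c. Proof. exact: weak_derivative_real mD Dl _ dY iY1. Qed.
Let wY1 : is_weak_derivative D Y1c Y2c. Proof. exact: weak_derivative_real mD Dl _ dY1 iY2. Qed.
Let sY : is_weak_derivative D Yc (weak_derivative D Yc).
Proof. by apply: weak_derivative_spec; exists Y1c. Qed.

Lemma classical_in_H2 : in_H2 D Yc Y1c.
Proof.
by split=> //; [exact: (in_H1_real mD Dl cY cY1)|exact: (in_H1_real mD Dl cY1 cY2)].
Qed.

Lemma classical_gradient : {ae mu, forall x, D x -> Y1c x = weak_derivative D Yc x}.
Proof. exact: weak_derivative_unique oD Dl Dsub mD wY sY. Qed.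

(** The gradient is an unspecified representative; replacing it by Y1 does not change
    its weak derivative. *)
Lemma classical_laplacian :
  {ae mu, forall x, D x -> Y2c x = weak_derivative D (weak_derivative D Yc) x}.
Proof.
have h : is_weak_derivative D (weak_derivative D Yc) Y2c.
  apply: (is_weak_derivative_ae mD _ _ classical_gradient wY1); first by case: wY.
  by case: sY.
apply: (weak_derivative_unique oD Dl Dsub mD h).
by apply: weak_derivative_spec; exists Y2c.
Qed.

Lemma classical_dirichlet :
  (\int[mu]_(x in D) (cabs (weak_derivative D Yc x) ^+ 2)%:E)%E = (\int[mu]_(x in D) Y1 x ^+ 2)%:E.
Proof.
rewrite -integral_eq_Rintegral//; have [L _] := sY.
apply: ge0_ae_eq_integral => //.
- by apply/measurable_EFinP; exact: in_L2_measurable_sqr.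
- by case/integrableP: iY1.
- by move=> x _; rewrite lee_fin sqr_ge0.
- by move=> x _; rewrite lee_fin sqr_ge0.
move: classical_gradient; apply: filterS; first exact: (ae_filter_ringOfSetsType mu).
by move=> x h Dx; rewrite -(h Dx) cabs_real real_normK ?num_real.
Qed.

End ClassicalEdge.
End WeakUniqueness.

(** * The maximizer as a function on the tadpole *)

Section Profile.
Context {R : realType}.
Notation mu := (@lebesgue_measure R).
Local Notation E := `](- pi), +oo[%classic.
Context (a nu : R) (W u u1 v v1 : R -> R).
Hypotheses (a0 : 0 < a) (bW : budget a (- pi) pi W 1) (W0 : forall x, 0 <= W x)
  (sm : smooth_solution a nu pi W u u1 v v1).
Implicit Types (m x y c : R).

Let force x := a * W x - nu * W x ^+ 5.

(** The half-line of the unrolled tadpole starts at pi, hence the translation. *)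
Definition lift m (y z : R -> R) : tfun R :=
  (fun x => (m * y x)%:C, fun x => (m * z (x + pi))%:C).

Let cW : continuous W. Proof. by case: bW. Qed.

Let cforce : continuous force.
Proof.
move=> x; apply: cvgB; (apply: cvgM; first exact: cvg_cst); first exact: cW.
apply: (@continuous_comp _ _ _ W (fun x : R => x ^+ 5)); first exact: cW.
exact: exprn_continuous.
Qed.

Let c_scale m (f : R -> R) : continuous f -> continuous (fun x => m * f x).
Proof. by move=> cf x; apply: cvgM; [exact: cvg_cst|exact: cf]. Qed.

Let c_shift1 (f : R -> R) : continuous f -> continuous (fun x => f (x + pi)).
Proof.
move=> cf x; apply: (@continuous_comp _ _ _ (fun t : R => t + pi) f); last exact: cf.
by apply: cvgD; [exact: cvg_id|exact: cvg_cst].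
Qed.

Let c_shift m (f : R -> R) : continuous f -> continuous (fun x => m * f (x + pi)).
Proof. by move=> cf; apply: c_scale; exact: c_shift1. Qed.

Let d_scale m (f : R -> R) c x : is_derive x 1 f c -> is_derive x 1 (fun t => m * f t) (m * c).
Proof. by move=> df; apply: is_derive_eq; rewrite /GRing.scale/=; ring. Qed.

Let d_shift1 (f : R -> R) c x : is_derive (x + pi) 1 f c ->
  is_derive x 1 (fun t => f (t + pi)) c.
Proof.
move=> df; have ds : is_derive x 1 (fun t : R => t + pi) 1 by apply: is_derive_eq; rewrite addr0.
have dc : is_derive x 1 (f \o (fun t : R => t + pi)) c.
  by apply: is_derive_eq; rewrite /GRing.scale/=; ring.
exact: dc.
Qed.

Let d_shift m (f : R -> R) c x : is_derive (x + pi) 1 f c ->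
  is_derive x 1 (fun t => m * f (t + pi)) (m * c).
Proof. by move=> df; apply: d_scale; exact: d_shift1. Qed.

Let pi0 : 0 < pi :> R. Proof. exact: pi_gt0. Qed.

Let mc := @measurable_circ R.
Let mh := @measurable_halfline R.

Let circ_gt x : circ x -> - pi < x. Proof. by case/circE. Qed.
Let halfline_gt x : halfline x -> 0 < x. Proof. by move/halflineE. Qed.

Let i_circ1 (f : R -> R) : continuous f -> mu.-integrable circ (EFin \o (fun x => f x ^+ 2)).
Proof.
move=> cf; apply: (@continuous_integrable_itv _ _ (- pi) pi).
  by move=> x; apply: cvgM; exact: cf.
by move=> x /circE[/ltW h1 /ltW h2]; rewrite /= in_itv/= h1.
Qed.

Let i_circ m (f : R -> R) : continuous f -> mu.-integrable circ (EFin \o (fun x => (m * f x) ^+ 2)).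
Proof. by move=> cf; apply: i_circ1; exact: c_scale. Qed.

Let i_half_scale m (f : R -> R) : mu.-integrable halfline (EFin \o (fun x => f (x + pi) ^+ 2)) ->
  mu.-integrable halfline (EFin \o (fun x => (m * f (x + pi)) ^+ 2)).
Proof.
move=> i; have -> : (fun x => (m * f (x + pi)) ^+ 2) = (fun x => m ^+ 2 * f (x + pi) ^+ 2).
  by apply/funext => x; rewrite exprMn.
exact: integrable_scale.
Qed.

Let iWh : mu.-integrable halfline (EFin \o (fun x => W (x + pi) ^+ 2)).
Proof.
have cWs := c_shift1 cW.
apply/integrableP; split.
  apply/measurable_EFinP; apply: measurable_funX.
  exact: measurable_funS (continuous_measurable_fun cWs).
have [_ _ /integrableP[_ iE] _] := bW.
have cW2 : continuous (fun x => W x ^+ 2) by move=> x; apply: cvgM; exact: cW.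
have e := tadpole_integral (@pi_itv R) cW2 (fun x => sqr_ge0 (W x)).
have absE (f : R -> R) (D : set (measurableTypeR R)) :
    (\int[mu]_(x in D) `|(f x ^+ 2)%:E| = \int[mu]_(x in D) (f x ^+ 2)%:E)%E.
  by apply: eq_integral => x _ /=; rewrite ger0_norm ?sqr_ge0.
apply: (@le_lt_trans _ _ (\int[mu]_(x in halfline) (W (x + pi) ^+ 2)%:E)%E).
  by rewrite le_eqVlt; apply/orP; left; apply/eqP; exact: (absE (fun x => W (x + pi))).
apply: (@le_lt_trans _ _ (\int[mu]_(x in E) (W x ^+ 2)%:E)%E).
  by rewrite e leeDr//; apply: integral_ge0 => x _; rewrite lee_fin sqr_ge0.
by apply: le_lt_trans iE; rewrite le_eqVlt; apply/orP; left; apply/eqP/esym; exact: (absE W).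
Qed.

(** W is bounded, so the force is at most a multiple of W. *)
Let iforce_half : mu.-integrable halfline (EFin \o (fun x => force (x + pi) ^+ 2)).
Proof.
pose S := 2 * (1 + a^-1) * 1.
have cs := c_shift1 cforce.
have i : mu.-integrable halfline (EFin \o (fun x => (a + `|nu| * S ^+ 2) ^+ 2 * W (x + pi) ^+ 2)).
  exact: integrable_scale.
apply: integrable_dom i _ => //.
  by apply: measurable_funX; exact: measurable_funS (continuous_measurable_fun cs).
move=> x /halflineE x0; rewrite ger0_norm ?sqr_ge0//.
have WS : W (x + pi) ^+ 2 <= S by apply: (budget_sup a0 bW) => //; have := pi0; lra.
have -> : force (x + pi) ^+ 2 = (a - nu * (W (x + pi) ^+ 2) ^+ 2) ^+ 2 * W (x + pi) ^+ 2.
  by rewrite /force; ring.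
apply: ler_wpM2r; first exact: sqr_ge0.
have p2 : (0 < 2)%N by [].
have S0 : 0 <= S := le_trans (sqr_ge0 _) WS.
have WS2 : (W (x + pi) ^+ 2) ^+ 2 <= S ^+ 2 by rewrite ler_pXn2r ?nnegrE ?sqr_ge0.
have nu0 : 0 <= `|nu| * S ^+ 2 by rewrite mulr_ge0 ?sqr_ge0.
rewrite -[leLHS]real_normK ?num_real// ler_pXn2r ?nnegrE ?normr_ge0 ?addr_ge0 ?(ltW a0)//.
apply: (le_trans (ler_normB _ _)); rewrite gtr0_norm// lerD2l normrM ler_wpM2l//.
by rewrite ger0_norm ?sqr_ge0.
Qed.

(** The budget of W bounds an abstract energy; this recovers the true Dirichlet
    integrals of both edges, and in particular the integrability of v1^2. *)
Let dirichlet : exists c1 c2, [/\ \int[mu]_(x in circ) u1 x ^+ 2 <= c1,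
  mu.-integrable halfline (EFin \o (fun x => v1 (x + pi) ^+ 2)),
  \int[mu]_(x in halfline) v1 (x + pi) ^+ 2 <= c2 &
  c1 + c2 + a * \int[mu]_(x in E) W x ^+ 2 <= 1].
Proof.
have [_ _ _ [c [A pot Ac] cm]] := bW.
have pp := @pi_itv R.
exists (A pi - A (- pi)), (c + A (- pi) - A pi).
have cu1 := smooth_cu1 sm; have cv1 := smooth_cv1 sm.
have circle : \int[mu]_(x in circ) u1 x ^+ 2 <= A pi - A (- pi).
  have : \int[mu]_(x in `[- pi, pi]) u1 x ^+ 2 <= A pi - A (- pi).
    apply: (@derivative_energy _ u u1 A) => //; first exact: ltW.
    - exact: smooth_cu sm.
    - by move=> x px; apply: (smooth_u sm); lra.
    move=> x y px xy yp; have := pot x y px xy.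
    by rewrite /energy_le !(smooth_circle sm)// ?(le_trans px)// (le_trans xy).
  apply: le_trans; apply: le_Rintegral_subset => //.
  - by move=> x /circE[/ltW h1 /ltW h2]; rewrite /= in_itv/= h1.
  - apply: (@continuous_integrable_itv _ _ (- pi) pi) => //.
    by move=> x; apply: cvgM; exact: cu1.
  - by move=> x _; exact: sqr_ge0.
have cvs := c_shift1 (smooth_cv sm).
have cv1s := c_shift1 cv1.
have [ih hh] : mu.-integrable `]0, +oo[ (EFin \o (fun x => v1 (x + pi) ^+ 2)) /\
    \int[mu]_(x in `]0, +oo[) v1 (x + pi) ^+ 2 <= c + A (- pi) - A pi.
  apply: halfline_integrable.
  - by move=> x; apply: cvgM; exact: cv1s.
  - by move=> x; exact: sqr_ge0.
  move=> X X0.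
  apply: (@le_trans _ _ (A (X + pi) - A (0 + pi))).
    apply: (@derivative_energy _ (fun x => v (x + pi)) (fun x => v1 (x + pi)) (fun x => A (x + pi))) => //.
      move=> x x0; have dv : is_derive (x + pi) 1 v (v1 (x + pi)) by apply: (smooth_v sm); lra.
      exact: d_shift1.
    move=> x y x0 xy yX; have := pot (x + pi) (y + pi).
    rewrite /energy_le (_ : y + pi - (x + pi) = y - x); last by ring.
    rewrite !(smooth_halfline sm) ?lerDr ?(le_trans x0)//.
    by apply; lra.
  by rewrite add0r; have := Ac (X + pi); lra.
by split=> //; lra.
Qed.

Let iv1 : mu.-integrable halfline (EFin \o (fun x => v1 (x + pi) ^+ 2)).
Proof. by have [c1 [c2 []]] := dirichlet. Qed.

Let iv : mu.-integrable halfline (EFin \o (fun x => v (x + pi) ^+ 2)).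
Proof.
have := iWh; apply: eq_integrable => // x; rewrite inE => /halflineE x0 /=.
by rewrite (smooth_halfline sm) ?lerDr ?ltW.
Qed.

Let Wpi : W pi = W (- pi). Proof. by case: bW. Qed.

Let u_circ x : - pi <= x -> x <= pi -> u x = W x.
Proof. by move=> h1 h2; rewrite (smooth_circle sm). Qed.

Let v_half x : pi <= x -> v x = W x.
Proof. by move=> h; rewrite (smooth_halfline sm). Qed.

Let bc1 m : (lift m u v).1 pi = (lift m u v).1 (- pi).
Proof. by have := @pi_itv R => /ltW h; rewrite /= !u_circ// Wpi. Qed.

Let bc2 m : (lift m u v).1 (- pi) = (lift m u v).2 0.
Proof. by have := @pi_itv R => /ltW h; rewrite /= u_circ// add0r v_half// Wpi. Qed.

Let circ_sub x : circ x -> `](- pi), x]%classic `<=` @circ R.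
Proof.
move=> /circE[h1 h2] t /=; rewrite in_itv/= => /andP[h3 h4].
by apply/circE; split=> //; exact: le_lt_trans h2.
Qed.

Let halfline_sub x : halfline x -> `]0, x]%classic `<=` @halfline R.
Proof. by move=> _ t /=; rewrite in_itv/= => /andP[h _]; exact/halflineE. Qed.

Let o_circ : open (@circ R). Proof. exact: interval_open. Qed.
Let o_half : open (@halfline R). Proof. exact: interval_open. Qed.

Let lift_circ m : [/\ in_H2 circ (lift m u v).1 (lift m u1 v1).1,
  {ae mu, forall x, circ x -> (m * force x)%:C = (laplacian (lift m u v)).1 x} &
  (\int[mu]_(x in circ) (cabs ((grad (lift m u v)).1 x) ^+ 2)%:E)%E =
    (\int[mu]_(x in circ) (m * u1 x) ^+ 2)%:E].
Proof.
have cu := smooth_cu sm; have cu1 := smooth_cu1 sm.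
have d x : - pi <= x -> is_derive x 1 (fun t => m * u t) (m * u1 x).
  by move=> px; apply: d_scale; apply: (smooth_u sm); lra.
have d1 x : - pi <= x -> is_derive x 1 (fun t => m * u1 t) (m * force x).
  by move=> px; apply: d_scale; apply: (smooth_u1 sm); lra.
have c := @c_scale m _ cu; have c1 := @c_scale m _ cu1; have c2 := @c_scale m _ cforce.
have i := @i_circ m _ cu; have i1 := @i_circ m _ cu1; have i2 := @i_circ m _ cforce.
split; first exact: (classical_in_H2 circ_gt mc c c1 c2 d d1 i i1 i2).
  exact: (classical_laplacian o_circ circ_gt circ_sub mc c1 c2 d d1 i1 i2).
exact: (classical_dirichlet o_circ circ_gt circ_sub mc c1 d i1).
Qed.

Let lift_half m : [/\ in_H2 halfline (lift m u v).2 (lift m u1 v1).2,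
  {ae mu, forall x, halfline x -> (m * force (x + pi))%:C = (laplacian (lift m u v)).2 x} &
  (\int[mu]_(x in halfline) (cabs ((grad (lift m u v)).2 x) ^+ 2)%:E)%E =
    (\int[mu]_(x in halfline) (m * v1 (x + pi)) ^+ 2)%:E].
Proof.
have d x : 0 <= x -> is_derive x 1 (fun t => m * v (t + pi)) (m * v1 (x + pi)).
  by move=> px; apply: d_shift; apply: (smooth_v sm); have := pi0; lra.
have d1 x : 0 <= x -> is_derive x 1 (fun t => m * v1 (t + pi)) (m * force (x + pi)).
  by move=> px; apply: d_shift; apply: (smooth_v1 sm); have := pi0; lra.
have c := @c_shift m _ (smooth_cv sm); have c1 := @c_shift m _ (smooth_cv1 sm).
have c2 := @c_shift m _ cforce.
have i := @i_half_scale m _ iv; have i1 := @i_half_scale m _ iv1; have i2 := @i_half_scale m _ iforce_half.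
split; first exact: (classical_in_H2 halfline_gt mh c c1 c2 d d1 i i1 i2).
  exact: (classical_laplacian o_half halfline_gt halfline_sub mh c1 c2 d d1 i1 i2).
exact: (classical_dirichlet o_half halfline_gt halfline_sub mh c1 d i1).
Qed.

Lemma lift_H1C m : H1C (lift m u v).
Proof.
have [[h1 _ _] _ _] := lift_circ m; have [[h2 _ _] _ _] := lift_half m.
by split.
Qed.

Lemma lift_H2NK m : H2NK (lift m u v).
Proof.
have [h1 _ _] := lift_circ m; have [h2 _ _] := lift_half m.
exists (lift m u1 v1); split=> //; rewrite /= add0r -(smooth_kirchhoff sm).
by rewrite mulrBr rmorphB.
Qed.

(** After division by m the force reads a W - nu W^5, and nu W^5 = 3 (m W)^4 W. *)
Lemma lift_NLS m : 0 <= m -> 3 * m ^+ 4 = nu -> stationary_NLS (- a) (lift m u v).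
Proof.
move=> m0 mnu.
have eqn w f : force w = f -> - (m * f)%:C - 3%:R * (cabs (m * W w)%:C ^+ 4)%:C * (m * W w)%:C =
    (- a)%:C * (m * W w)%:C :> R[i].
  move=> <-; rewrite cabs_real ger0_norm ?mulr_ge0// /force.
  have -> : 3%:R = (3%:R)%:C :> R[i] by rewrite rmorph_nat.
  by rewrite -!rmorphM -rmorphN -rmorphB /=; congr (_%:C); rewrite -mnu; ring.
split.
  have [_ lap _] := lift_circ m; move: lap; apply: filterS; first exact: (ae_filter_ringOfSetsType mu).
  move=> x /= h cx; rewrite -(h cx); case/circE: cx => /ltW h1 /ltW h2.
  by rewrite u_circ//; exact: eqn.
have [_ lap _] := lift_half m; move: lap; apply: filterS; first exact: (ae_filter_ringOfSetsType mu).
move=> x /= h cx; rewrite -(h cx); move/halflineE: cx => /ltW x0.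
by rewrite v_half ?lerDr//; exact: eqn.
Qed.

Lemma lift_power_sum m q : 0 <= m ->
  power_sum q (lift m u v) = (\int[mu]_(x in E) ((m * W x) ^+ q)%:E)%E.
Proof.
move=> m0; rewrite (tadpole_integral (@pi_itv R)).
- congr (_ + _)%E; apply: eq_integral => x; rewrite inE.
    move=> /circE[/ltW h1 /ltW h2]; rewrite /lift cabs_real u_circ//.
    by rewrite ger0_norm ?mulr_ge0.
  move=> /halflineE/ltW x0; rewrite /lift cabs_real v_half ?lerDr//.
  by rewrite ger0_norm ?mulr_ge0.
- move=> x; apply: (@continuous_comp _ _ _ (fun t => m * W t) (fun x : R => x ^+ q)).
    exact: c_scale.
  exact: exprn_continuous.
- by move=> x; rewrite exprn_ge0// mulr_ge0.
Qed.

Lemma lift_B_form m : 0 <= m -> B_form (- a) (lift m u v) <= m ^+ 2.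
Proof.
move=> m0; rewrite B_formE mulNr opprK.
have [c1 [c2 [h1 i2 h2 h12]]] := dirichlet.
have -> : power_sum 2 (grad (lift m u v)) = (m ^+ 2 * \int[mu]_(x in circ) u1 x ^+ 2 +
    m ^+ 2 * \int[mu]_(x in halfline) v1 (x + pi) ^+ 2)%:E.
  have [_ _ g1] := lift_circ m; have [_ _ g2] := lift_half m.
  have i1 := i_circ1 (smooth_cu1 sm).
  rewrite /power_sum g1 g2 -!RintegralZl// -EFinD; congr (_ + _)%:E;
    by apply: eq_Rintegral => x _; rewrite exprMn.
have -> : fine (power_sum 2 (lift m u v)) = m ^+ 2 * \int[mu]_(x in E) W x ^+ 2.
  rewrite lift_power_sum// -RintegralZl//; last by case: bW.
  by congr fine; apply: eq_integral => x _; rewrite exprMn.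
rewrite /= mulrCA -!mulrDr -[leRHS]mulr1 ler_wpM2l ?sqr_ge0//.
lra.
Qed.

End Profile.

(** * The minimizer *)

Lemma powR_root (R : realType) (n : nat) (x : R) : (0 < n)%N -> 0 <= x -> (x `^ (n%:R^-1)) ^+ n = x.
Proof.
move=> n0 x0; rewrite -powR_mulrn ?powR_ge0// -powRrM mulVf ?pnatr_eq0 -?lt0n//.
exact: powRr1.
Qed.

Theorem theorem1p1 (R : realType) (omega : R) (omega_lt0 : omega < 0) :
  exists Psi : tfun R,
    is_global_minimizer omega Psi /\
    let Phi := tscale ((3%:R^-1 * B_inf omega) `^ (4%:R^-1))%:C Psi in
    strong_solution omega Phi /\
    exists (z : R[i]) (u v : R -> R),
      cabs z = 1 /\
      (forall x, `[(- pi), pi]%classic x -> Phi.1 x = z * (u x)%:C) /\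
      (forall x, `[0, +oo[%classic x -> Phi.2 x = z * (v x)%:C) /\
      (forall x, `[(- pi), pi]%classic x -> 0 < u x) /\
      (forall x, `[0, +oo[%classic x -> 0 < v x) /\
      (forall x, `[(- pi), pi]%classic x -> u (- x) = u x) /\
      strictly_decreasing_on `[0, pi]%classic u /\
      strictly_decreasing_on `[0, +oo[%classic v.
Proof.
have a0 : 0 < - omega by rewrite oppr_gt0.
have omegaE : omega = - - omega by rewrite opprK.
move: (- omega) a0 omegaE => a a0 omegaE.
have pi0 : 0 < pi :> R := pi_gt0 R.
have [W [bW maxW W0 evenW nincrW]] := exists_maximizer a0 pi0.
have [u [u1 [v [v1 sm]]]] := maximizer_smooth a0 pi0 bW maxW.
have k0 := best_gt0 a0 pi0.
have le_best F j : budget a (- pi) pi F j -> sextic (- pi) F <= best a pi * j ^+ 3.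
  exact: sextic_le_best.
move: (best a pi) k0 maxW sm le_best => k k0 maxW sm le_best.
have W6 : sextic (- pi) W = k.
  by apply/eqP; rewrite eq_le maxW andbT; have := le_best W 1 bW; rewrite expr1n mulr1.
have nu0 : 0 < k^-1 by rewrite invr_gt0.
have iW : (@lebesgue_measure R).-integrable `](- pi), +oo[ (EFin \o (fun x => W x ^+ 2)) by case: bW.
have Wneq0 : exists2 x, - pi <= x & W x != 0.
  apply: contrapT => noW; move: k0; rewrite -W6 /sextic.
  rewrite (_ : Rintegral _ _ _ = 0) ?ltxx//.
  transitivity (\int[@lebesgue_measure R]_(x in `](- pi), +oo[) (0 : R)).
    apply: eq_Rintegral => x; rewrite inE/= in_itv/= andbT => /ltW px.
    have -> : W x = 0 by apply/eqP/negPn/negP => Wx; apply: noW; exists x.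
    by rewrite expr0n.
  by rewrite Rintegral_cst// mul0r.
have Wgt0 := smooth_gt0 a0 nu0 pi0 sm W0 evenW nincrW iW Wneq0.
have Wdecr := smooth_decreasing a0 nu0 pi0 sm W0 evenW nincrW iW Wneq0.
have uW x : - pi <= x -> x <= pi -> u x = W x by move=> *; rewrite (smooth_circle sm).
have vW x : 0 <= x -> v (x + pi) = W (x + pi) by move=> ?; rewrite (smooth_halfline sm) ?lerDr.
have p6 : (0 < 6)%N by []. have p4 : (0 < 4)%N by []. have p3 : (0 < 3)%N by [].
(* The exponent makes the sextic integral of s W equal to 1. *)
pose s := k^-1 `^ (6%:R^-1).
have s0 : 0 <= s by exact: powR_ge0.
have s6 : s ^+ 6 = k^-1 by rewrite powR_root// ltW.
pose Psi := lift s u v.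
have cPsi : constraint_set Psi.
  split; first exact: (lift_H1C a0 bW sm).
  apply/(Lqnorm_eq1 _ p6).
  rewrite (lift_power_sum bW W0 sm)// integral_eq_Rintegral//; last first.
    exact: (budget_sextic_integrable a0 (budget_scale s bW)).
  by rewrite -/(sextic (- pi) (fun x => s * W x)) (sextic_scale a0 s bW) s6 W6 mulVf ?gt_eqF.
have leb U : constraint_set U -> s ^+ 2 <= B_form omega U.
  move=> /(constraint_budget omega_lt0); rewrite [in - omega]omegaE opprK => -[bU sU].
  have B0 := budget_ge0 a0 bU.
  rewrite -(ler_pXn2r p3) ?nnegrE ?sqr_ge0// -exprM s6 -div1r ler_pdivrMr// mulrC.
  by rewrite -sU; exact: le_best bU.
have Psib : B_form omega Psi = s ^+ 2.
  apply/eqP; rewrite eq_le leb// andbT omegaE.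
  exact: (lift_B_form a0 bW W0 sm s0).
have minPsi : is_global_minimizer omega Psi.
  by split=> // U /leb; rewrite Psib.
have infB : B_inf omega = s ^+ 2.
  apply/eqP; rewrite eq_le; apply/andP; split.
    rewrite -Psib; apply: ge_inf; last by exists Psi.
    by exists (s ^+ 2) => _ [U cU <-]; exact: leb.
  by apply: lb_le_inf; [exists (B_form omega Psi); exists Psi|move=> _ [U cU <-]; exact: leb].
exists Psi; split=> //; rewrite infB.
set c := _ `^ _; have c0 : 0 <= c by exact: powR_ge0.
have c4 : c ^+ 4 = 3%:R^-1 * s ^+ 2 by rewrite powR_root// mulr_ge0 ?invr_ge0 ?sqr_ge0.
pose m := c * s.
have mE y : c%:C * (s * y)%:C = (m * y)%:C by rewrite -rmorphM mulrA.
have scaleE : tscale c%:C Psi = lift m u v by congr pair; apply/funext => x; exact: mE.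
rewrite /= scaleE; split.
  split; first exact: (lift_H2NK a0 bW sm).
  rewrite omegaE; apply: (lift_NLS a0 bW W0 sm); first exact: mulr_ge0.
  (* 3 (c s)^4 = s^2 s^4 = s^6, which is the coefficient of W^5. *)
  by rewrite exprMn c4 -s6; field.
have sgt0 : 0 < s by rewrite powR_gt0.
have m0 : 0 < m by rewrite mulr_gt0// powR_gt0// mulr_gt0 ?invr_gt0 ?exprn_gt0.
exists 1, (fun x => m * u x), (fun x => m * v (x + pi)).
have circ_itv x : `[(- pi), pi]%classic x -> - pi <= x /\ x <= pi :> R.
  by rewrite /= in_itv/= => /andP.
have half_itv x : `[0, +oo[%classic x -> 0 <= x :> R by rewrite /= in_itv/= andbT.
split; first by rewrite (cabs_real 1 : cabs 1 = _) normr1.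
split; first by move=> x _; rewrite mE mul1r.
split; first by move=> x _; rewrite mE mul1r.
split; first by move=> x /circ_itv[h1 h2]; rewrite uW// mulr_gt0.
split; first by move=> x /half_itv x0; rewrite vW// mulr_gt0.
split; first by move=> x /circ_itv[h1 h2]; rewrite !uW ?evenW// ?lerN2// lerNl.
split=> x y.
  rewrite /= !in_itv/= => /andP[x0 xpi] /andP[y0 ypi] xy.
  by rewrite ltr_pM2l// !uW ?Wdecr//; lra.
by move=> /half_itv x0 /half_itv y0 xy; rewrite ltr_pM2l// !vW// Wdecr ?ltrD2r// addr_ge0// ltW.
Qed.
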